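(* The finite Hilbert transform $T$ maps $L\log L$ into $L^1$, and $T\colon L\log L\to L^1$ is a bounded linear operator.
   Context: All functions are complex-valued, Lebesgue measurable on $(-1,1)$, identified when equal a.e.; $L^1=L^1(-1,1)$. The decreasing rearrangement of $f$ is $f^*(t)=\inf\{\lambda\ge 0: |\{x\in(-1,1):|f(x)|>\lambda\}|\le t\}$, $0<t<2$. The Zygmund space $L\log L=L\log L(-1,1)$ consists of all measurable $f$ with $\|f\|_{L\log L}:=\int_0^2 f^*(t)\log\big(\tfrac{2e}{t}\big)\,dt<\infty$ (equivalently $\int_{-1}^1|f|\log^+|f|<\infty$), with this norm; it is contained in $L^1$. For $f\in L^1$ the finite Hilbert transform is $$T(f)(t)=\lim_{\varepsilon\to0^+}\frac1\pi\Big(\int_{-1}^{t-\varepsilon}+\int_{t+\varepsilon}^1\Big)\frac{f(x)}{x-t}\,dx ,$$ which exists for a.e. $t\in(-1,1)$ and is measurable. *)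

(* Defs.v *)
From HB Require Import structures.
From mathcomp Require Import all_boot all_order all_algebra.
From mathcomp Require Import complex.
From mathcomp Require Import all_classical all_reals all_analysis.
Set Implicit Arguments.
Unset Strict Implicit.
Unset Printing Implicit Defensive.
Import Order.TTheory GRing.Theory Num.Theory ComplexField.
Import numFieldNormedType.Exports.
Local Open Scope classical_set_scope.
Local Open Scope ring_scope.
Local Open Scope complex_scope.

Section FiniteHilbertTransform.
Variable R : realType.

(* [R] with the Lebesgue sigma-algebra, i.e. the Caratheodory sigma-algebra of
   the outer measure generated by interval length.  The library's
   [measurableTypeR R] only has the Borel sets. *)
Definition LebesgueR := caratheodory_type (wlength (@idfun R))^*%mu.

Definition leb : {measure set LebesgueR -> \bar R} :=
  @completed_lebesgue_measure R.

Definition I11 : set LebesgueR := `]-1, 1[%classic.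

(* Complex-valued functions on (-1, 1) are represented by total functions on
   the line whose values off (-1, 1) are never used.  Identification of a.e.
   equal functions is handled by [%[ae leb in I11]]. *)
Implicit Types (f g : LebesgueR -> R[i]) (D : set LebesgueR).

Definition cmeasurable D f :=
  measurable_fun D (fun x => complex.Re (f x)) /\
  measurable_fun D (fun x => complex.Im (f x)).

Definition cintegral D f : R[i] :=
  (\int[leb]_(x in D) complex.Re (f x)) +i*
  (\int[leb]_(x in D) complex.Im (f x)).

Definition L1norm f : \bar R :=
  (\int[leb]_(x in I11) (Normc.normc (f x))%:E)%E.

Definition in_L1 f := cmeasurable I11 f /\ (L1norm f < +oo)%E.

(* Taken in the extended reals, so that the infimum of the empty set is [+oo]
   and not the default real value 0. *)
Definition rearrangement f (t : R) : \bar R :=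
  ereal_inf [set l%:E | l in [set l : R |
    0 <= l /\
    (leb [set x | I11 x /\ (l < Normc.normc (f x))%R] <= t%:E)%E]].

Definition LlogLnorm f : \bar R :=
  (\int[leb]_(t in `]0%R, 2%R[%classic)
     (rearrangement f t * (ln (2 * expR 1 / t))%:E))%E.

Definition in_LlogL f := cmeasurable I11 f /\ (LlogLnorm f < +oo)%E.

(* [R[i]^o] is [R[i]] carrying the topology given by the modulus. *)
Definition truncated_fht f (t eps : R) : R[i]^o :=
  (pi^-1)%:C *
  (cintegral `]-1, t - eps[%classic (fun x => f x / ((x : R) - t)%:C) +
   cintegral `]t + eps, 1[%classic (fun x => f x / ((x : R) - t)%:C)).

(* [lim] takes a default value when the limit does not exist, hence the
   separate predicate. *)
Definition fht_exists f (t : R) := cvg (truncated_fht f t eps @[eps --> 0^'+]).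

Definition fht f (t : LebesgueR) : R[i] :=
  lim (truncated_fht f t eps @[eps --> 0^'+]).

End FiniteHilbertTransform.

(* Main.v *)
(* Write [phi s = s ln (1 + s)] and let [Q_e f], [P_e f] be the conjugate Poisson and
   Poisson integrals at height [e] of [f], a function supported in (-1, 1).
   If [`|g| <= 1] has bounded support, then [F = Q_e g + i P_e g] is a superposition of
   the functions [t |-> 1 / (u - t - i e)], whose poles lie in one half-plane, so
   [F^m] has integral zero for [m >= 2].  As [`|P_e g| <= pi], the real parts for even
   [m] bound all even moments of [Q_e g], and [exp (delta `|Q_e g|)] is integrable
   over (-1, 1) uniformly in [e].  By duality and Young's inequality
   [s r <= phi s + exp r], the [L^1] norm of [Q_e f] is bounded uniformly in [e] by
   [l / delta * (A + 64)] as soon as [phi (`|f| / l)] has integral at most [A].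
   The integral truncated at [e] differs from [Q_e f] by at most [P_e `|f|], so the
   same kind of bound holds for it.  With [P_a Q_d f = pi Q_(a+d) f] and the
   Hardy-Littlewood inequality the [L^1] bound gives a weak bound on the maximal
   truncated integral; a.e. convergence then follows by approximation from intervals,
   via Borel sets and simple functions, and Fatou's lemma bounds the limit.
   Finally [phi (`|f| / l)] has integral at most 4 when the norm of [f] in L log L is
   at most [l], by a layer-cake computation with the measures of [`|f| > k l].
   The analysis is done for Borel functions; a Lebesgue measurable function is
   replaced by an a.e. equal Borel function. *)

(* The moment bounds grow like [(C n)^(2 n)], which is just what division by [(2 n)!] absorbs; this
   is why an exponential of [Q_e g], and hence [L log L] on the dual side, is the natural endpoint.
   The vanishing of the integral of [F^m] is obtained without contour integration: the resolvent
   identity splits a product of two Cauchy kernels with distinct poles, and an induction carries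
   this to powers of [F]. Coinciding poles are excluded, so Fubini is needed in a form that ignores
   a null set of densities. The modular is not homogeneous. The scale [l] therefore stays free
   throughout: for fixed [A] all bounds are linear in [l], and approximation at every scale [l]
   makes the weak bound as small as wished. The maximal function is applied to [Q_d f] cut off to
   [(-3, 3)]; elsewhere [Q_d f] is bounded by half the [L^1] norm of [f]. The [L^1] bound holds for
   each [d] separately and no limit as [d] tends to 0 is known at that stage, so the exceptional
   sets of the heights [d] are combined by a lower limit, which keeps their common measure bound. *)
Require Import Defs.
From HB Require Import structures.
From mathcomp Require Import all_boot all_order all_algebra.
From mathcomp Require Import complex.
From mathcomp Require Import all_classical all_reals all_analysis.
From mathcomp Require Import measurable_realfun.
From mathcomp Require Import ring lra.
Set Implicit Arguments.
Unset Strict Implicit.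
Unset Printing Implicit Defensive.
Import Order.TTheory GRing.Theory Num.Theory.
Import numFieldNormedType.Exports.
Import HBNNSimple.
Local Open Scope classical_set_scope.
Local Open Scope ring_scope.
Local Open Scope complex_scope.
Local Notation Re := complex.Re.
Local Notation Im := complex.Im.
Local Notation normc := Normc.normc.

(** * Integrals with a kernel *)

Section Fubini.
Context {R : realType}.
Local Notation mu := (@lebesgue_measure R).
Local Notation integr f := (mu.-integrable [set: measurableTypeR R] (EFin \o f)).
Implicit Types (f g p : R -> R).

Lemma le_integrable_real f p : measurable_fun setT f -> integr p ->
  (forall x, `|f x| <= p x) -> integr f.
Proof.
move=> mf ip fp; apply: (le_integrable _ _ _ ip) => //.
  exact/measurable_EFinP.
by move=> x _ /=; rewrite lee_fin (le_trans (fp x))// ler_norm.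
Qed.

Lemma integrZ (k : R) f : integr f -> integr (fun x => k * f x).
Proof. by move=> /(integrableZl measurableT k); apply: eq_integrable. Qed.

Lemma integrD f g : integr f -> integr g -> integr (fun x => f x + g x).
Proof. by move=> If Ig; have := integrableD measurableT If Ig; apply: eq_integrable. Qed.

Lemma integrB f g : integr f -> integr g -> integr (fun x => f x - g x).
Proof. by move=> If Ig; have := integrableB measurableT If Ig; apply: eq_integrable. Qed.

Lemma integr_norm f : integr f -> integr (fun x => `|f x|).
Proof. by move=> If; exact: (@integrable_norm _ _ _ mu). Qed.

Lemma integr_measurable f : integr f -> measurable_fun setT f.
Proof. by move=> /integrableP[/measurable_EFinP]. Qed.

Lemma measurable_kernel1 (K : R * R -> R) (u : R) : measurable_fun setT K ->
  measurable_fun setT (fun t => K (u, t)).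
Proof. by move=> mK; apply: measurableT_comp. Qed.

Lemma measurable_kernel2 (K : R * R -> R) (t : R) : measurable_fun setT K ->
  measurable_fun setT (fun u => K (u, t)).
Proof. by move=> mK; apply: measurableT_comp. Qed.

Section kernel.
Variables (g p : R -> R) (K : R * R -> R).
Hypotheses (ig : integr g) (ip : integr p).
Hypothesis mK : measurable_fun [set: measurableTypeR R * measurableTypeR R] K.
Hypothesis gK : forall u t, `|g u * K (u, t)| <= `|g u| * p t.

Let mg : measurable_fun setT g.
Proof. exact: integr_measurable. Qed.
Let mp : measurable_fun setT p.
Proof. exact: integr_measurable. Qed.

Let mgK : measurable_fun setT (fun z : measurableTypeR R * measurableTypeR R => g z.1 * K z).
Proof. by apply: measurable_funM => //; apply: measurableT_comp. Qed.

Let igK : (mu \x mu)%E.-integrable setT (fun z => (g z.1 * K z)%:E).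
Proof.
apply/integrable12ltyP; first exact/measurable_EFinP.
apply: (@le_lt_trans _ _ (\int[mu]_x (`|(g x)%:E| * \int[mu]_t `|(p t)%:E|)))%E.
  apply: ge0_le_integral => //.
  - by move=> x _; exact: integral_ge0.
  - have := @measurable_fun_fubini_tonelli_F _ _ _ _ R mu
      (fun z : measurableTypeR R * measurableTypeR R => `|(g z.1 * K z)%:E|%E).
    apply; last by move=> ?; rewrite abse_ge0.
    by apply: measurableT_comp => //; exact/measurable_EFinP.
  - apply: emeasurable_funM; last exact: measurable_cst.
    by apply: measurableT_comp => //; exact/measurable_EFinP.
  - move=> x _; rewrite -ge0_integralZl//; last first.
      by apply: measurableT_comp => //; exact/measurable_EFinP.
    apply: ge0_le_integral => //.
    + apply: measurableT_comp => //; apply/measurable_EFinP.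
      apply: measurable_funM => /=; first exact: measurable_cst.
      exact: (@measurable_kernel1 K x mK).
    + apply: measurable_funeM.
      by apply: measurableT_comp => //; exact/measurable_EFinP.
    + move=> t _ /=; rewrite lee_fin (le_trans (gK _ _))// ler_wpM2l//.
      exact: ler_norm.
rewrite ge0_integralZr//.
- case/integrableP : ig => _ ?; case/integrableP : ip => _ ?.
  apply: lte_mul_pinfty => //; first exact: integral_ge0.
  by rewrite ge0_fin_numE//; exact: integral_ge0.
- by apply: measurableT_comp => //; exact/measurable_EFinP.
- exact: integral_ge0.
Qed.

Hypothesis pK : forall t, exists C, forall u, `|K (u, t)| <= C.

Lemma integrable_kernel2 t : integr (fun u => g u * K (u, t)).
Proof.
have [C KC] := pK t.
apply: (@le_integrable_real _ (fun u => C * `|g u|)) => //.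
- by apply: measurable_funM => //; exact: measurable_kernel2.
- exact/integrZ/integr_norm.
- by move=> u; rewrite normrM mulrC ler_wpM2r.
Qed.

Let kernel_intE : EFin \o (fun t => \int[mu]_u (g u * K (u, t))) =
  fubini_G mu (fun z => (g z.1 * K z)%:E).
Proof.
apply/funext => t /=; rewrite /Rintegral fineK//.
by apply: integrable_fin_num => //; exact: integrable_kernel2.
Qed.

Lemma measurable_kernel_int : measurable_fun setT (fun t => \int[mu]_u (g u * K (u, t))).
Proof. by apply/measurable_EFinP; rewrite kernel_intE; exact: measurable_fubini_G igK. Qed.

Lemma kernel_int_le t : `|\int[mu]_u (g u * K (u, t))| <= (\int[mu]_u `|g u|) * p t.
Proof.
rewrite (le_trans (le_normr_Rintegral _ _))//; first exact: integrable_kernel2.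
rewrite -RintegralZr//; last exact: integr_norm.
apply: le_Rintegral => //.
- exact/integr_norm/integrable_kernel2.
- under eq_fun do rewrite mulrC; exact/integrZ/integr_norm.
Qed.

Lemma Fubini_kernel : \int[mu]_t (\int[mu]_u (g u * K (u, t))) =
   \int[mu]_u (g u * \int[mu]_t (K (u, t))).
Proof.
rewrite {1}/Rintegral -/(EFin \o _) [X in fine (integral _ _ X)](_ : _ =
  fubini_G mu (fun z => (g z.1 * K z)%:E)); last exact: kernel_intE.
rewrite -(Fubini igK) /Rintegral; congr fine.
apply: eq_integral => u _ /=; have [->|gu0] := eqVneq (g u) 0.
  by under eq_integral do rewrite mul0r; rewrite integral0 mul0r.
have iK : integr (fun t => K (u, t)).
  apply: (@le_integrable_real _ p) => //; first exact: measurable_kernel1.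
  by move=> t; move: (gK u t); rewrite normrM ler_pM2l// normr_gt0.
under eq_integral do rewrite EFinM.
rewrite integralZl// EFinM fineK//.
exact: integrable_fin_num.
Qed.

(** The null set [N] is there for the poles that coincide with a given one: integrals of products of
    Cauchy kernels are computed by a resolvent identity that divides by the difference of the
    poles. *)
Lemma Fubini_kernel0 (N : set R) : mu.-negligible N ->
  (forall u, ~ N u -> g u <> 0 -> \int[mu]_t K (u, t) = 0) ->
  \int[mu]_t (\int[mu]_u (g u * K (u, t))) = 0.
Proof.
move=> N0 NK.
rewrite {1}/Rintegral -/(EFin \o _) [X in fine (integral _ _ X)](_ : _ =
  fubini_G mu (fun z => (g z.1 * K z)%:E)); last exact: kernel_intE.
rewrite -(Fubini igK) (_ : 0 = fine (\int[mu]_u cst 0%E u)%E); last first.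
  by rewrite integral0.
congr fine; apply: ae_eq_integral => //.
  exact: (measurable_fubini_F igK).
apply: (negligibleS _ N0) => u /=; apply: contra_notP => Nu _; rewrite /fubini_F /=.
have [->|/eqP gu0] := eqVneq (g u) 0.
  by under eq_integral do rewrite mul0r; rewrite integral0.
have iK : integr (fun t => K (u, t)).
  apply: (@le_integrable_real _ p) => //; first exact: measurable_kernel1.
  by move=> t; move: (gK u t); rewrite normrM ler_pM2l// normr_gt0; apply/eqP.
under eq_integral do rewrite EFinM.
rewrite integralZl// -[X in (_ * X)%E]fineK; last exact: integrable_fin_num.
by have := NK u Nu gu0; rewrite /Rintegral => ->; rewrite mule0.
Qed.

End kernel.
End Fubini.

(** * Integrals over the line from a primitive *)

Section line_integrals.
Context {R : realType}.
Local Notation mu := (@lebesgue_measure R).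
Local Notation integr f := (mu.-integrable [set: measurableTypeR R] (EFin \o f)).
Implicit Types (f g p F : R -> R).

Lemma FTC_line f F (L : R) : continuous f -> integr f ->
  (forall x : R, is_derive x 1 F (f x)) ->
  (F n%:R - F (- n%:R)) @[n --> \oo] --> L -> \int[mu]_x f x = L.
Proof.
move=> cf If dF FL.
have mf := integr_measurable If.
pose f_ n := EFin \o (f \_ `[(- n%:R)%R, n%:R%R]).
(* The shift to [n.+1] keeps the interval nondegenerate, as [continuous_FTC2] demands. *)
have E n : (\int[mu]_x f_ n.+1 x = (F n.+1%:R - F (- n.+1%:R))%:E)%E.
  rewrite /f_ -restrict_EFin -integral_mkcond (@continuous_FTC2 _ f F)//.
  - by rewrite gtrN.
  - exact: continuous_subspaceT.
  - split=> [x _||].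
    + by have [] := dF x.
    + apply: cvg_at_right_filter; apply: differentiable_continuous.
      by apply/derivable1_diffP; have [] := dF (- n.+1%:R).
    + apply: cvg_at_left_filter; apply: differentiable_continuous.
      by apply/derivable1_diffP; have [] := dF (n.+1%:R).
  - by move=> x _; rewrite derive1E; have [] := dF x.
have [] := @dominated_convergence _ _ _ mu setT measurableT f_ (EFin \o f)
  (EFin \o (fun x => `|f x|)).
- move=> n; apply/measurable_EFinP; apply/(measurable_restrictT _ _).1 => //.
  exact: measurable_funTS.
- exact/measurable_EFinP.
- apply: aeW => x _; apply: cvg_near_cst; near=> n.
  rewrite /f_ /= patchE mem_set//= in_itv/=.
  rewrite -ler_norml; near: n; exact: nbhs_infty_ger.
- exact: integr_norm.
- apply: aeW => x n _; rewrite /f_ /= patchE; case: ifPn => // _.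
  by rewrite normr0 lee_fin.
move=> _ _ H.
rewrite /Rintegral.
have : (\int[mu]_x f_ n.+1 x)%E @[n --> \oo] --> L%:E.
  under eq_cvg do rewrite E.
  apply: cvg_EFin; first exact: nearW.
  by move: FL; rewrite -cvg_shiftS.
move: H; rewrite -cvg_shiftS => H /(cvg_unique _ H).
by move=> /= ->.
Unshelve. all: by end_near. Qed.
End line_integrals.

(** * Poisson and conjugate Poisson kernels *)

Section kernels.
Context {R : realType}.
Local Notation mu := (@lebesgue_measure R).
Local Notation integr f := (mu.-integrable [set: measurableTypeR R] (EFin \o f)).
Implicit Types (u v s t e x y : R).

Definition qk e u t : R := (u - t) / ((u - t) ^+ 2 + e ^+ 2).
Definition pk e u t : R := e / ((u - t) ^+ 2 + e ^+ 2).

Lemma denom_gt0 e u t : 0 < e -> 0 < (u - t) ^+ 2 + e ^+ 2.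
Proof. by move=> e0; rewrite ltr_wpDl ?sqr_ge0// exprn_gt0. Qed.

Lemma continuous_denom e u : continuous (fun t => (u - t) ^+ 2 + e ^+ 2).
Proof.
move=> t; apply: cvgD; last exact: cvg_cst.
apply: (@cvgM _ _ _ _ (fun t => u - t) (fun t => u - t)).
all: by apply: cvgB; [exact: cvg_cst|exact: cvg_id].
Qed.

Lemma continuous_qk e u : 0 < e -> continuous (qk e u).
Proof.
move=> e0 t; apply: cvgM; first by apply: cvgB; [exact: cvg_cst|exact: cvg_id].
by apply: cvgV; [rewrite gt_eqF// denom_gt0|exact: continuous_denom].
Qed.

Lemma continuous_pk e u : 0 < e -> continuous (pk e u).
Proof.
move=> e0 t; apply: cvgM; first exact: cvg_cst.
by apply: cvgV; [rewrite gt_eqF// denom_gt0|exact: continuous_denom].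
Qed.

Lemma pk_ge0 e u t : 0 < e -> 0 <= pk e u t.
Proof. by move=> e0; rewrite divr_ge0 ?ltW// denom_gt0. Qed.

Lemma pk_le e u t : 0 < e -> pk e u t <= e^-1.
Proof.
move=> e0; rewrite ler_pdivrMr ?denom_gt0// ler_pdivlMl//.
by rewrite -expr2 lerDr sqr_ge0.
Qed.

Lemma qk_le e u t : 0 < e -> `|qk e u t| <= e^-1.
Proof.
move=> e0; rewrite normrM normfV (gtr0_norm (denom_gt0 _ _ e0)).
rewrite ler_pdivrMr ?denom_gt0// ler_pdivlMl//.
rewrite -(real_normK (num_real (u - t))); nra.
Qed.

Lemma pkC e u t : pk e u t = pk e t u.
Proof. by rewrite /pk -[in RHS]opprB sqrrN. Qed.

Lemma qkC e u t : qk e u t = - qk e t u.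
Proof. by rewrite /qk -(opprB u t) sqrrN mulNr opprK. Qed.

(** The common integrable majorant: every product of two Cauchy kernels is dominated by a multiple
    of it. *)
Definition rho t : R := (1 + t ^+ 2)^-1.

Lemma rho_gt0 t : 0 < rho t. Proof. by rewrite invr_gt0 ltr_wpDr// sqr_ge0. Qed.

Lemma continuous_rho : continuous rho.
Proof.
move=> t; apply: cvgV; first by rewrite gt_eqF// ltr_wpDr// sqr_ge0.
by apply: cvgD; [exact: cvg_cst|exact: exprn_continuous].
Qed.

Lemma integrable_rho : integr rho.
Proof.
apply/integrableP; split.
  by apply/measurable_EFinP; apply: continuous_measurable_fun; exact: continuous_rho.
under eq_integral => t _ do rewrite /= ger0_norm ?ltW ?rho_gt0//.
rewrite ge0_symfun_integralT.
- rewrite -set_itvcy (integral0y_oneDsqr R) -EFinM ltry//.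
- by move=> x; exact/ltW/rho_gt0.
- exact: continuous_rho.
- by move=> x; rewrite /rho/= sqrrN.
Qed.

Lemma denom_rho e u t : 0 < e ->
  ((u - t) ^+ 2 + e ^+ 2)^-1 <= (2 + (1 + 2 * u ^+ 2) / e ^+ 2) * rho t.
Proof.
move=> e0; have e20 : 0 < e ^+ 2 by rewrite exprn_gt0.
rewrite -[X in _ <= X](invrK) lef_pV2 ?posrE ?denom_gt0//; last first.
  rewrite invr_gt0 mulr_gt0 ?rho_gt0//.
  by rewrite ltr_wpDr// divr_ge0 ?ltW// ltr_wpDr// mulr_ge0// sqr_ge0.
set c := (2 + _).
have c2 : 2 <= c by rewrite lerDl divr_ge0 ?ltW// ltr_wpDr// mulr_ge0// sqr_ge0.
rewrite invfM /rho invrK ler_pdivrMl; last lra.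
have ce : c * e ^+ 2 = 2 * e ^+ 2 + (1 + 2 * u ^+ 2).
  by rewrite /c mulrDl divfK ?gt_eqF.
have c1 : 2 * (u - t) ^+ 2 <= c * (u - t) ^+ 2 by rewrite ler_wpM2r// sqr_ge0.
rewrite mulrDr ce (le_trans _ (lerD c1 (lexx _)))//.
(* This square equals [2 (u - t)^2 + 2 u^2 - t^2], so that [1 + t^2] is at most
   [2 (u - t)^2 + 2 u^2 + 1]. *)
have : 0 <= (2 * u - t) ^+ 2 by exact: sqr_ge0.
nra.
Qed.

Lemma integrable_pk e u : 0 < e -> integr (pk e u).
Proof.
move=> e0; set c := (2 + (1 + 2 * u ^+ 2) / e ^+ 2).
apply: (@le_integrable_real _ _ (fun t => (e * c) * rho t)).
- apply: continuous_measurable_fun; exact: continuous_pk.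
- exact/integrZ/integrable_rho.
- by move=> t; rewrite ger0_norm ?pk_ge0// -mulrA; apply: ler_wpM2l (denom_rho _ _ _); rewrite ?ltW.
Qed.

Lemma integral_pk e u : 0 < e -> \int[mu]_t pk e u t = pi.
Proof.
move=> e0; apply: (@FTC_line _ _ (fun t => atan ((t - u) / e))).
- exact: continuous_pk.
- exact: integrable_pk.
- move=> x.
  have H1 : is_derive x 1 (fun t : R => (t - u) / e) (e^-1).
    by apply: is_derive_eq; rewrite ?subr0 ?scaler0 ?add0r ?addr0 ?oppr0 ?scaler1 /GRing.scale/= ?mulr1.
  have H := @is_derive1_comp _ atan (fun t : R => (t - u) / e) x _ _ (is_derive1_atan _) H1.
  eapply is_derive_eq; first exact: H.
  have := denom_gt0 u x e0 => D0; rewrite /pk; field.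
  by rewrite !gt_eqF.
- under eq_fun do rewrite -opprD mulNr atanN opprK.
  have H c : atan ((n%:R + c) / e) @[n --> \oo] --> pi / 2.
    apply: (cvg_comp _ _ _ (@cvgy_atan R)).
    apply/cvgryPge => A; near=> n.
    rewrite ler_pdivlMr// -lerBlDr; near: n; exact: nbhs_infty_ger.
  by rewrite (splitr pi); apply: cvgD; exact: H.
Unshelve. all: by end_near. Qed.

(** A single [qk] decays like [1/t] and is not integrable; a difference decays like [1/t^2]. It is
    the real part of [1/z - 1/w = (w - z) / (z w)] with [z = (x - t) + i e] and [w = (y - t) + i d],
    and [1/|z w|] is bounded through the squares. *)
Lemma abs_qkB_le e d x y t : 0 < e -> 0 < d ->
  `|qk e x t - qk d y t| <=
  (`|x - y| + `|e - d|) * (((x - t) ^+ 2 + e ^+ 2)^-1 + ((y - t) ^+ 2 + d ^+ 2)^-1).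
Proof.
move=> e0 d0; have A0 := denom_gt0 x t e0; have B0 := denom_gt0 y t d0.
set r := x - t in A0 *; set r' := y - t in B0 *.
have -> : qk e x t - qk d y t =
  ((y - x) * (r * r' - e * d) + (e - d) * (- r * d - e * r')) / ((r ^+ 2 + e ^+ 2) * (r' ^+ 2 + d ^+ 2)).
  rewrite /qk -/r -/r' (_ : y - x = r' - r); last by rewrite /r /r'; ring.
  by field; rewrite !gt_eqF.
rewrite normrM normfV [X in _ * X^-1]gtr0_norm; last exact: mulr_gt0.
rewrite -(ler_pM2r (mulr_gt0 A0 B0)) divfK ?gt_eqF ?mulr_gt0//.
rewrite -mulrA (_ : (_^-1 + _^-1) * _ = (r ^+ 2 + e ^+ 2) + (r' ^+ 2 + d ^+ 2)); last first.
  by field; rewrite !gt_eqF.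
rewrite (le_trans (ler_normD _ _))// !normrM (distrC y) [leRHS]mulrDl.
apply: lerD; apply: ler_wpM2l => //.
- have h1 := sqr_ge0 (r - r'); have h2 := sqr_ge0 (e + d).
  have h3 := sqr_ge0 (r + r'); have h4 := sqr_ge0 (e - d).
  have h5 := sqr_ge0 r; have h6 := sqr_ge0 r'; have h7 := sqr_ge0 e; have h8 := sqr_ge0 d.
  rewrite ler_norml; apply/andP; split; nra.
- have h1 := sqr_ge0 (r - d); have h2 := sqr_ge0 (e + r').
  have h3 := sqr_ge0 (r + d); have h4 := sqr_ge0 (e - r').
  have h5 := sqr_ge0 r; have h6 := sqr_ge0 r'; have h7 := sqr_ge0 e; have h8 := sqr_ge0 d.
  rewrite ler_norml; apply/andP; split; nra.
Qed.

Lemma lnB_le (a b : R) : 0 < a -> 0 < b -> ln a - ln b <= (a - b) / b.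
Proof.
move=> a0 b0; rewrite -ln_div ?posrE// (_ : a / b = 1 + (a - b) / b).
  by apply: le_ln1Dx; rewrite mulrBl divff ?gt_eqF// ltrBrDr addNr divr_gt0.
by field; rewrite gt_eqF.
Qed.

(** By [lnB_le] the difference is at most a difference of quadratics, of order [n], over a
    denominator of order [n^2]. This upper bound, applied to both orders of the two logarithms,
    gives the squeeze. *)
Lemma cvg_ln_denomB e d x y : 0 < e -> 0 < d ->
  (ln ((x - n%:R) ^+ 2 + e ^+ 2) - ln ((y - n%:R) ^+ 2 + d ^+ 2)) @[n --> \oo] --> 0.
Proof.
move=> e0 d0.
have H u v (a b : R) : 0 < a -> 0 < b -> exists2 K : R, 0 <= K & forall n : nat,
    ln ((u - n%:R) ^+ 2 + a ^+ 2) - ln ((v - n%:R) ^+ 2 + b ^+ 2) <= K * n.+1%:R^-1.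
  move=> a0 b0; set c := (2 + (1 + 2 * v ^+ 2) / b ^+ 2).
  have c0 : 0 <= c by rewrite addr_ge0// divr_ge0 ?sqr_ge0// addr_ge0// mulr_ge0// sqr_ge0.
  pose k : R := `|u ^+ 2 - v ^+ 2 + a ^+ 2 - b ^+ 2| + 2 * `|u - v|.
  have k0 : 0 <= k by rewrite addr_ge0// mulr_ge0.
  exists (k * c * 2) => [|n]; first by rewrite !mulr_ge0.
  rewrite (le_trans (lnB_le (denom_gt0 _ _ a0) (denom_gt0 _ _ b0)))//.
  set D := (_ - _); have Dk : D <= k * (1 + n%:R).
    rewrite (_ : D = u ^+ 2 - v ^+ 2 + a ^+ 2 - b ^+ 2 - 2 * (u - v) * n%:R); last first.
      by rewrite /D; ring.
    have := ler_norm (u ^+ 2 - v ^+ 2 + a ^+ 2 - b ^+ 2).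
    have := ler_norm (- (u - v)); rewrite normrN /k.
    have := ler0n R n; have := normr_ge0 (u ^+ 2 - v ^+ 2 + a ^+ 2 - b ^+ 2).
    have := normr_ge0 (u - v).
    set X := `|_|; set Y := `|_| => *; nra.
  have B0 := denom_gt0 v n%:R b0.
  apply: (@le_trans _ _ (k * (1 + n%:R) * (c * rho n%:R))).
    apply: (@le_trans _ _ (k * (1 + n%:R) * ((v - n%:R) ^+ 2 + b ^+ 2)^-1)).
      by rewrite ler_wpM2r// invr_ge0 ltW.
    by apply: ler_wpM2l (denom_rho _ _ _); rewrite ?mulr_ge0// addr_ge0.
  rewrite -nat1r (_ : k * _ * _ = (k * c) * ((1 + n%:R) * rho n%:R)); last by ring.
  rewrite -[leRHS]mulrA; apply: ler_wpM2l; rewrite ?mulr_ge0// /rho.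
  rewrite ler_pdivlMr ?addr_gt0// mulrAC ler_pdivrMr; last by rewrite ltr_wpDr// sqr_ge0.
  have : 0 <= (1 - n%:R : R) ^+ 2 by exact: sqr_ge0.
  nra.
have [K1 K10 H1] := H x y e d e0 d0.
have [K2 K20 H2] := H y x d e d0 e0.
have cv (K : R) : K * (n.+1%:R)^-1 @[n --> \oo] --> 0.
  by rewrite -[X in _ --> X](mulr0 K); apply: cvgMr; exact: cvg_harmonic.
apply: (@squeeze_cvgr _ _ _ _ (fun n => - (K2 * n.+1%:R^-1)) (fun n => K1 * n.+1%:R^-1)).
- by apply: nearW => n; rewrite H1 lerNl opprB H2.
- by rewrite -oppr0; apply: cvgN; exact: cv.
- exact: cv.
Qed.

Lemma integrable_qkB e d x y : 0 < e -> 0 < d -> integr (fun t => qk e x t - qk d y t).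
Proof.
move=> e0 d0; apply: (@le_integrable_real _ _ (fun t => (`|x - y| + `|e - d|) * (((x - t) ^+ 2 + e ^+ 2)^-1 + ((y - t) ^+ 2 + d ^+ 2)^-1))).
- apply: continuous_measurable_fun => t.
  by apply: cvgB; exact: continuous_qk.
- apply: integrZ; have -> : (fun t => ((x - t) ^+ 2 + e ^+ 2)^-1 + ((y - t) ^+ 2 + d ^+ 2)^-1) =
      (fun t => e^-1 * pk e x t + d^-1 * pk d y t).
    by apply/funext => t; rewrite /pk !mulKf ?gt_eqF.
  by apply: integrD; apply: integrZ; exact: integrable_pk.
- by move=> t; exact: abs_qkB_le.
Qed.

Lemma integral_qkB e d x y : 0 < e -> 0 < d ->
  \int[mu]_t (qk e x t - qk d y t) = 0.
Proof.
move=> e0 d0.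
apply: (@FTC_line _ _ (fun t => 2^-1 * (ln ((y - t) ^+ 2 + d ^+ 2) - ln ((x - t) ^+ 2 + e ^+ 2)))).
- by move=> t; apply: cvgB; exact: continuous_qk.
- exact: integrable_qkB.
- move=> t.
  have H u (a : R) : 0 < a -> is_derive t 1 (fun t : R => ln ((u - t) ^+ 2 + a ^+ 2)) (- (2 * qk a u t)).
    move=> a0; have D0 := denom_gt0 u t a0.
    have H1 : is_derive t 1 (fun t : R => (u - t) ^+ 2 + a ^+ 2) (- (2 * (u - t))).
      by apply: is_derive_eq; rewrite /GRing.scale/=; ring.
    have H2 := @is_derive1_comp R (@ln R) (fun t : R => (u - t) ^+ 2 + a ^+ 2) t _ _ (is_derive1_ln D0) H1.
    eapply is_derive_eq; first exact: H2.
    by rewrite /qk; field; rewrite gt_eqF.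
  have := H x e e0; have := H y d d0 => Hy Hx.
  eapply is_derive_eq; first exact: (is_deriveZ (2^-1) (is_deriveB Hy Hx)).
  by rewrite /GRing.scale/=; field.
- have E n : (y - - n%:R) ^+ 2 = (- y - n%:R) ^+ 2 by ring.
  have E' n : (x - - n%:R) ^+ 2 = (- x - n%:R) ^+ 2 by ring.
  under eq_fun do rewrite E E'.
  rewrite (_ : 0 = 2^-1 * 0 - 2^-1 * 0); last by rewrite subrr.
  by apply: cvgB; apply: cvgMr; exact: cvg_ln_denomB.
Qed.
End kernels.

(** * Integrals of products of kernels *)

Section products.
Context {R : realType}.
Local Notation mu := (@lebesgue_measure R).
Local Notation integr f := (mu.-integrable [set: measurableTypeR R] (EFin \o f)).
Local Notation RR := (measurableTypeR R * measurableTypeR R)%type.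
Implicit Types (u v s t e a d x y : R).

Lemma qk_shift e u t : qk e u t = qk e 0 (t - u).
Proof. by rewrite /qk sub0r opprB. Qed.

Lemma pk_shift e u t : pk e u t = pk e 0 (t - u).
Proof. by rewrite /pk sub0r opprB. Qed.

Lemma measurable_qk e : 0 < e -> measurable_fun [set: RR] (fun z : RR => qk e z.1 z.2).
Proof.
move=> e0; under eq_fun do rewrite qk_shift.
apply: (measurableT_comp (f := qk e 0)).
  by apply: continuous_measurable_fun; exact: continuous_qk.
by apply: measurable_funB; [exact: measurable_snd|exact: measurable_fst].
Qed.

Lemma measurable_pk e : 0 < e -> measurable_fun [set: RR] (fun z : RR => pk e z.1 z.2).
Proof.
move=> e0; under eq_fun do rewrite pk_shift.
apply: (measurableT_comp (f := pk e 0)).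
  by apply: continuous_measurable_fun; exact: continuous_pk.
by apply: measurable_funB; [exact: measurable_snd|exact: measurable_fst].
Qed.

Lemma RintZ (f : R -> R) k : integr f -> \int[mu]_x (k * f x) = k * \int[mu]_x f x.
Proof. by move=> If; rewrite RintegralZl. Qed.

Lemma RintD (f g : R -> R) : integr f -> integr g ->
  \int[mu]_x (f x + g x) = \int[mu]_x f x + \int[mu]_x g x.
Proof. by move=> If Ig; rewrite RintegralD. Qed.

Lemma RintB (f g : R -> R) : integr f -> integr g ->
  \int[mu]_x (f x - g x) = \int[mu]_x f x - \int[mu]_x g x.
Proof. by move=> If Ig; rewrite RintegralB. Qed.

(* [2 Im(c) Re(c') = Im(c c') + Im(c conj(c'))] for the Cauchy kernels
   [c = 1/(s - t - ia)] and [c' = 1/(s - x - id)], followed by partial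
   fractions. *)
Lemma integral_pk_qk a d t x : 0 < a -> 0 < d -> a != d ->
  \int[mu]_s (pk a t s * qk d x s) = pi * qk (a + d) x t.
Proof.
move=> a0 d0 ad.
pose n1 := (t - x) ^+ 2 + (a - d) ^+ 2; pose n2 := (t - x) ^+ 2 + (a + d) ^+ 2.
have n10 : 0 < n1.
  by rewrite ltr_wpDl ?sqr_ge0// lt0r sqr_ge0 sqrf_eq0 subr_eq0 ad.
have n20 : 0 < n2 by rewrite ltr_wpDl ?sqr_ge0// exprn_gt0// addr_gt0.
(* Partial fraction coefficients. In [c1 + c2] the [n1] terms cancel, and the [c3] term has integral
   zero, so only [n2] survives. *)
pose c1 := - 2^-1 * (t - x) * (n1^-1 + n2^-1).
pose c2 := - 2^-1 * (t - x) * (n2^-1 - n1^-1).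
pose c3 := - 2^-1 * ((a - d) / n1 + (a + d) / n2).
have E s : pk a t s * qk d x s = c1 * pk a t s + c2 * pk d x s + c3 * (qk a t s - qk d x s).
  have A0 := denom_gt0 t s a0; have B0 := denom_gt0 x s d0.
  rewrite /c1 /c2 /c3 /n1 /n2 /pk /qk; field.
  by rewrite !gt_eqF.
under eq_Rintegral do rewrite E.
rewrite RintD; last 2 first.
- by apply: integrD; apply/integrZ/integrable_pk.
- exact/integrZ/integrable_qkB.
rewrite RintD; [|exact/integrZ/integrable_pk|exact/integrZ/integrable_pk].
rewrite (RintZ c1 (integrable_pk t a0)) (RintZ c2 (integrable_pk x d0)).
rewrite (RintZ c3 (integrable_qkB t x a0 d0)) !integral_pk ?integral_qkB//.
rewrite mulr0 addr0 /c1 /c2 /qk (_ : (x - t) ^+ 2 + _ = n2); last by rewrite /n2; ring.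
by field; rewrite !gt_eqF.
Qed.

(** Real and imaginary part of the product of two Cauchy kernels. The resolvent identity turns both
    into differences of single kernels; this starts the induction on powers. *)
Lemma integral_qk_pk_mul e x y : 0 < e -> x != y ->
  \int[mu]_t (qk e x t * qk e y t - pk e x t * pk e y t) = 0 /\
  \int[mu]_t (qk e x t * pk e y t + pk e x t * qk e y t) = 0.
Proof.
move=> e0 xy; have yx0 : y - x != 0 by rewrite subr_eq0 eq_sym.
have E1 t : qk e x t * qk e y t - pk e x t * pk e y t = (y - x)^-1 * (qk e x t - qk e y t).
  by rewrite /pk /qk; field; rewrite yx0 !gt_eqF// denom_gt0.
have E2 t : qk e x t * pk e y t + pk e x t * qk e y t = (y - x)^-1 * (pk e x t - pk e y t).
  by rewrite /pk /qk; field; rewrite yx0 !gt_eqF// denom_gt0.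
split.
  under eq_Rintegral do rewrite E1.
  by rewrite (RintZ _ (integrable_qkB x y e0 e0)) integral_qkB ?mulr0.
under eq_Rintegral do rewrite E2.
rewrite (RintZ _ (integrB (integrable_pk x e0) (integrable_pk y e0))).
by rewrite RintB ?integral_pk ?subrr ?mulr0//; exact: integrable_pk.
Qed.
End products.

Section complex_facts.
Context {R : realType}.
Implicit Types (z w : R[i]).

Lemma Re_le_normc z : `|Re z| <= normc z.
Proof.
by case: z => a b /=; rewrite -sqrtr_sqr ler_wsqrtr// lerDl sqr_ge0.
Qed.

Lemma Im_le_normc z : `|Im z| <= normc z.
Proof.
by case: z => a b /=; rewrite -sqrtr_sqr ler_wsqrtr// lerDr sqr_ge0.
Qed.

Lemma normc_ge0 z : 0 <= normc z.
Proof. by case: z => a b; exact: sqrtr_ge0. Qed.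

Lemma normc_le z : normc z <= `|Re z| + `|Im z|.
Proof.
case: z => a b /=; rewrite -[leRHS]ger0_norm ?addr_ge0// -sqrtr_sqr ler_wsqrtr//.
rewrite sqrrD !real_normK ?num_real// -addrA lerD2l lerDr.
by rewrite mulrn_wge0// mulr_ge0.
Qed.

Lemma ReM z w : Re (z * w) = Re z * Re w - Im z * Im w.
Proof. by case: z w => [a b] [c d]. Qed.

Lemma ImM z w : Im (z * w) = Re z * Im w + Im z * Re w.
Proof. by case: z w => [a b] [c d]. Qed.

End complex_facts.

(** * Powers of Cauchy integrals of bounded densities *)

Section cauchy_powers.
Context {R : realType}.
Local Notation mu := (@lebesgue_measure R).
Local Notation integr f := (mu.-integrable [set: measurableTypeR R] (EFin \o f)).
Local Notation RR := (measurableTypeR R * measurableTypeR R)%type.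
Implicit Types (u v s t x y : R) (h : R -> R[i]).

Definition QT e (f : R -> R) t : R := \int[mu]_u (f u * qk e u t).
Definition PT e (f : R -> R) t : R := \int[mu]_u (f u * pk e u t).

(* [kc e u t] is [((u - t) - i e)^-1]. *)
Definition kc e u t : R[i] := qk e u t +i* pk e u t.
Definition cint0 h := \int[mu]_t Re (h t) = 0 /\ \int[mu]_t Im (h t) = 0.
Definition cmeas h := measurable_fun setT (fun t : measurableTypeR R => Re (h t)) /\
  measurable_fun setT (fun t : measurableTypeR R => Im (h t)).

Lemma cmeasM h1 h2 : cmeas h1 -> cmeas h2 -> cmeas (fun t => h1 t * h2 t).
Proof.
move=> [? ?] [? ?]; split.
  under eq_fun do rewrite ReM.
  by apply: measurable_funB; apply: measurable_funM.
under eq_fun do rewrite ImM.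
by apply: measurable_funD; apply: measurable_funM.
Qed.

Lemma cmeas_kc e u : 0 < e -> cmeas (kc e u).
Proof.
move=> e0; split; apply: continuous_measurable_fun.
  exact: continuous_qk.
exact: continuous_pk.
Qed.

(** The decay of one Cauchy factor; two factors give the integrable [rho]. *)
Definition wt t : R := Num.sqrt (rho t).

Lemma wtM t : wt t * wt t = rho t.
Proof. by rewrite -expr2 sqr_sqrtr// ltW// rho_gt0. Qed.

Lemma wt_ge0 t : 0 <= wt t. Proof. exact: sqrtr_ge0. Qed.

Definition ec e u : R := Num.sqrt (2 + (1 + 2 * u ^+ 2) / e ^+ 2).

Lemma ec_ge0 e u : 0 <= ec e u. Proof. exact: sqrtr_ge0. Qed.

Lemma ecM e u : ec e u * ec e u = 2 + (1 + 2 * u ^+ 2) / e ^+ 2.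
Proof.
rewrite -expr2 /ec sqr_sqrtr//.
by rewrite addr_ge0// divr_ge0 ?sqr_ge0// addr_ge0// mulr_ge0// sqr_ge0.
Qed.

Lemma normc_kc e u t : 0 < e -> normc (kc e u t) <= ec e u * wt t.
Proof.
move=> e0; rewrite /ec /wt -sqrtrM; last first.
  by rewrite addr_ge0// divr_ge0 ?sqr_ge0// addr_ge0// mulr_ge0// sqr_ge0.
rewrite ler_wsqrtr// (le_trans _ (denom_rho _ _ e0))//.
rewrite le_eqVlt; apply/orP; left; apply/eqP; rewrite /qk /pk; field.
by rewrite gt_eqF// denom_gt0.
Qed.

Lemma ec_le3 e u : `|u| <= 3 -> ec e u <= ec e 3.
Proof.
move=> u3; rewrite ler_wsqrtr// lerD2l ler_wpM2r ?invr_ge0 ?sqr_ge0// lerD2l ler_wpM2l//.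
by rewrite -(real_normK (num_real u)) lerXn2r ?nnegrE.
Qed.

Lemma kcM e x y t : 0 < e -> x != y ->
  kc e x t * kc e y t = ((y - x)^-1)%:C * (kc e x t - kc e y t).
Proof.
move=> e0 xy; have yx0 : y - x != 0 by rewrite subr_eq0 eq_sym.
apply/eqP; rewrite eq_complex /=; apply/andP; split; apply/eqP.
  by rewrite /pk /qk; field; rewrite yx0 !gt_eqF// denom_gt0.
by rewrite /pk /qk; field; rewrite yx0 !gt_eqF// denom_gt0.
Qed.

Lemma integr_rho_bound h C : cmeas h -> (forall t, normc (h t) <= C * rho t) ->
  integr (fun t => Re (h t)) /\ integr (fun t => Im (h t)).
Proof.
move=> [mr mi] hC; split; apply: (le_integrable_real _ (integrZ C integrable_rho)) => // t.
  by rewrite (le_trans (Re_le_normc _)).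
by rewrite (le_trans (Im_le_normc _)).
Qed.

Lemma integr_fqk e f t : 0 < e -> integr f -> integr (fun u => f u * qk e u t).
Proof.
move=> e0 If; apply: (@le_integrable_real _ _ (fun u => e^-1 * `|f u|)).
- apply: measurable_funM; first exact: integr_measurable.
  by apply: (@measurable_kernel2 _ (fun z => qk e z.1 z.2)); exact: measurable_qk.
- exact/integrZ/integr_norm.
- by move=> u; rewrite normrM mulrC ler_wpM2r// qk_le.
Qed.

Lemma integr_fpk e f t : 0 < e -> integr f -> integr (fun u => f u * pk e u t).
Proof.
move=> e0 If; apply: (@le_integrable_real _ _ (fun u => e^-1 * `|f u|)).
- apply: measurable_funM; first exact: integr_measurable.
  by apply: (@measurable_kernel2 _ (fun z => pk e z.1 z.2)); exact: measurable_pk.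
- exact/integrZ/integr_norm.
- by move=> u; rewrite normrM mulrC ler_wpM2r// ger0_norm ?pk_ge0// pk_le.
Qed.

(* [rho] only serves to make the kernel integrable in [t]. *)
Lemma measurable_bounded_kernel (K : RR -> R) f C : integr f ->
  measurable_fun [set: RR] K -> (forall u t, `|K (u, t)| <= C) ->
  measurable_fun setT (fun t : measurableTypeR R => \int[mu]_u (f u * K (u, t))).
Proof.
move=> If mK KC.
have mr : measurable_fun setT (@rho R) 
  by apply: continuous_measurable_fun; exact: continuous_rho.
have IfK t : integr (fun u => f u * K (u, t)).
  apply: (@le_integrable_real _ _ (fun u => C * `|f u|)).
  - by apply: measurable_funM; [exact: integr_measurable|exact: measurable_kernel2].
  - exact/integrZ/integr_norm.
  - by move=> u; rewrite normrM mulrC ler_wpM2r.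
have -> : (fun t => \int[mu]_u (f u * K (u, t))) =
    (fun t => (1 + t ^+ 2) * \int[mu]_u (f u * (K (u, t) * rho t))).
  apply/funext => t; rewrite -RintZ.
    apply: eq_Rintegral => u _; rewrite /rho; field.
    by rewrite gt_eqF// ltr_wpDr// sqr_ge0.
  apply: (@le_integrable_real _ _ (fun u => (C * rho t) * `|f u|)).
  - apply: measurable_funM; first exact: integr_measurable.
    by apply: measurable_funM => //; exact: measurable_kernel2.
  - exact/integrZ/integr_norm.
  - move=> u; rewrite normrM mulrC ler_wpM2r// normrM (ger0_norm (ltW (rho_gt0 t))).
    by rewrite ler_wpM2r// ltW// rho_gt0.
apply: measurable_funM.
  by apply: measurable_funD => //; exact: measurable_funX.
apply: (@measurable_kernel_int _ f (fun t => C * rho t) (fun z => K z * rho z.2)) => //.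
- exact/integrZ/integrable_rho.
- by apply: measurable_funM => //; apply: measurableT_comp => //; exact: measurable_snd.
- move=> u t; rewrite normrM ler_wpM2l// normrM (ger0_norm (ltW (rho_gt0 t))).
  by rewrite ler_wpM2r// ltW// rho_gt0.
- move=> t; exists (C * rho t) => u; rewrite normrM (ger0_norm (ltW (rho_gt0 t))).
  by rewrite ler_wpM2r// ltW// rho_gt0.
Qed.

Lemma measurable_QT e f : 0 < e -> integr f -> measurable_fun setT (QT e f).
Proof.
move=> e0 If.
apply: (@measurable_bounded_kernel (fun z => qk e z.1 z.2) f e^-1) => //.
  exact: measurable_qk.
by move=> u t; exact: qk_le.
Qed.

Lemma measurable_PT e f : 0 < e -> integr f -> measurable_fun setT (PT e f).
Proof.
move=> e0 If.
apply: (@measurable_bounded_kernel (fun z => pk e z.1 z.2) f e^-1) => //.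
  exact: measurable_pk.
by move=> u t; rewrite ger0_norm ?pk_ge0// pk_le.
Qed.

Section bounded_density.
Variables (g : R -> R) (e : R).
Hypotheses (mg : measurable_fun setT g) (g1 : forall u, `|g u| <= 1)
  (g3 : forall u, 3 < `|u| -> g u = 0) (e0 : 0 < e).

Definition FT t : R[i] := QT e g t +i* PT e g t.

Lemma integr_g : integr g.
Proof.
apply: (@le_integrable_real _ _ (\1_`[(-3 : R), 3]%classic)) => //.
  exact: (integrable_indic_itv (-3) 3 true false).
move=> u; rewrite indicE; case: (boolP (_ \in _)) => //.
rewrite notin_setE/= in_itv/= -ler_norml => /negP; rewrite -ltNge => /g3 ->.
by rewrite normr0.
Qed.

(** [FT] is the superposition of the kernels [kc e u] with density [g], so a vanishing integral
    against almost every kernel with pole in the support of [g] passes to [FT]. *)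
Lemma cFubini0 h p (N : set R) : cmeas h -> integr p ->
  (forall u t, `|u| <= 3 -> normc (h t) * normc (kc e u t) <= p t) ->
  mu.-negligible N ->
  (forall u, ~ N u -> `|u| <= 3 -> cint0 (fun t => h t * kc e u t)) ->
  cint0 (fun t => h t * FT t).
Proof.
move=> [mr mi] ip hp N0 hN.
have gz u : g u <> 0 -> `|u| <= 3.
  by move=> gu; rewrite leNgt; apply/negP => /g3.
have RE t : Re (h t * FT t) = \int[mu]_u (g u * Re (h t * kc e u t)).
  rewrite ReM /= /QT /PT -(RintZ _ (integr_fqk t e0 integr_g)) -(RintZ _ (integr_fpk t e0 integr_g)).
  rewrite -RintB; [|exact/integrZ/(integr_fqk t e0 integr_g)|exact/integrZ/(integr_fpk t e0 integr_g)].
  by apply: eq_Rintegral => u _; rewrite ReM/=; ring.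
have IE t : Im (h t * FT t) = \int[mu]_u (g u * Im (h t * kc e u t)).
  rewrite ImM /= /QT /PT -(RintZ _ (integr_fqk t e0 integr_g)) -(RintZ _ (integr_fpk t e0 integr_g)).
  rewrite -RintD; [|exact/integrZ/(integr_fpk t e0 integr_g)|exact/integrZ/(integr_fqk t e0 integr_g)].
  by apply: eq_Rintegral => u _; rewrite ImM/=; ring.
have bd u t : normc (h t * kc e u t) <= normc (h t) * (e^-1 + e^-1).
  rewrite Normc.normcM ler_wpM2l ?normc_ge0// (le_trans (normc_le _))//=.
  by rewrite lerD ?qk_le// ger0_norm ?pk_ge0// pk_le.
have bd' (r : R[i] -> R) u t : (forall z, `|r z| <= normc z) ->
    `|g u * r (h t * kc e u t)| <= `|g u| * p t.
  move=> rn; rewrite normrM; have [->|/eqP gu] := eqVneq (g u) 0.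
    by rewrite normr0 !mul0r.
  by rewrite ler_wpM2l// (le_trans (rn _))// Normc.normcM hp// gz.
have mz (f : R -> R) : measurable_fun setT f -> measurable_fun [set: RR] (fun z : RR => f z.2).
  by move=> mf; apply: measurableT_comp => //; exact: measurable_snd.
split.
- under eq_Rintegral do rewrite RE.
  apply: (@Fubini_kernel0 _ g p (fun z => Re (h z.2 * kc e z.1 z.2))) => //.
  + exact: integr_g.
  + under eq_fun do rewrite ReM.
    by apply: measurable_funB; apply: measurable_funM;
      [exact: (mz _ mr)|exact: measurable_qk|exact: (mz _ mi)|exact: measurable_pk].
  + by move=> u t; apply: bd' => z; exact: Re_le_normc.
  + move=> t; exists (normc (h t) * (e^-1 + e^-1)) => u.
    by rewrite (le_trans (Re_le_normc _)).
  + exact: N0.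
  + by move=> u Nu /gz u3; have [] := hN u Nu u3.
- under eq_Rintegral do rewrite IE.
  apply: (@Fubini_kernel0 _ g p (fun z => Im (h z.2 * kc e z.1 z.2))) => //.
  + exact: integr_g.
  + under eq_fun do rewrite ImM.
    by apply: measurable_funD; apply: measurable_funM;
      [exact: (mz _ mr)|exact: measurable_pk|exact: (mz _ mi)|exact: measurable_qk].
  + by move=> u t; apply: bd' => z; exact: Im_le_normc.
  + move=> t; exists (normc (h t) * (e^-1 + e^-1)) => u.
    by rewrite (le_trans (Im_le_normc _)).
  + exact: N0.
  + by move=> u Nu /gz u3; have [] := hN u Nu u3.
Qed.

Lemma cmeas_FT : cmeas FT.
Proof.
by split; [exact: measurable_QT integr_g|exact: measurable_PT integr_g].
Qed.

Let G := \int[mu]_u `|g u|.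

Let G0 : 0 <= G. Proof. exact: Rintegral_ge0. Qed.

Let kernel_bound (k : R -> R) t : (forall u, `|k u| <= normc (kc e u t)) ->
  integr (fun u => g u * k u) ->
  `|\int[mu]_u (g u * k u)| <= (ec e 3 * wt t) * G.
Proof.
move=> kn Ik; rewrite (le_trans (le_normr_Rintegral _ _))//.
rewrite -RintZ; last exact/integr_norm/integr_g.
apply: le_Rintegral => //.
- exact/integr_norm.
- exact/integrZ/integr_norm/integr_g.
- move=> u _; rewrite normrM mulrC; have [->|/eqP gu] := eqVneq (g u) 0.
    by rewrite normr0 !mulr0.
  rewrite ler_wpM2r// (le_trans (kn u))// (le_trans (normc_kc _ _ e0))//.
  rewrite ler_wpM2r ?wt_ge0// ec_le3// leNgt; apply/negP => /g3; exact: gu.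
Qed.

Definition FTc := 2 * (ec e 3 * G).

Lemma FTc_ge0 : 0 <= FTc.
Proof. by rewrite mulr_ge0// mulr_ge0// ec_ge0. Qed.

Lemma normc_FT t : normc (FT t) <= FTc * wt t.
Proof.
rewrite (le_trans (normc_le _))//= /FTc -mulrA mulr_natl mulr2n (mulrAC (ec e 3)).
rewrite lerD//; apply: kernel_bound.
- by move=> u; exact: (Re_le_normc (kc e u t)).
- exact: integr_fqk integr_g.
- by move=> u; exact: (Im_le_normc (kc e u t)).
- exact: integr_fpk integr_g.
Qed.

Definition cbounded h := exists M : R, forall t, normc (h t) <= M.

(* By the resolvent identity [kc x * kc y = (kc x - kc y) / (y - x)] this property
   passes from [h] to [h * FT], hence to all powers of [FT]; it replaces the
   holomorphy of [FT] in a half-plane. *)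
Definition cauchy_null h := forall x y, x != y ->
  cint0 (fun t => h t * kc e x t * kc e y t).

Lemma wt_le1 t : wt t <= 1.
Proof.
rewrite -[leRHS]sqrtr1 ler_wsqrtr// /rho invf_le1 ?ltr_wpDr ?sqr_ge0//.
by rewrite lerDl sqr_ge0.
Qed.

Lemma cbounded_FT : cbounded FT.
Proof.
exists FTc => t; rewrite (le_trans (normc_FT t))//.
by rewrite ler_piMr ?FTc_ge0// wt_le1.
Qed.

Lemma cboundedM h1 h2 : cbounded h1 -> cbounded h2 -> cbounded (fun t => h1 t * h2 t).
Proof.
move=> [M hM] [N hN]; exists (M * N) => t; rewrite Normc.normcM.
by rewrite ler_pM ?normc_ge0.
Qed.

Lemma negligible2 x y : mu.-negligible [set x; y].
Proof.
have m1 z : mu.-negligible [set z].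
  by apply/negligibleP => //; exact: lebesgue_measure_set1.
exact: negligibleU.
Qed.

Lemma cint0_ext h1 h2 : (forall t, h1 t = h2 t) -> cint0 h1 -> cint0 h2.
Proof. by move=> /funext ->. Qed.

Lemma cint0B h1 h2 (c : R) C : cmeas h1 -> cmeas h2 ->
  (forall t, normc (h1 t) <= C * rho t) -> (forall t, normc (h2 t) <= C * rho t) ->
  cint0 h1 -> cint0 h2 -> cint0 (fun t => c%:C * (h1 t - h2 t)).
Proof.
move=> m1 m2 b1 b2 [r1 i1] [r2 i2].
have [R1 I1] := integr_rho_bound m1 b1; have [R2 I2] := integr_rho_bound m2 b2.
have RE t : Re (c%:C * (h1 t - h2 t)) = c * (Re (h1 t) - Re (h2 t)).
  by rewrite ReM /= mul0r subr0; case: (h1 t) (h2 t) => [? ?] [? ?].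
have IE t : Im (c%:C * (h1 t - h2 t)) = c * (Im (h1 t) - Im (h2 t)).
  by rewrite ImM /= mul0r addr0; case: (h1 t) (h2 t) => [? ?] [? ?].
split.
  under eq_Rintegral do rewrite RE.
  by rewrite RintZ ?RintB ?r1 ?r2 ?subrr ?mulr0//; exact: integrB.
under eq_Rintegral do rewrite IE.
by rewrite RintZ ?RintB ?i1 ?i2 ?subrr ?mulr0//; exact: integrB.
Qed.

Lemma normc_kc2 x y t : normc (kc e x t * kc e y t) <= (ec e x * ec e y) * rho t.
Proof.
rewrite Normc.normcM -wtM mulrACA.
by rewrite ler_pM ?normc_ge0 ?normc_kc.
Qed.

Lemma cauchy_nullM h : cmeas h -> cbounded h -> cauchy_null h ->
  cauchy_null (fun t => h t * FT t).
Proof.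
move=> mh [M hM] h0 x y xy.
have M0 : 0 <= M by rewrite (le_trans _ (hM 0))// normc_ge0.
have mk := cmeas_kc _ e0.
have bd u v t : normc (h t * kc e u t * kc e v t) <= M * (ec e u * ec e v) * rho t.
  rewrite -[h t * _ * _]mulrA Normc.normcM -[leRHS]mulrA.
  by rewrite ler_pM ?normc_ge0 ?normc_kc2.
apply: (@cint0_ext (fun t => h t * kc e x t * kc e y t * FT t)).
  by move=> t; ring.
have mhk u : cmeas (fun t => h t * kc e u t) by apply: cmeasM.
apply: (@cFubini0 _ (fun t => (M * (ec e x * ec e y) * (e^-1 + e^-1)) * rho t) [set x; y]).
- by apply: cmeasM.
- exact/integrZ/integrable_rho.
- move=> u t _; rewrite [leRHS]mulrAC ler_pM ?normc_ge0//.
  by rewrite (le_trans (normc_le _))//= lerD ?qk_le// ger0_norm ?pk_ge0// pk_le.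
- exact: negligible2.
- move=> u Nu _.
  have ux : x != u by apply/eqP => xu; apply: Nu; left.
  have uy : y != u by apply/eqP => xu; apply: Nu; right.
  (* The resolvent identity removes one of the poles [x], [y], leaving the pairs [x, u] and [y, u];
     both are covered by the hypothesis on [h] as soon as [u] avoids [x] and [y]. *)
  apply: (@cint0_ext (fun t => ((y - x)^-1)%:C *
      (h t * kc e x t * kc e u t - h t * kc e y t * kc e u t))).
    move=> t; rewrite (_ : h t * kc e x t * kc e y t * kc e u t =
      h t * kc e u t * (kc e x t * kc e y t)); last by ring.
    by rewrite kcM//; ring.
  pose C := M * (ec e x * ec e u) + M * (ec e y * ec e u).
  apply: (@cint0B _ _ _ C).
  + by apply: cmeasM.
  + by apply: cmeasM.
  + move=> t; rewrite (le_trans (bd _ _ _))// ler_wpM2r ?(ltW (rho_gt0 t))// /C lerDl.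
    by rewrite !mulr_ge0 ?ec_ge0.
  + move=> t; rewrite (le_trans (bd _ _ _))// ler_wpM2r ?(ltW (rho_gt0 t))// /C lerDr.
    by rewrite !mulr_ge0 ?ec_ge0.
  + exact: h0.
  + exact: h0.
Qed.

Lemma cmeas_FTX n : cmeas (fun t => FT t ^+ n).
Proof.
elim: n => [|n IH]; first by split; exact: measurable_cst.
by under eq_fun do rewrite exprSr; apply: cmeasM => //; exact: cmeas_FT.
Qed.

Lemma cbounded_FTX n : cbounded (fun t => FT t ^+ n).
Proof.
elim: n => [|n IH]; first by exists 1 => t; rewrite expr0 Normc.normc1.
by under eq_fun do rewrite exprSr; apply: cboundedM => //; exact: cbounded_FT.
Qed.

Lemma cauchy_nullX n : cauchy_null (fun t => FT t ^+ n).
Proof.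
elim: n => [x y xy|n IH].
  have [r0 i0] := integral_qk_pk_mul e0 xy.
  apply: (@cint0_ext (fun t => kc e x t * kc e y t)).
    by move=> t; rewrite expr0 mul1r.
  by split.
by under eq_fun do rewrite exprSr; apply: cauchy_nullM => //;
  [exact: cmeas_FTX|exact: cbounded_FTX].
Qed.

(** Two of the factors are expanded into kernels, with poles [x] and [u]; what remains is
    [cauchy_null] of the power [n]. These two factors also supply the decay [rho] needed by
    Fubini. *)
Lemma cint0_FTX n : cint0 (fun t => FT t ^+ n.+2).
Proof.
have [M hM] := cbounded_FTX n.
have M0 : 0 <= M by rewrite (le_trans _ (hM 0))// normc_ge0.
have bd (z w : R[i]) t (a b : R) : normc z <= a * wt t -> normc w <= b * wt t ->
    normc (FT t ^+ n * z) * normc w <= M * (a * b) * rho t.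
  move=> za wb; rewrite Normc.normcM -mulrA -[leRHS]mulrA.
  rewrite ler_pM ?mulr_ge0 ?normc_ge0// -wtM mulrACA.
  by rewrite ler_pM ?normc_ge0.
apply: (@cint0_ext (fun t => FT t ^+ n * FT t * FT t)).
  by move=> t; rewrite -!exprSr.
apply: (@cFubini0 _ (fun t => (M * (FTc * ec e 3)) * rho t) set0).
- by apply: cmeasM; [exact: cmeas_FTX|exact: cmeas_FT].
- exact/integrZ/integrable_rho.
- move=> u t u3; apply: bd; first exact: normc_FT.
  by rewrite (le_trans (normc_kc _ _ e0))// ler_wpM2r ?wt_ge0// ec_le3.
- exact: negligible_set0.
move=> x _ _.
apply: (@cint0_ext (fun t => FT t ^+ n * kc e x t * FT t)).
  by move=> t; ring.
(* The excluded set is the diagonal [u = x], written as a pair so that [negligible2] applies. *)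
apply: (@cFubini0 _ (fun t => (M * (ec e x * ec e 3)) * rho t) [set x; x]).
- by apply: cmeasM; [exact: cmeas_FTX|exact: cmeas_kc].
- exact/integrZ/integrable_rho.
- move=> u t u3; apply: bd; first exact: normc_kc.
  by rewrite (le_trans (normc_kc _ _ e0))// ler_wpM2r ?wt_ge0// ec_le3.
- exact: negligible2.
- move=> u xu _; apply: cauchy_nullX; apply/eqP => ux; apply: xu; by left.
Qed.

End bounded_density.
End cauchy_powers.

(** * Real parts of even powers *)

Section moments.
Context {R : realType}.
Local Notation mu := (@lebesgue_measure R).
Local Notation integr f := (mu.-integrable [set: measurableTypeR R] (EFin \o f)).

Lemma normcD (z w : R[i]) : normc (z + w) <= normc z + normc w.
Proof. exact: le_normcD. Qed.

Lemma normc_exprB (z w : R[i]) (M : R) n : normc z <= M -> normc w <= M ->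
  normc (z ^+ n.+1 - w ^+ n.+1) <= n.+1%:R * normc (z - w) * M ^+ n.
Proof.
move=> zM wM; have M0 : 0 <= M := le_trans (normc_ge0 _) zM.
elim: n => [|n IH]; first by rewrite !expr1 mul1r expr0 mulr1.
rewrite (_ : z ^+ n.+2 - w ^+ n.+2 = z * (z ^+ n.+1 - w ^+ n.+1) + (z - w) * w ^+ n.+1); last first.
  by rewrite !(exprS _ n.+1); ring.
rewrite (le_trans (normcD _ _))// !Normc.normcM.
rewrite -(nat1r n.+1) mulrDl mul1r mulrDl addrC lerD//.
  rewrite ler_wpM2l ?normc_ge0//.
  elim: (n.+1) => [|m IHm]; first by rewrite !expr0 Normc.normc1.
  by rewrite !exprS Normc.normcM ler_pM ?normc_ge0.
rewrite [M ^+ _]exprS [leRHS]mulrCA.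
by rewrite ler_pM ?normc_ge0.
Qed.

Lemma normcX (z : R[i]) n : normc (z ^+ n) = normc z ^+ n.
Proof.
by elim: n => [|n IH]; rewrite ?expr0 ?Normc.normc1// !exprS Normc.normcM IH.
Qed.

(** The power is at most [exp (1/4)], and [exp (- 1/4) >= 3/4]. *)
Lemma expr_perturb_le2 n : (1 + (8 * n.+1%:R)^-1 : R) ^+ (2 * n.+1).-1 <= 2.
Proof.
apply: (@le_trans _ _ ((1 + (8 * n.+1%:R)^-1 : R) ^+ (2 * n.+1))).
  by rewrite ler_weXn2l ?leq_pred// lerDl invr_ge0 mulr_ge0.
apply: (@le_trans _ _ (expR ((8 * n.+1%:R)^-1) ^+ (2 * n.+1))).
  by rewrite lerXn2r ?nnegrE ?expR_ge0 ?expR_ge1Dx// addr_ge0// invr_ge0 mulr_ge0.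
rewrite -expRM_natl natrM (_ : _ / _ = 2 * 8^-1); last first.
  by field; rewrite nat1r pnatr_eq0.
have h : 1 + - (2 * 8^-1) <= expR (- (2 * 8^-1)) :> R by exact: expR_ge1Dx.
have h2 := expRxMexpNx_1 (2 * 8^-1 : R); have h3 := expR_gt0 (2 * 8^-1 : R).
nra.
Qed.

(** Write [N] for [n + 1]. If [|q| >= 8 N |b|], the imaginary part perturbs [q^(2 N)] by at most
    half of it. Otherwise the modulus is at most [9 N |b|], and the last term dominates
    everything. *)
Lemma Re_even_power_ge (q b : R) n :
  q ^+ (2 * n.+1) / 2 <=
  Re ((q +i* b) ^+ (2 * n.+1)) + 2 * (9 * n.+1%:R * `|b|) ^+ (2 * n.+1).
Proof.
set m := (2 * n.+1)%N; set N : R := n.+1%:R.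
have N1 : 1 <= N by rewrite /N ler1n.
have qm : q ^+ m = `|q| ^+ m by rewrite /m !exprM real_normK ?num_real.
have nz : normc (q +i* b) <= `|q| + `|b| := normc_le (q +i* b).
have B0 : 0 <= (9 * N * `|b|) ^+ m by rewrite exprn_ge0// !mulr_ge0// ltW// (lt_le_trans _ N1).
have [bq|qb] := leP (8 * N * `|b|) `|q|; last first.
  have z9 : normc (q +i* b) <= 9 * N * `|b|.
    by rewrite (le_trans nz)//; have := normr_ge0 b; nra.
  have h1 : `|Re ((q +i* b) ^+ m)| <= (9 * N * `|b|) ^+ m.
    rewrite (le_trans (Re_le_normc _))// normcX lerXn2r ?nnegrE ?normc_ge0//.
    by rewrite (le_trans (normc_ge0 _) z9).
  have h2 : q ^+ m <= (9 * N * `|b|) ^+ m.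
    rewrite qm lerXn2r ?nnegrE//; first by rewrite (le_trans (normc_ge0 _) z9).
    by rewrite (le_trans (ltW qb))//; have := normr_ge0 b; nra.
  have := exprn_ge0 m (normr_ge0 q); rewrite -qm.
  by move: h1; rewrite ler_norml => /andP[h1 _]; lra.
have N80 : 0 < 8 * N by rewrite mulr_gt0// (lt_le_trans _ N1).
pose M := `|q| * (1 + (8 * N)^-1).
have bM : `|b| <= `|q| / (8 * N) by rewrite ler_pdivlMr// mulrC.
have zM : normc (q +i* b) <= M by rewrite (le_trans nz)// /M mulrDr mulr1 lerD2l.
have wM : normc (q +i* 0) <= M.
  rewrite (le_trans (normc_le _))//= normr0 addr0 /M ler_peMr// lerDl invr_ge0.
  exact: ltW.
have mE : m = m.-1.+1 by rewrite /m mulnS.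
have := normc_exprB m.-1 zM wM; rewrite -mE.
have -> : (q +i* b) - (q +i* 0) = (0 +i* b) by apply/eqP; rewrite eq_complex /= subrr subr0 !eqxx.
have -> : normc (0 +i* b) = `|b| by rewrite /= expr0n add0r sqrtr_sqr.
have -> : (q +i* 0) ^+ m = (q ^+ m)%:C.
  by rewrite -[q +i* 0]/(q%:C) rmorphXn.
move=> H.
have {}H : `|Re ((q +i* b) ^+ m) - q ^+ m| <= m%:R * `|b| * M ^+ m.-1.
  rewrite (le_trans _ H)// (le_trans _ (Re_le_normc _))//.
  by case: ((q +i* b) ^+ m).
have K : m%:R * `|b| * M ^+ m.-1 <= q ^+ m / 2.
  rewrite /M exprMn qm [in leRHS]mE exprSr.
  have e2 := expr_perturb_le2 n.
  rewrite -/m in e2.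
  have X0 : 0 <= `|q| ^+ m.-1 by rewrite exprn_ge0.
  have mb : m%:R * `|b| <= `|q| / 4.
    rewrite /m natrM -/N; move: bM; rewrite ler_pdivlMr// => bM.
    by rewrite ler_pdivlMr//; lra.
  rewrite (_ : _ * `|q| / 2 = (`|q| / 4) * (`|q| ^+ m.-1 * 2)); last by field.
  by rewrite ler_pM ?mulr_ge0 ?exprn_ge0 ?ler_wpM2l// addr_ge0// invr_ge0 ltW.
move: H; rewrite ler_norml => /andP[H _].
by lra.
Qed.
End moments.

(** * Exponential integrability of the conjugate Poisson integral *)

Section even_moments.
Context {R : realType}.
Local Notation mu := (@lebesgue_measure R).
Local Notation integr f := (mu.-integrable [set: measurableTypeR R] (EFin \o f)).
Variables (g : R -> R) (e : R).
Hypotheses (mg : measurable_fun setT g) (g1 : forall u, `|g u| <= 1)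
  (g3 : forall u, 3 < `|u| -> g u = 0) (e0 : 0 < e).

Let Q := QT e g.
Let P := PT e g.
Let F := FT g e.
Let Ig := integr_g mg g1 g3.
Let c := FTc g e.

Let FX_le n t : normc (F t ^+ n.+2) <= c ^+ n.+2 * rho t.
Proof.
have c0 : 0 <= c by exact: FTc_ge0.
rewrite normcX (@le_trans _ _ ((c * wt t) ^+ n.+2))//.
  by rewrite lerXn2r ?nnegrE ?normc_ge0 ?(mulr_ge0 c0 (wt_ge0 t))//; exact: normc_FT.
rewrite exprMn ler_wpM2l ?exprn_ge0// -wtM !exprS mulrA.
by rewrite ler_piMr ?(mulr_ge0 (wt_ge0 t) (wt_ge0 t))// exprn_ile1 ?wt_ge0 ?wt_le1.
Qed.

Let mQ : measurable_fun setT Q. Proof. exact: measurable_QT. Qed.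
Let mP : measurable_fun setT P. Proof. exact: measurable_PT. Qed.

Let integr_pow (f : R -> R) n : measurable_fun setT f -> (forall t, `|f t| <= normc (F t)) ->
  integr (fun t => f t ^+ n.+2).
Proof.
move=> mf fF; apply: (@le_integrable_real _ _ (fun t => c ^+ n.+2 * rho t)).
- exact: measurable_funX.
- exact/integrZ/integrable_rho.
- move=> t; rewrite (le_trans _ (FX_le n t))// normrX normcX.
  by rewrite lerXn2r ?nnegrE ?normc_ge0.
Qed.

Let IQ n : integr (fun t => Q t ^+ n.+2).
Proof. by apply: integr_pow => // t; exact: (Re_le_normc (F t)). Qed.

Let IP n : integr (fun t => `|P t| ^+ n.+2).
Proof.
apply: integr_pow => [|t]; first exact: measurableT_comp.
by rewrite normr_id; exact: (Im_le_normc (F t)).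
Qed.

Lemma integr_QTX n : integr (fun t => QT e g t ^+ (2 * n.+1)).
Proof. by rewrite mulnS; exact: IQ. Qed.

Lemma PT_le_pi t : `|P t| <= pi.
Proof.
have Ik : integr (fun u => pk e u t).
  by under eq_fun do rewrite pkC; exact: integrable_pk.
rewrite (le_trans (le_normr_Rintegral _ (integr_fpk t e0 Ig)))//.
rewrite -(integral_pk t e0); apply: le_Rintegral => //.
- exact/integr_norm/integr_fpk.
- exact: integrable_pk.
- move=> u _; rewrite normrM (pkC e u) (ger0_norm (pk_ge0 _ _ e0)).
  by rewrite ler_piMl ?pk_ge0.
Qed.

Lemma integral_g_le : \int[mu]_u `|g u| <= 6.
Proof.
apply: (@le_trans _ _ (\int[mu]_u (\1_`[(-3 : R), 3]%classic u))).
  apply: le_Rintegral => //; first exact: integr_norm.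
    exact: (integrable_indic_itv (-3) 3 true false).
  move=> u _; rewrite indicE; case: (boolP (_ \in _)) => //.
  rewrite notin_setE/= in_itv/= -ler_norml => /negP; rewrite -ltNge => /g3 ->.
  by rewrite normr0.
rewrite /Rintegral integral_indic// setIT /= lebesgue_measure_itv/=.
rewrite lte_fin ifT; last lra.
by rewrite -EFinD/=; lra.
Qed.

(** A majorant of [pk e u] that is uniform for [u] in the support of [g], as [Fubini_kernel]
    asks. *)
Let pp t := e * (ec e 3 * ec e 3) * rho t.

Let Ipp : integr pp. Proof. exact/integrZ/integrable_rho. Qed.

Let pk_pp u t : `| `|g u| * pk e u t| <= `| `|g u| | * pp t.
Proof.
rewrite normrM !normr_id; have [->|gu] := eqVneq (g u) 0.
  by rewrite normr0 !mul0r.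
rewrite ler_wpM2l//= ger0_norm ?pk_ge0//.
have u3 : `|u| <= 3 by rewrite leNgt; apply: contra gu => /g3/eqP.
have := ec_le3 e u3; have := ec_ge0 e u => ec0 ec3.
rewrite /pk /pp -mulrA ler_wpM2l ?(ltW e0)// (le_trans (denom_rho _ _ e0))//.
rewrite ler_wpM2r ?(ltW (rho_gt0 t))//.
by rewrite -ecM ler_pM.
Qed.

Let pk_bd t : exists C : R, forall u, `|pk e u t| <= C.
Proof. by exists e^-1 => u; rewrite ger0_norm ?pk_ge0 ?pk_le. Qed.

Let PT_abs t : `|P t| <= \int[mu]_u (`|g u| * pk e u t).
Proof.
rewrite (le_trans (le_normr_Rintegral _ (integr_fpk t e0 Ig)))//.
rewrite le_eqVlt; apply/orP; left; apply/eqP; apply: eq_Rintegral => u _.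
by rewrite normrM (ger0_norm (pk_ge0 _ _ e0)).
Qed.

Let IPabs : integr (fun t => \int[mu]_u (`|g u| * pk e u t)).
Proof.
apply: (@le_integrable_real _ _ (fun t => \int[mu]_u `| `|g u| | * pp t)).
- apply: (@measurable_kernel_int _ (fun u => `|g u|) pp (fun z => pk e z.1 z.2)) => //.
    exact: integr_norm.
  exact: measurable_pk.
- exact/integrZ.
- move=> t; apply: (@kernel_int_le _ (fun u => `|g u|) pp (fun z => pk e z.1 z.2)) => //.
    exact: integr_norm.
  exact: measurable_pk.
Qed.

Let IP1 : integr (fun t => `|P t|).
Proof.
apply: (le_integrable_real _ IPabs); first exact: measurableT_comp.
by move=> t; rewrite normr_id.
Qed.

Lemma integral_PT_le : \int[mu]_t `|P t| <= 6 * pi.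
Proof.
have E : \int[mu]_t (\int[mu]_u (`|g u| * pk e u t)) <= 6 * pi.
  have -> : \int[mu]_t (\int[mu]_u (`|g u| * pk e u t)) =
      \int[mu]_u (`|g u| * \int[mu]_t pk e u t).
    apply: (@Fubini_kernel _ (fun u => `|g u|) pp (fun z => pk e z.1 z.2)) => //.
      exact: integr_norm.
    exact: measurable_pk.
  under eq_Rintegral do rewrite integral_pk//.
  under eq_Rintegral do rewrite mulrC.
  rewrite RintZ; last exact: integr_norm.
  by rewrite mulrC ler_wpM2r ?pi_ge0// integral_g_le.
by apply: le_trans E; apply: le_Rintegral.
Qed.

(* The real part of [\int (Q + i P)^m = 0] controls the even moments of [Q] by those
   of the Poisson integral [P], and [`|P| <= pi]. *)
Lemma moment_le n : \int[mu]_t (Q t ^+ (2 * n.+1)) <= 24 * (9 * n.+1%:R * pi) ^+ (2 * n.+1).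
Proof.
set m := (2 * n.+1)%N.
have mE : m = (2 * n).+2 by rewrite /m mulnS.
have [r0 _] := cint0_FTX mg g1 g3 e0 (2 * n).
have [IR _] : integr (fun t => Re (F t ^+ m)) /\ integr (fun t => Im (F t ^+ m)).
  apply: (@integr_rho_bound _ _ (c ^+ m)); rewrite mE; first exact: cmeas_FTX.
  exact: FX_le.
have H : \int[mu]_t (2^-1 * Q t ^+ m) <=
    \int[mu]_t (Re (F t ^+ m) + 2 * (9 * n.+1%:R) ^+ m * `|P t| ^+ m).
  apply: le_Rintegral => //.
  - by apply: integrZ; rewrite mE; exact: IQ.
  - by apply: integrD => //; apply: integrZ; rewrite mE; exact: IP.
  - move=> t _; rewrite mulrC -[2 * _ * _]mulrA -exprMn.
    exact: (Re_even_power_ge (Q t) (P t) n).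
move: H; rewrite RintZ; last by rewrite mE; exact: IQ.
rewrite RintD//; last by apply: integrZ; rewrite mE; exact: IP.
rewrite RintZ; last by rewrite mE; exact: IP.
rewrite {2}mE r0 add0r => H.
(* All factors but one are bounded by [pi] and the last one is integrated. The factors 2 and 2 of
   [Re_even_power_ge] together with this 6 give 24. *)
have HP : \int[mu]_t (`|P t| ^+ m) <= 6 * pi ^+ m.
  apply: (@le_trans _ _ (\int[mu]_t (pi ^+ m.-1 * `|P t|))).
    apply: le_Rintegral => //; first by rewrite mE; exact: IP.
      exact: integrZ.
    move=> t _; rewrite mE/= exprSr ler_wpM2r//.
    by rewrite lerXn2r ?nnegrE ?pi_ge0 ?PT_le_pi.
  rewrite RintZ//.
  rewrite [in leRHS]mE exprSr mulrCA mE/= ler_wpM2l ?exprn_ge0 ?pi_ge0//.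
  by rewrite integral_PT_le.
have A0 : 0 <= (9 * n.+1%:R : R) ^+ m by rewrite exprn_ge0.
rewrite [in leRHS]exprMn.
have := ler_wpM2l A0 HP; lra.
Qed.
End even_moments.

Section exponential_integrability.
Context {R : realType}.
Local Notation mu := (@lebesgue_measure R).
Local Notation integr f := (mu.-integrable [set: measurableTypeR R] (EFin \o f)).

(* Only even moments are controlled, so [expR `|x|] is reached through the
   expansion of [expR x + expR (- x)]. *)
Definition cosh_sum (N : nat) (x : R) : R := \sum_(n < N) 2 * x ^+ (2 * n) / (2 * n)`!%:R.

Lemma cosh_sumE N x : cosh_sum N x =
  series (exp_coeff x) (2 * N)%N + series (exp_coeff (- x)) (2 * N)%N.
Proof.
elim: N => [|N IH]; first by rewrite /cosh_sum big_ord0 muln0 /series/= !big_geq// addr0.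
rewrite /cosh_sum big_ord_recr/= -/(cosh_sum N x) IH /series/= mulnS.
rewrite (_ : (2 + 2 * N)%N = (2 * N).+2)// !(big_nat_recr (2 * N).+1)//= !(big_nat_recr (2 * N))//=.
have E0 : (- x) ^+ (2 * N) = x ^+ (2 * N) by rewrite !exprM sqrrN.
have E1 : (- x) ^+ (2 * N).+1 = - x ^+ (2 * N).+1 by rewrite !exprS E0 mulNr.
have ecE y n : exp_coeff y n = y ^+ n / n`!%:R :> R by [].
by rewrite !ecE E0 E1; ring.
Qed.

Lemma cvg_cosh_sum x : cosh_sum N x @[N --> \oo] --> expR x + expR (- x).
Proof.
under eq_cvg do rewrite cosh_sumE.
have H y : series (exp_coeff y) (2 * N)%N @[N --> \oo] --> expR y.
  apply: (cvg_comp (fun N => (2 * N)%N) (series (exp_coeff y)) _ (is_cvg_series_exp_coeff y)).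
  apply/cvgnyPge => A; near=> n; rewrite (@leq_trans n)//; last by rewrite leq_pmull.
  near: n; exact: nbhs_infty_ge.
by apply: cvgD; exact: H.
Unshelve. all: by end_near. Qed.

Lemma cosh_sum_nd x : nondecreasing_seq (cosh_sum ^~ x).
Proof.
apply/nondecreasing_seqP => n; rewrite /cosh_sum big_ord_recr/= lerDl.
by rewrite divr_ge0// mulr_ge0// exprM exprn_ge0// sqr_ge0.
Qed.

Lemma cosh_sum_ge0 N x : 0 <= cosh_sum N x.
Proof.
by apply: sumr_ge0 => i _; rewrite divr_ge0// mulr_ge0// exprM exprn_ge0// sqr_ge0.
Qed.

(** The factor [9 pi] cancels the one in [moment_le]; the factor [expR 1] leaves a geometric ratio
    below 1 in [cosh_coeff_le]. *)
Definition delta : R := (9 * pi * expR 1)^-1.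

Lemma delta_gt0 : 0 < delta.
Proof. by rewrite invr_gt0 !mulr_gt0 ?pi_gt0 ?expR_gt0. Qed.

(** With this [delta] the power is [(n / e)^(2 n)], that is [(2 n)^(2 n) / (2 e)^(2 n)]. Since
    [m^m / m! <= e^m], a factor [2^(- 2 n)] is left. *)
Lemma cosh_coeff_le (n : nat) :
  2 * delta ^+ (2 * n) / (2 * n)`!%:R * (24 * (9 * n%:R * pi) ^+ (2 * n)) <= 48 * (4^-1) ^+ n.
Proof.
have [->|n0] := posnP n; first by rewrite muln0 !expr0 fact0; lra.
have e0 := expR_gt0 (1 : R); have p0 := pi_gt0 R.
have -> : 2 * delta ^+ (2 * n) / (2 * n)`!%:R * (24 * (9 * n%:R * pi) ^+ (2 * n)) =
  48 * ((2 * n)%:R ^+ (2 * n) / (2 * n)`!%:R * ((2 * expR 1)^-1 ^+ (2 * n))).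
  rewrite (_ : 9 * n%:R * pi = (9 * pi * expR 1) * ((2 * n)%:R * (2 * expR 1)^-1)); last first.
    by rewrite natrM; field; rewrite gt_eqF.
  rewrite [in X in 24 * X]exprMn [in X in 24 * (_ * X)]exprMn /delta.
  rewrite [X in 2 * X]exprVn; field.
  by rewrite expf_neq0 ?mulf_neq0 ?gt_eqF// pnatr_eq0 -lt0n fact_gt0.
rewrite ler_pM2l// (_ : 4^-1 = expR 1 ^+ 2 * (2 * expR 1)^-1 ^+ 2 :> R); last first.
  by field; rewrite gt_eqF.
rewrite exprMn -!exprM ler_wpM2r//.
rewrite -expRM_natl mulr1; have := @expR_ge1Dxn R (2 * n)%:R (2 * n).-1 (ler0n _ _).
rewrite prednK ?muln_gt0//; apply: le_trans; rewrite lerDr//.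
Qed.

Section exp_bound.
Variables (g : R -> R) (e : R).
Hypotheses (mg : measurable_fun setT g) (g1 : forall u, `|g u| <= 1)
  (g3 : forall u, 3 < `|u| -> g u = 0) (e0 : 0 < e).

Let mQ : measurable_fun setT (QT e g).
Proof. by apply: measurable_QT => //; exact: integr_g. Qed.

Let mS n : measurable_fun setT (fun t : measurableTypeR R => cosh_sum n (delta * QT e g t)).
Proof.
rewrite /cosh_sum; apply: measurable_sum => i.
by apply: measurable_funM => //; apply: measurable_funM => //; apply: measurable_funX; apply: measurable_funM.
Qed.

Let I11 : set (measurableTypeR R) := `]-1, 1[%classic.

Let mI : measurable I11. Proof. exact: measurable_itv. Qed.

Let term_le i : (\int[mu]_(t in I11)
  (2 * (delta * QT e g t) ^+ (2 * i) / (2 * i)`!%:R)%:E <= (48 * (4^-1) ^+ i)%:E)%E.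
Proof.
(* The term of index 0 is the constant 2, integrable only because the domain is bounded; the other
   terms are bounded by their integrals over the line. *)
case: i => [|i].
  under eq_integral do rewrite muln0 expr0 fact0 mulr1 divr1.
  rewrite integral_cst//= lebesgue_measure_itv/= lte_fin ifT; last lra.
  by rewrite -EFinD -EFinM lee_fin expr0; lra.
have IQ : integr (fun t => QT e g t ^+ (2 * i.+1)) by exact: integr_QTX.
have H := moment_le mg g1 g3 e0 i.
apply: le_trans (_ : _ <= \int[mu]_t (2 * (delta * QT e g t) ^+ (2 * i.+1) / (2 * i.+1)`!%:R)%:E)%E _.
  apply: ge0_subset_integral => //.
    apply/measurable_EFinP.
    by apply: measurable_funM => //; apply: measurable_funM => //; apply: measurable_funX; apply: measurable_funM.
  by move=> t _; rewrite lee_fin divr_ge0// mulr_ge0// exprM exprn_ge0// sqr_ge0.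
have -> : (fun t => (2 * (delta * QT e g t) ^+ (2 * i.+1) / (2 * i.+1)`!%:R)%:E) =
   (fun t => (2 * delta ^+ (2 * i.+1) / (2 * i.+1)`!%:R * QT e g t ^+ (2 * i.+1))%:E).
  by apply/funext => t; rewrite exprMn; congr EFin; ring.
rewrite -[leLHS]fineK; last first.
  by apply: integrable_fin_num => //; exact: integrZ.
rewrite lee_fin -/(Rintegral _ _ _) RintZ//.
rewrite (le_trans _ (cosh_coeff_le i.+1))// ler_wpM2l// divr_ge0// mulr_ge0// exprn_ge0//.
exact/ltW/delta_gt0.
Qed.

Lemma exp_integrable : (\int[mu]_(t in I11) (expR (delta * `|QT e g t|))%:E <= 64%:E)%E.
Proof.
have HS N : (\int[mu]_(t in I11) (cosh_sum N (delta * QT e g t))%:E <= 64%:E)%E.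
  rewrite /cosh_sum; under eq_integral do rewrite -sumEFin.
  rewrite ge0_integral_sum//; last 2 first.
  - move=> i; apply/measurable_EFinP; apply: measurable_funTS.
    by apply: measurable_funM => //; apply: measurable_funM => //; apply: measurable_funX; apply: measurable_funM.
  - by move=> i t _; rewrite lee_fin divr_ge0// mulr_ge0// exprM exprn_ge0// sqr_ge0.
  apply: (@le_trans _ _ (\sum_(i < N) (48 * (4^-1) ^+ i)%:E)%E).
    by apply: lee_sum => i _; exact: term_le.
  rewrite sumEFin lee_fin.
  (* 64 is the full geometric sum [48 * (4/3)]. *)
  suff -> : \sum_(i < N) (48 * (4^-1) ^+ i) = 64 * (1 - (4^-1) ^+ N) :> R.
    by rewrite ler_piMr// gerBl exprn_ge0.
  elim: (N) => [|k IH]; first by rewrite big_ord0 expr0 subrr mulr0.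
  by rewrite big_ord_recr/= IH exprS; field.
apply: (@le_trans _ _ (\int[mu]_(t in I11) (limn (fun N => (cosh_sum N (delta * QT e g t))%:E)))%E).
  have L t : limn (fun N => (cosh_sum N (delta * QT e g t))%:E) = (expR (delta * QT e g t) + expR (- (delta * QT e g t)))%:E.
    apply/cvg_lim => //; apply: cvg_EFin; first exact: nearW.
    exact: cvg_cosh_sum.
  apply: ge0_le_integral => //.
  - apply/measurable_EFinP; apply: measurable_funTS.
    apply: measurableT_comp => //; apply: measurable_funM => //.
    exact: measurableT_comp.
  - under eq_fun do rewrite L.
    apply/measurable_EFinP; apply: measurable_funTS.
    apply: measurable_funD; apply: measurableT_comp => //.
      exact: measurable_funM.
    by apply: measurable_funN; exact: measurable_funM.
  - move=> t _; rewrite L lee_fin; have d0 := ltW delta_gt0.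
    have [q0|q0] := leP 0 (QT e g t); first by rewrite ger0_norm// lerDl expR_ge0.
    by rewrite ltr0_norm// mulrN lerDr expR_ge0.
rewrite monotone_convergence//.
- apply: lime_le; last exact: nearW.
  apply: ereal_nondecreasing_is_cvgn => m n mn; apply: ge0_le_integral => //.
  + by move=> t _; rewrite lee_fin cosh_sum_ge0.
  + by apply/measurable_EFinP; exact: measurable_funTS.
  + by apply/measurable_EFinP; exact: measurable_funTS.
  + by move=> t _; rewrite lee_fin cosh_sum_nd.
- by move=> n; apply/measurable_EFinP; exact: measurable_funTS.
- by move=> n t _; rewrite lee_fin cosh_sum_ge0.
- by move=> t _ m n mn; rewrite lee_fin cosh_sum_nd.
Qed.
End exp_bound.
End exponential_integrability.

(** * The modular of L log L *)

Section modular.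
Context {R : realType}.
Local Notation mu := (@lebesgue_measure R).
Local Notation integr f := (mu.-integrable [set: measurableTypeR R] (EFin \o f)).

Definition phi (s : R) : R := s * ln (1 + s).

Lemma phi_ge0 s : 0 <= s -> 0 <= phi s.
Proof. by move=> s0; rewrite mulr_ge0// ln_ge0// lerDl. Qed.

(** The conjugate of [exp] is [s ln s - s]: the inequality is [1 + v <= exp v] at [v = r - ln s],
    multiplied by [s], and [s ln s - s] is at most [phi s]. *)
Lemma young_phi (s r : R) : 0 <= s -> s * r <= phi s + expR r.
Proof.
rewrite le_eqVlt => /predU1P[<-|s0].
  by rewrite /phi !mul0r add0r expR_ge0.
have h : s * (1 + (r - ln s)) <= expR r.
  rewrite -[X in _ <= expR X](subrK (ln s)) expRD lnK ?posrE// mulrC.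
  by rewrite ler_wpM2r ?(ltW s0)// expR_ge1Dx.
have h2 : s * ln s <= s * ln (1 + s).
  by rewrite ler_wpM2l ?(ltW s0)// ler_ln ?posrE ?lerDr// addr_gt0.
rewrite /phi; lra.
Qed.

Lemma QT_le e (f : R -> R) t : 0 < e -> integr f ->
  `|QT e f t| <= e^-1 * \int[mu]_u `|f u|.
Proof.
move=> e0 If; rewrite (le_trans (le_normr_Rintegral _ _))//; first exact: integr_fqk.
rewrite -RintZ; last exact: integr_norm.
apply: le_Rintegral => //; first exact/integr_norm/integr_fqk.
  exact/integrZ/integr_norm.
by move=> u _; rewrite normrM mulrC ler_wpM2r// qk_le.
Qed.

Lemma integrM_QT e (f g : R -> R) : 0 < e -> integr f -> integr g ->
  integr (fun t => f t * QT e g t).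
Proof.
move=> e0 If Ig; apply: (@le_integrable_real _ _ (fun t => (e^-1 * \int[mu]_u `|g u|) * `|f t|)).
- by apply: measurable_funM; [exact: integr_measurable|exact: measurable_QT].
- exact/integrZ/integr_norm.
- by move=> t; rewrite normrM mulrC ler_wpM2r// QT_le.
Qed.

Section L1_bound.
Variables (f : R -> R) (e l A : R).
Hypotheses (If : integr f) (e0 : 0 < e) (l0 : 0 < l).
Let I11 : set (measurableTypeR R) := `]-1, 1[%classic.
Let J : set (measurableTypeR R) := `]-3, 3[%classic.
Hypothesis f0 : forall x, ~ I11 x -> f x = 0.
Hypothesis fA : (\int[mu]_(x in I11) (phi (`|f x| / l))%:E <= A%:E)%E.

Let Q := QT e f.
Let mQ : measurable_fun setT Q. Proof. exact: measurable_QT. Qed.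
Let mf : measurable_fun setT f. Proof. exact: integr_measurable. Qed.
Let mI : measurable I11. Proof. exact: measurable_itv. Qed.
Let mJ : measurable J. Proof. exact: measurable_itv. Qed.

(** The sign of [Q] on [J], in a form whose measurability is immediate. *)
Let g (t : R) : R := \1_(J `&` [set t | 0 < Q t]) t - \1_(J `&` [set t | Q t < 0]) t.

Let mg : measurable_fun setT g.
Proof.
apply: measurable_funB; apply: measurable_indic; apply: measurableI => //.
  rewrite (_ : [set t | 0 < Q t] = setT `&` Q @^-1` `]0, +oo[%classic).
    exact: mQ (measurable_itv _).
  by rewrite setTI; apply/seteqP; split=> t /=; rewrite in_itv/= andbT.
rewrite (_ : [set t | Q t < 0] = setT `&` Q @^-1` `]-oo, 0[%classic).
  exact: mQ (measurable_itv _).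
by rewrite setTI; apply/seteqP; split=> t /=; rewrite in_itv.
Qed.

Let gE t : g t = if t \in J then Num.sg (Q t) else 0.
Proof.
rewrite /g !indicE !in_setI; case: ifPn => tJ /=; last by rewrite subr0.
rewrite (_ : (t \in [set t | 0 < Q t]) = (0 < Q t)); last by apply/idP/idP; rewrite inE.
rewrite (_ : (t \in [set t | Q t < 0]) = (Q t < 0)); last by apply/idP/idP; rewrite inE.
by case: sgrP => ?; rewrite ?subr0 ?sub0r.
Qed.

Let g1 u : `|g u| <= 1.
Proof. by rewrite gE; case: ifPn => _; rewrite ?normr0// normr_sg; case: (_ != 0). Qed.

Let g3 u : 3 < `|u| -> g u = 0.
Proof.
move=> u3; rewrite gE ifF//; apply/negP; rewrite inE /J /= in_itv/= -ltr_norml.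
by rewrite ltNge (ltW u3).
Qed.

Let Ig : integr g. Proof. exact: integr_g. Qed.
Let IgQ : integr (fun t => g t * Q t). Proof. exact: integrM_QT. Qed.

(** [qk] is antisymmetric, so [QT e] is minus its own adjoint. The bound of [qk] by [e^-1] and the
    integrability of [g] justify Fubini. *)
Let duality : \int[mu]_t (g t * Q t) = - \int[mu]_u (f u * QT e g u).
Proof.
have -> : \int[mu]_t (g t * Q t) = \int[mu]_t \int[mu]_u (f u * (g t * qk e u t)).
  apply: eq_Rintegral => t _; rewrite /Q /QT -RintZ; last exact: integr_fqk.
  by apply: eq_Rintegral => u _; ring.
rewrite (@Fubini_kernel _ f (fun t => e^-1 * `|g t|) (fun z => g z.2 * qk e z.1 z.2)) //=.
- rewrite -mulN1r -RintZ.
    apply: eq_Rintegral => u _; rewrite mulrCA mulN1r /QT; congr (_ * _).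
    rewrite -mulN1r -RintZ; last exact: integr_fqk.
    by apply: eq_Rintegral => t _; rewrite (qkC e t u); ring.
  exact: integrM_QT.
- exact/integrZ/integr_norm.
- apply: measurable_funM; last exact: measurable_qk.
  by apply: measurableT_comp => //; exact: measurable_snd.
- by move=> u t; rewrite normrM ler_wpM2l// normrM mulrC ler_wpM2r// qk_le.
- by move=> t; exists (`|g t| * e^-1) => u; rewrite normrM ler_wpM2l// qk_le.
Qed.

Lemma QT_L1_le : (\int[mu]_(t in J) `|QT e f t|%:E <= (l / delta * (A + 64))%:E)%E.
Proof.
have -> : (\int[mu]_(t in J) `|QT e f t|%:E = (\int[mu]_t (g t * Q t))%:E)%E.
  rewrite /Rintegral fineK; last exact: integrable_fin_num.
  rewrite [LHS]integral_mkcond; apply: eq_integral => t _; rewrite patchE gE.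
  by case: ifPn => _; rewrite ?mul0r// -normrEsg.
rewrite duality.
have IfQ := integrM_QT e0 If Ig.
have mQg : measurable_fun setT (QT e g) by exact: measurable_QT.
apply: (@le_trans _ _ (\int[mu]_(u in I11) (`|f u| * `|QT e g u|)%:E)%E).
  apply: (@le_trans _ _ (\int[mu]_u `|f u * QT e g u|)%:E).
    by rewrite lee_fin (le_trans (ler_norm _))// normrN le_normr_Rintegral.
  rewrite /Rintegral fineK; last by apply: integrable_fin_num => //; exact: integr_norm.
  rewrite [leRHS]integral_mkcond; apply: ge0_le_integral => //.
  - apply/measurable_EFinP; apply: measurableT_comp => //; exact: measurable_funM.
  - apply/(measurable_restrictT _ _).1 => //; apply/measurable_EFinP.
    by apply: measurable_funTS; apply: measurable_funM; exact: measurableT_comp.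
  - move=> u _; rewrite patchE; case: ifPn => [_|]; first by rewrite normrM.
    by rewrite notin_setE => /f0 ->; rewrite mul0r normr0.
have d0 := @delta_gt0 R.
have mp : measurable_fun setT (fun u : measurableTypeR R => phi (`|f u| / l)).
  have ml : measurable_fun setT (fun u : measurableTypeR R => `|f u| / l).
    by apply: measurable_funM => //; exact: measurableT_comp.
  apply: measurable_funM => //; apply: measurableT_comp => //.
  exact: measurable_funD.
have mE : measurable_fun setT (fun u : measurableTypeR R => expR (delta * `|QT e g u|)).
  apply: measurableT_comp => //; apply: measurable_funM => //; exact: measurableT_comp.
have p0 u : 0 <= phi (`|f u| / l) by rewrite phi_ge0// divr_ge0// ltW.
have ld0 : 0 <= l / delta by rewrite divr_ge0// ltW.
apply: (@le_trans _ _ (\int[mu]_(u in I11) ((l / delta)%:E * ((phi (`|f u| / l))%:E + (expR (delta * `|QT e g u|))%:E)))%E).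
  apply: ge0_le_integral => //.
  - apply/measurable_EFinP.
    by apply: measurable_funTS; apply: measurable_funM; exact: measurableT_comp.
  - apply/measurable_funTS/measurable_EFinP.
    by apply: measurable_funM => //; exact: measurable_funD.
  - move=> u _; rewrite lee_fin.
    (* Young's inequality at [|f u| / l] and [delta * |QT e g u|], multiplied by [l / delta] to
       restore the product. *)
    have := young_phi (delta * `|QT e g u|) (divr_ge0 (normr_ge0 (f u)) (ltW l0)).
    move/(ler_wpM2l ld0); apply: le_trans.
    rewrite le_eqVlt; apply/orP; left; apply/eqP; field.
    by rewrite !gt_eqF.
rewrite ge0_integralZl//; last 2 first.
- apply/measurable_funTS/measurable_EFinP; exact: measurable_funD.
- by move=> u _; rewrite adde_ge0// lee_fin// expR_ge0.
rewrite [leRHS]EFinM; apply: lee_wpmul2l; rewrite ?lee_fin//.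
rewrite ge0_integralD//; last 3 first.
- by move=> u _; rewrite lee_fin.
- exact/measurable_funTS/measurable_EFinP.
- exact/measurable_funTS/measurable_EFinP.
by rewrite EFinD; apply: leeD => //; exact: exp_integrable.
Qed.
End L1_bound.
End modular.

(** * Maximal estimates *)

Section poisson_maximal.
Context {R : realType}.
Local Notation mu := (@lebesgue_measure R).
Local Notation integr f := (mu.-integrable [set: measurableTypeR R] (EFin \o f)).

(** The least [k] with [|u - t| < 2^k e] works: by minimality [|u - t|] is at least half that radius
    unless [k = 0], where the bound [e^-1] is enough. *)
Lemma pk_dyadic (e u t : R) : 0 < e -> exists k : nat,
  `|u - t| < 2 ^+ k * e /\ pk e u t <= 4 * (2 ^+ k)^-1 / (2 ^+ k * e).
Proof.
move=> e0; have ex : exists k : nat, `|u - t| < 2 ^+ k * e.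
  have [k hk] : exists k : nat, `|u - t| / e < k%:R.
    by exists (Num.trunc (`|u - t| / e)).+1; apply: truncnS_gt.
  exists k; rewrite -ltr_pdivrMr// (lt_trans hk)//.
  by rewrite -natrX ltr_nat ltn_expl.
case: (ex_minnP ex) => k hk kmin; exists k; split => //.
have p0 : 0 < 2 ^+ k :> R by rewrite exprn_gt0.
rewrite (_ : 4 * _ / _ = 4 / ((2 ^+ k) ^+ 2 * e)); last by field; rewrite !gt_eqF.
rewrite /pk ler_pdivrMr ?denom_gt0// mulrAC ler_pdivlMr ?mulr_gt0 ?exprn_gt0//.
rewrite -(real_normK (num_real (u - t))).
case: k hk kmin p0 => [|k] hk kmin p0.
  by rewrite expr0; have := sqr_ge0 `|u - t|; nra.
have : 2 ^+ k * e <= `|u - t|.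
  by rewrite leNgt; apply/negP => /kmin; rewrite ltnn.
rewrite [2 ^+ k.+1]exprS => h.
have k0 : 0 < 2 ^+ k * e by rewrite mulr_gt0// exprn_gt0.
have h2 : (2 ^+ k * e) ^+ 2 <= `|u - t| ^+ 2 by rewrite lerXn2r ?nnegrE ?(ltW k0).
rewrite (_ : e * _ = 4 * (2 ^+ k * e) ^+ 2); last by ring.
by have := sqr_ge0 e; lra.
Qed.

(** The kernel is dominated by a sum of weighted indicators of the balls of radius [2^k e]. Weight
    times ball length is [8 / 2^k], with sum 16. *)
Lemma poisson_le_HL (g : R -> R) (e t c : R) : integr g -> 0 < e ->
  (HL_maximal g t <= c%:E)%E -> (\int[mu]_u (`|g u| * pk e u t)%:E <= (16 * c)%:E)%E.
Proof.
move=> Ig e0 gc; have mg := integr_measurable Ig.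
have r0 k : 0 < 2 ^+ k * e by rewrite mulr_gt0// exprn_gt0.
pose w k : R := 4 * (2 ^+ k)^-1 / (2 ^+ k * e).
have w0 k : 0 <= w k by rewrite /w divr_ge0 ?mulr_ge0 ?invr_ge0 ?exprn_ge0// ltW.
pose h k (u : measurableTypeR R) := (w k * `|g u| * \1_(ball t (2 ^+ k * e)) u)%:E.
have mh k : measurable_fun setT (h k).
  apply/measurable_EFinP; apply: measurable_funM.
    by apply: measurable_funM => //; exact: measurableT_comp.
  by apply: measurable_indic; exact: measurable_ball.
have h0 k u : (0 <= h k u)%E.
  by rewrite /h lee_fin mulr_ge0 ?(mulr_ge0 (w0 k) (normr_ge0 _))// indicE.
have c0 : 0 <= c.
  rewrite -lee_fin (le_trans _ gc)//; apply: HL_maximalT_ge0.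
  by apply: open_integrable_locally => //; exact: openT.
apply: (@le_trans _ _ (\int[mu]_u (\sum_(k <oo) h k u))%E).
  apply: ge0_le_integral => //.
  - by move=> u _; rewrite lee_fin mulr_ge0// pk_ge0.
  - apply/measurable_EFinP; apply: measurable_funM; first exact: measurableT_comp.
    apply: (@measurable_kernel2 _ (fun z => pk e z.1 z.2)); exact: measurable_pk.
  - exact: ge0_emeasurable_sum.
  - move=> u _; have [k [uk pkw]] := pk_dyadic u t e0.
    apply: (@le_trans _ _ (h k u)).
      rewrite lee_fin indicE mem_set ?mulr1; last by rewrite /ball/= distrC.
      by rewrite mulrC ler_wpM2r.
    apply: (@le_trans _ _ (\sum_(0 <= i < k.+1) h i u)%E); last exact: nneseries_lim_ge.
    by rewrite big_nat_recr//= leeDr// sume_ge0.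
rewrite integral_nneseries//.
apply: lime_le; first by apply: is_cvg_nneseries => k _ _; exact: integral_ge0.
apply: nearW => n.
have H k : (\int[mu]_u h k u <= (8 * c * (2^-1) ^+ k)%:E)%E.
  pose X := (\int[mu]_(u in ball t (2 ^+ k * e)) `|(g u)%:E|)%E.
  have -> : (\int[mu]_u h k u = (w k)%:E * X)%E.
    rewrite /X [in RHS]integral_mkcond -ge0_integralZl//.
    - apply: eq_integral => u _; rewrite patchE /h indicE; case: ifPn => _ /=.
        by rewrite mulr1 EFinM.
      by rewrite mulr0 mule0.
    - apply/(measurable_restrictT _ _).1; first exact: measurable_ball.
      by apply: measurable_funTS; apply: measurableT_comp => //; exact/measurable_EFinP.
    - by move=> u _; rewrite patchE; case: ifPn.
    - by rewrite lee_fin.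
  have Xc : (X <= (c * (2 ^+ k * e *+ 2))%:E)%E.
    have : (iavg g (ball t (2 ^+ k * e)) <= c%:E)%E.
      apply: le_trans gc; apply: ereal_sup_ubound => /=.
      by exists (2 ^+ k * e) => //; rewrite /= in_itv/= andbT.
    rewrite /iavg lebesgue_measure_ball ?(ltW (r0 k))// -/X inver mulrn_eq0/= gt_eqF//.
    rewrite lee_pdivrMl; last by rewrite pmulrn_lgt0.
    by rewrite -EFinM mulrC.
  apply: (@le_trans _ _ ((w k)%:E * (c * (2 ^+ k * e *+ 2))%:E)%E).
    by rewrite lee_wpmul2l ?lee_fin.
  rewrite -EFinM lee_fin /w le_eqVlt; apply/orP; left; apply/eqP.
  by rewrite exprVn -mulr_natr; field; rewrite !gt_eqF// exprn_gt0.
apply: (@le_trans _ _ (\sum_(0 <= k < n) (8 * c * (2^-1) ^+ k)%:E)%E).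
  by apply: lee_sum => k _; exact: H.
rewrite sumEFin lee_fin.
suff -> : \sum_(0 <= k < n) (8 * c * (2^-1) ^+ k) = 16 * c * (1 - (2^-1) ^+ n) :> R.
  by rewrite ler_piMr ?mulr_ge0// gerBl exprn_ge0.
elim: n => [|k IH]; first by rewrite big_geq// expr0 subrr mulr0.
by rewrite big_nat_recr//= IH exprS; field.
Qed.
End poisson_maximal.

Section maximal.
Context {R : realType}.
Local Notation mu := (@lebesgue_measure R).
Local Notation integr f := (mu.-integrable [set: measurableTypeR R] (EFin \o f)).
Implicit Types (e u t : R) (f : R -> R).

(** It makes [QT] at the height [a + d] a Poisson average of [QT d f], so that one maximal function,
    taken at height [d], controls higher levels. *)
Lemma QT_semigroup f a d t : integr f -> 0 < a -> 0 < d -> a != d ->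
  \int[mu]_s (QT d f s * pk a t s) = pi * QT (a + d) f t.
Proof.
move=> If a0 d0 ad.
have -> : \int[mu]_s (QT d f s * pk a t s) =
    \int[mu]_s \int[mu]_u (f u * (pk a t s * qk d u s)).
  apply: eq_Rintegral => s _; rewrite /QT mulrC -RintZ; last exact: integr_fqk.
  by apply: eq_Rintegral => u _; ring.
rewrite (@Fubini_kernel _ f (fun s => d^-1 * pk a t s) (fun z => pk a t z.2 * qk d z.1 z.2)) //=.
- rewrite -RintZ; last by apply: integr_fqk => //; rewrite addr_gt0.
  by apply: eq_Rintegral => u _; rewrite integral_pk_qk//; ring.
- exact/integrZ/integrable_pk.
- apply: measurable_funM; last exact: measurable_qk.
  apply: measurableT_comp; last exact: measurable_snd.
  by apply: continuous_measurable_fun; exact: continuous_pk.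
- move=> u s; rewrite normrM ler_wpM2l// normrM (ger0_norm (pk_ge0 _ _ a0)) mulrC.
  by rewrite ler_wpM2r ?pk_ge0// qk_le.
- move=> s; exists (pk a t s * d^-1) => u; rewrite normrM (ger0_norm (pk_ge0 _ _ a0)).
  by rewrite ler_wpM2l ?pk_ge0// qk_le.
Qed.

Definition hk e u t : R := if e < `|u - t| then (u - t)^-1 else 0.

Definition HT e f t : R := \int[mu]_u (f u * hk e u t).

Lemma hk_le e u t : 0 < e -> `|hk e u t| <= e^-1.
Proof.
move=> e0; rewrite /hk; case: ifPn => h; last by rewrite normr0 invr_ge0 ltW.
by rewrite normfV lef_pV2 ?posrE ?(lt_trans e0 h) ?(ltW h).
Qed.

Lemma hk_qk e u t : 0 < e -> `|hk e u t - qk e u t| <= pk e u t.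
Proof.
move=> e0; rewrite /hk /qk /pk; have D0 := denom_gt0 u t e0.
set y := u - t in D0 *; case: ifPn => [h|]; last first.
  rewrite -leNgt sub0r normrN normrM normfV (gtr0_norm D0) => ye.
  by rewrite ler_wpM2r// invr_ge0 ltW.
have y0 : y != 0 by rewrite -normr_gt0 (lt_trans e0).
rewrite (_ : y^-1 - y / (y ^+ 2 + e ^+ 2) = (e / y) * (e / (y ^+ 2 + e ^+ 2))); last first.
  by field; rewrite gt_eqF.
have p0 : 0 <= e / (y ^+ 2 + e ^+ 2) by rewrite divr_ge0// ltW.
rewrite normrM (ger0_norm p0) ler_piMl// normrM normfV (gtr0_norm e0).
by rewrite ler_pdivrMr ?normr_gt0// mul1r ltW.
Qed.

Lemma measurable_hk e : 0 < e -> measurable_fun [set: measurableTypeR R * measurableTypeR R]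
  (fun z : measurableTypeR R * measurableTypeR R => hk e z.1 z.2).
Proof.
move=> e0.
(* [k] is continuous and equals [y^-1] where [e <= `|y|]. *)
pose k (y : R) := y / ((y ^+ 2 + e ^+ 2 + `|y ^+ 2 - e ^+ 2|) / 2).
have mk : measurable_fun setT k.
  have m2 : measurable_fun setT (fun y : measurableTypeR R => y ^+ 2) by exact: measurable_funX.
  apply: measurable_funM => //; apply: continuous_measurable_fun => y.
  apply: cvgV.
    by rewrite gt_eqF// divr_gt0// ltr_wpDr// ltr_wpDl ?sqr_ge0// exprn_gt0.
  apply: cvgMl; apply: cvgD.
    by apply: cvgD; [exact: exprn_continuous|exact: cvg_cst].
  apply: cvg_norm; apply: cvgB; [exact: exprn_continuous|exact: cvg_cst].
have -> : (fun z : measurableTypeR R * measurableTypeR R => hk e z.1 z.2) =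
    (fun z => if e < `|z.1 - z.2| then k (z.1 - z.2) else 0).
  apply/funext => -[u t] /=; rewrite /hk /k; case: ifPn => // h.
  have y0 : u - t != 0 by rewrite -normr_gt0 (lt_trans e0).
  rewrite ger0_norm.
    rewrite (_ : _ / 2 = (u - t) ^+ 2); last by field.
    by field.
  rewrite subr_ge0 -(real_normK (num_real (u - t))) lerXn2r ?nnegrE ?(ltW e0) ?(ltW h)//.
have md : measurable_fun [set: measurableTypeR R * measurableTypeR R]
    (fun z : measurableTypeR R * measurableTypeR R => z.1 - z.2).
  by apply: measurable_funB; [exact: measurable_fst|exact: measurable_snd].
apply: measurable_fun_ifT => //.
  by apply: measurable_fun_ltr => //; exact: measurableT_comp.
exact: measurableT_comp mk md.
Qed.

Lemma integr_fhk e f t : 0 < e -> integr f -> integr (fun u => f u * hk e u t).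
Proof.
move=> e0 If; apply: (@le_integrable_real _ _ (fun u => e^-1 * `|f u|)).
- apply: measurable_funM; first exact: integr_measurable.
  by apply: (@measurable_kernel2 _ (fun z => hk e z.1 z.2)); exact: measurable_hk.
- exact/integrZ/integr_norm.
- by move=> u; rewrite normrM mulrC ler_wpM2r// hk_le.
Qed.

Lemma measurable_HT e f : 0 < e -> integr f -> measurable_fun setT (HT e f).
Proof.
move=> e0 If.
apply: (@measurable_bounded_kernel _ (fun z => hk e z.1 z.2) f e^-1) => //.
  exact: measurable_hk.
by move=> u t; exact: hk_le.
Qed.

Lemma HT_QT_le e f t : 0 < e -> integr f ->
  `|HT e f t - QT e f t| <= \int[mu]_u (`|f u| * pk e u t).
Proof.
move=> e0 If; rewrite /HT /QT -RintB; [|exact: integr_fhk|exact: integr_fqk].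
rewrite (le_trans (le_normr_Rintegral _ _))//.
  by apply: integrB; [exact: integr_fhk|exact: integr_fqk].
apply: le_Rintegral => //.
- by apply/integr_norm/integrB; [exact: integr_fhk|exact: integr_fqk].
- by apply: integr_fpk => //; exact: integr_norm.
- by move=> u _; rewrite -mulrBr normrM ler_wpM2l// hk_qk.
Qed.

Lemma expR1_le4 : expR 1 <= 4 :> R.
Proof.
rewrite (_ : 1 = 2^-1 + 2^-1); last by lra.
rewrite expRD; have h1 : 1 + - 2^-1 <= expR (- 2^-1) :> R := expR_ge1Dx _.
have h2 := expRxMexpNx_1 (2^-1 : R); have h3 := expR_gt0 (2^-1 : R).
have h4 : expR 2^-1 <= 2 :> R by nra.
nra.
Qed.

Lemma deltaV_ge1 : 1 <= (@delta R)^-1.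
Proof.
rewrite /delta invrK; have := pi_ge2 R; have : 1 + 1 <= expR 1 :> R := expR_ge1Dx _.
by move=> *; nra.
Qed.

(** A union of the [E k] may be large, whereas the lower limit is an increasing union of
    intersections and inherits the bound [K] by continuity from below. *)
Lemma mu_liminf_le (E : nat -> set (measurableTypeR R)) (K : \bar R) :
  (forall k, measurable (E k)) -> (forall k, mu (E k) <= K)%E ->
  measurable (\bigcup_m \bigcap_(k in [set k | (m <= k)%N]) E k) /\
  (mu (\bigcup_m \bigcap_(k in [set k | (m <= k)%N]) E k) <= K)%E.
Proof.
move=> mE EK; pose D m := \bigcap_(k in [set k | (m <= k)%N]) E k.
have mD m : measurable (D m) by apply: bigcap_measurable => //; exists m => /=.
have mU : measurable (\bigcup_m D m) by exact: bigcupT_measurable.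
split => //.
have ndD : nondecreasing_seq D.
  move=> m n mn; apply/subsetPset => x Dx k /= nk; apply: Dx => /=.
  exact: leq_trans nk.
have H := @nondecreasing_cvg_mu _ _ _ mu _ mD mU ndD.
rewrite -(cvg_lim _ H)//; apply: lime_le; first exact: cvgP H.
apply: nearW => m /=; rewrite (le_trans _ (EK m))// le_measure ?inE//.
by move=> x; apply => /=.
Qed.

Section maximal_bound.
Variables (f : R -> R) (l A : R).
Hypotheses (If : integr f) (l0 : 0 < l).
Let I11 : set (measurableTypeR R) := `]-1, 1[%classic.
Let J : set (measurableTypeR R) := `]-3, 3[%classic.
Hypothesis f0 : forall x, ~ I11 x -> f x = 0.
Hypothesis fA : (\int[mu]_(x in I11) (phi (`|f x| / l))%:E <= A%:E)%E.

Let mI : measurable I11. Proof. exact: measurable_itv. Qed.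
Let mJ : measurable J. Proof. exact: measurable_itv. Qed.
Let n1 := \int[mu]_u `|f u|.
Let QJ d : R -> R := QT d f \_ J.
Let N := l / delta * (A + 64).

Let A0 : 0 <= A.
Proof.
rewrite -lee_fin (le_trans _ fA)// integral_ge0// => x _.
by rewrite lee_fin phi_ge0// divr_ge0// ltW.
Qed.

Let mf : measurable_fun setT f. Proof. exact: integr_measurable. Qed.

(** Young's inequality at [r = 1] bounds the [L^1] norm by [l (A + 2 e)]. This is enlarged to [N] so
    that a single constant serves both for [f] and for [QT d f]. *)
Lemma modular_L1_le : n1 <= N.
Proof.
have p0 u : 0 <= phi (`|f u| / l) by rewrite phi_ge0// divr_ge0// ltW.
have mp : measurable_fun setT (fun u : measurableTypeR R => phi (`|f u| / l)).
  have ml : measurable_fun setT (fun u : measurableTypeR R => `|f u| / l).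
    by apply: measurable_funM => //; exact: measurableT_comp.
  apply: measurable_funM => //; apply: measurableT_comp => //.
  exact: measurable_funD.
apply: (@le_trans _ _ (l * (A + 2 * expR 1))); last first.
  have d1 := deltaV_ge1; have e4 := expR1_le4.
  rewrite /N -mulrA ler_wpM2l ?(ltW l0)//.
  have A64 : 0 <= A + 64 by rewrite addr_ge0.
  have := ler_wpM2r A64 d1; rewrite mul1r; apply: le_trans; lra.
rewrite -lee_fin /n1 /Rintegral fineK; last first.
  by apply: integrable_fin_num => //; exact: integr_norm.
apply: (@le_trans _ _ (\int[mu]_(u in I11) (l%:E * ((phi (`|f u| / l))%:E + (expR 1)%:E)))%E).
  rewrite [leRHS]integral_mkcond; apply: ge0_le_integral => //.
  - by apply/measurable_EFinP; exact: measurableT_comp.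
  - apply/(measurable_restrictT _ _).1 => //; apply/measurable_funTS/measurable_EFinP.
    by apply: measurable_funM => //; exact: measurable_funD.
  - move=> u _; rewrite patchE; case: ifPn => [_|]; last first.
      by rewrite notin_setE => /f0 ->; rewrite normr0.
    rewrite -EFinD -EFinM lee_fin.
    have := young_phi 1 (divr_ge0 (normr_ge0 (f u)) (ltW l0)).
    move/(ler_wpM2l (ltW l0)); apply: le_trans.
    by rewrite mulr1 mulrCA divff ?gt_eqF// mulr1.
rewrite ge0_integralZl//; last 3 first.
- apply/measurable_funTS/measurable_EFinP; exact: measurable_funD.
- by move=> u _; rewrite adde_ge0// lee_fin// expR_ge0.
- by rewrite lee_fin ltW.
rewrite [leRHS]EFinM lee_wpmul2l ?lee_fin ?(ltW l0)//.
rewrite ge0_integralD//; last 2 first.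
- by move=> u _; rewrite lee_fin.
- exact/measurable_funTS/measurable_EFinP.
rewrite EFinD leeD// integral_cst//= lebesgue_measure_itv/= lte_fin ifT; last lra.
by rewrite -EFinD -EFinM lee_fin mulrC ler_wpM2r ?expR_ge0//; lra.
Qed.

(** A point off [J] is at distance at least 2 from every source in [I11], where the kernel is at
    most [1/2]. *)
Let QT_far d s : 0 < d -> ~ J s -> `|QT d f s| <= n1 / 2.
Proof.
move=> d0 Js; rewrite (le_trans (le_normr_Rintegral _ _))//; first exact: integr_fqk.
rewrite mulrC /n1 -RintZ; last exact: integr_norm.
apply: le_Rintegral => //; first exact/integr_norm/integr_fqk.
  exact/integrZ/integr_norm.
move=> u _; rewrite normrM mulrC.
have [/f0 ->|uI] := pselect (~ I11 u); first by rewrite normr0 !mulr0.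
rewrite ler_wpM2r//; move/contrapT: uI; rewrite /I11/= in_itv/= => /andP[u1 u2].
have us : 2 <= `|u - s|.
  rewrite leNgt ltr_norml; apply/negP => /andP[? ?]; apply: Js.
  by rewrite /J/= in_itv/=; lra.
rewrite /qk normrM normfV (gtr0_norm (denom_gt0 _ _ d0)) ler_pdivrMr ?denom_gt0//.
rewrite -(real_normK (num_real (u - s))).
have := sqr_ge0 d; nra.
Qed.

Let mQ d : 0 < d -> measurable_fun setT (QT d f).
Proof. by move=> d0; exact: measurable_QT. Qed.

Let integr_QJ d : 0 < d -> integr (QJ d).
Proof.
move=> d0; apply: (@le_integrable_real _ _ (fun s => (d^-1 * n1) * \1_J s)).
- by apply/(measurable_restrictT _ _).1 => //; apply: measurable_funTS; exact: mQ.
- exact/integrZ/(integrable_indic_itv (-3) 3 false true).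
- move=> s; rewrite /QJ patchE indicE; case: ifPn => _.
    by rewrite mulr1 QT_le.
  by rewrite normr0 mulr0.
Qed.

(** In the semigroup identity the part of [QT d f] on [J] is handled by the maximal function and the
    rest by [QT_far]; division by [pi] only improves the first term. *)
Let pointwise d a c t : 0 < d -> 0 < a -> a != d -> 0 < c ->
  (HL_maximal (QJ d) t <= c%:E)%E -> `|QT (a + d) f t| <= 16 * c + n1 / 2.
Proof.
move=> d0 a0 ad c0 hc.
have n10 : 0 <= n1 by exact: Rintegral_ge0.
have IQJ : integr (fun s => `|QJ d s| * pk a t s).
  under eq_fun do rewrite pkC; apply: integr_fpk => //.
  by apply: integr_norm; exact: integr_QJ.
have IQ : integr (fun s => QT d f s * pk a t s).
  apply: (@le_integrable_real _ _ (fun s => (d^-1 * n1) * pk a t s)).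
  - apply: measurable_funM; first exact: mQ.
    by apply: continuous_measurable_fun; exact: continuous_pk.
  - exact/integrZ/integrable_pk.
  - by move=> s; rewrite normrM (ger0_norm (pk_ge0 _ _ a0)) ler_wpM2r ?pk_ge0// QT_le.
have H1 : \int[mu]_s (`|QJ d s| * pk a t s) <= 16 * c.
  rewrite -lee_fin /Rintegral fineK; last exact: integrable_fin_num.
  under eq_integral do rewrite pkC.
  exact: (poisson_le_HL (integr_QJ d0) a0).
have : pi * `|QT (a + d) f t| <= 16 * c + n1 / 2 * pi.
  rewrite -{1}(gtr0_norm (pi_gt0 R)) -normrM -QT_semigroup//.
  rewrite (le_trans (le_normr_Rintegral _ _))//.
  apply: (@le_trans _ _ (\int[mu]_s (`|QJ d s| * pk a t s + n1 / 2 * pk a t s))).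
    apply: le_Rintegral => //; first exact: integr_norm.
      by apply: integrD => //; apply/integrZ/integrable_pk.
    move=> s _; rewrite normrM (ger0_norm (pk_ge0 _ _ a0)) -mulrDl ler_wpM2r ?pk_ge0//.
    rewrite /QJ patchE; case: ifPn => sJ; first by rewrite lerDl divr_ge0.
    by rewrite normr0 add0r; apply: QT_far => //; rewrite notin_setE in sJ.
  rewrite RintD//; last exact/integrZ/integrable_pk.
  by rewrite (RintZ _ (integrable_pk t a0)) integral_pk// lerD2r.
have p2 := pi_ge2 R; have q0 := normr_ge0 (QT (a + d) f t).
rewrite mulrC -lerBlDr -mulrBl => H.
rewrite -lerBlDr; have [|qn] := leP (`|QT (a + d) f t| - n1 / 2) 0; first lra.
by nra.
Qed.

Lemma HT_maximal s : 0 < s -> exists B : set (measurableTypeR R),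
  [/\ measurable B, (mu B <= (384 * N / s)%:E)%E &
    forall t, I11 t -> ~ B t -> forall e, 0 < e -> `|HT e f t| <= s].
Proof.
move=> s0.
have N0 : 0 <= N by rewrite (le_trans _ modular_L1_le)// Rintegral_ge0.
(* For [s < N] the bound exceeds 384 and all of [I11] may be excluded. Otherwise [n1 <= N <= s],
   which leaves room for the far part [n1 / 2]. *)
have [Ns|sN] := leP N s; last first.
  exists I11; split => //.
  rewrite lebesgue_measure_itv/= lte_fin ifT; last lra.
  by rewrite -EFinD lee_fin ler_pdivlMr//; lra.
(* With this threshold the total [16 c + 16 c + n1 / 2] is [(s + n1) / 2]. Two maximal inequalities
   with constant 3 then yield [384 = 2 * 3 * 64]. *)
pose c := s / 64; have c0 : 0 < c by rewrite divr_gt0.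
have c30 : 0 <= 3 / c by rewrite divr_ge0// ltW.
pose E k := [set t | (c%:E < HL_maximal (QJ k.+1%:R^-1) t)%E].
pose E' := [set t | (c%:E < HL_maximal f t)%E].
have d0 k : 0 < (k.+1%:R : R)^-1 by rewrite invr_gt0.
have loc g : integr g -> locally_integrable setT g.
  by move=> Ig; apply: open_integrable_locally => //; exact: openT.
have mset g : integr g -> measurable [set t : measurableTypeR R | (c%:E < HL_maximal g t)%E].
  move=> /loc lg; rewrite -[X in measurable X]setTI.
  by apply: emeasurable_fun_o_infty => //; exact: measurable_HL_maximal.
have muE' : (mu E' <= (3 / c * N)%:E)%E.
  rewrite (le_trans (maximal_inequality (loc _ If) c0))//.
  rewrite [leRHS]EFinM lee_wpmul2l ?lee_fin//.
  apply: (@le_trans _ _ n1%:E); last by rewrite lee_fin modular_L1_le.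
  by rewrite /n1 /Rintegral fineK//; apply: integrable_fin_num => //; exact: integr_norm.
have muE k : (mu (E k) <= (3 / c * N)%:E)%E.
  rewrite (le_trans (maximal_inequality (loc _ (integr_QJ (d0 k))) c0))//.
  rewrite [leRHS]EFinM lee_wpmul2l ?lee_fin//.
  apply: le_trans (QT_L1_le If (d0 k) l0 f0 fA).
  rewrite [leRHS]integral_mkcond; apply: ge0_le_integral => //.
  - apply: measurableT_comp => //; apply/measurable_EFinP.
    exact: (integr_measurable (integr_QJ (d0 k))).
  - apply/(measurable_restrictT _ _).1 => //; apply/measurable_funTS/measurable_EFinP.
    by apply: measurableT_comp => //; exact: mQ.
  - by move=> t _; rewrite /QJ !patchE; case: ifPn => //= _; rewrite normr0.
have [mL muL] := mu_liminf_le (fun k => mset _ (integr_QJ (d0 k))) muE.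
set L := \bigcup_m _ in mL muL.
exists (E' `|` L); split.
- by apply: measurableU => //; exact: mset.
- rewrite (le_trans (measureU2 _ (mset _ If) mL))//.
  rewrite (le_trans (leeD muE' muL))// -EFinD lee_fin le_eqVlt.
  by apply/orP; left; apply/eqP; rewrite /c; field; rewrite gt_eqF.
move=> t tI /not_orP[tE' tL] e e0.
(* Off the lower limit [L], [t] avoids [E k] for arbitrarily large [k]. The choice [d < e / 2] makes
   [e - d] positive and different from [d]. *)
have [k [ke kL]] : exists k : nat, k.+1%:R^-1 < e / 2 /\ ~ E k t.
  have [m hm] : exists m : nat, m.+1%:R^-1 < e / 2.
    exists (Num.trunc (2 / e)); rewrite invf_plt ?posrE ?divr_gt0//.
    by rewrite invf_div; exact: truncnS_gt.
  apply: contra_notP tL => /forallNP H; exists m => // k /= mk.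
  apply: contrapT => Ek; apply: (H k); split => //.
  by rewrite (le_lt_trans _ hm)// lef_pV2 ?posrE// ler_nat ltnS.
set d := k.+1%:R^-1 in ke kL.
have Qe : `|QT e f t| <= 16 * c + n1 / 2.
  rewrite -(subrK d e); apply: (pointwise (d0 k)) => //.
  - by rewrite subr_gt0; lra.
  - by have de : d < e - d by [lra]; rewrite neq_lt de orbT.
  - by rewrite leNgt; exact/negP.
have Pe : \int[mu]_u (`|f u| * pk e u t) <= 16 * c.
  rewrite -lee_fin /Rintegral fineK; last first.
    by apply: integrable_fin_num => //; apply: integr_fpk => //; exact: integr_norm.
  by apply: poisson_le_HL => //; rewrite leNgt; exact/negP.
have := HT_QT_le t e0 If => HQ.
have : `|HT e f t| <= `|HT e f t - QT e f t| + `|QT e f t|.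
  by rewrite -{1}(subrK (QT e f t) (HT e f t)) ler_normD.
move=> H; rewrite (le_trans H)// (le_trans (lerD (le_trans HQ Pe) Qe))//.
rewrite (_ : 16 * c + (16 * c + n1 / 2) = (s + n1) / 2); last by rewrite /c; field.
by rewrite ler_pdivrMr// mulr_natr mulr2n lerD2l (le_trans modular_L1_le).
Qed.
End maximal_bound.
End maximal.

(** * Almost everywhere convergence *)

Section convergence.
Context {R : realType}.
Local Notation mu := (@lebesgue_measure R).
Local Notation integr f := (mu.-integrable [set: measurableTypeR R] (EFin \o f)).
Implicit Types (e u t : R) (f g : R -> R).
Let I11 : set (measurableTypeR R) := `]-1, 1[%classic.

Lemma HTZ e f k t : 0 < e -> integr f -> HT e (fun x => k * f x) t = k * HT e f t.
Proof.
move=> e0 If; rewrite /HT -RintZ; last exact: integr_fhk.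
by apply: eq_Rintegral => u _; rewrite mulrA.
Qed.

Lemma HTD e f g t : 0 < e -> integr f -> integr g ->
  HT e (fun x => f x + g x) t = HT e f t + HT e g t.
Proof.
move=> e0 If Ig; rewrite /HT -RintD; [|exact: integr_fhk|exact: integr_fhk].
by apply: eq_Rintegral => u _; rewrite mulrDl.
Qed.

Lemma HTB e f g t : 0 < e -> integr f -> integr g ->
  HT e (fun x => f x - g x) t = HT e f t - HT e g t.
Proof.
move=> e0 If Ig; rewrite /HT -RintB; [|exact: integr_fhk|exact: integr_fhk].
by apply: eq_Rintegral => u _; rewrite mulrBl.
Qed.

(** The Cauchy form needs no candidate for the limit and passes through uniform approximation. *)
Definition HTcauchy f t := forall r : R, 0 < r -> exists2 e1 : R, 0 < e1 &
  forall e e' : R, 0 < e -> e < e1 -> 0 < e' -> e' < e1 -> `|HT e f t - HT e' f t| <= r.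

Definition ae_conv f := integr f /\ mu.-negligible [set t | I11 t /\ ~ HTcauchy f t].

Lemma HTcauchy_eventually_const f t e1 (c : R) : 0 < e1 ->
  (forall e, 0 < e -> e < e1 -> HT e f t = c) -> HTcauchy f t.
Proof.
move=> e10 H r r0; exists e1 => // e e' *; rewrite !H// subrr normr0.
exact: ltW.
Qed.

Lemma HTcauchyZ f k t : integr f -> HTcauchy f t -> HTcauchy (fun x => k * f x) t.
Proof.
move=> If ft r r0; have k0 : 0 < `|k| + 1 by rewrite ltr_wpDl.
have [e1 e10 H] := ft (r / (`|k| + 1)) (divr_gt0 r0 k0).
exists e1 => // e e' p1 p2 p3 p4; rewrite !HTZ// -mulrBr normrM.
rewrite (le_trans (ler_wpM2l _ (H _ _ p1 p2 p3 p4)))//.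
by rewrite mulrCA ler_piMr ?(ltW r0)// ler_pdivrMr// mul1r lerDl.
Qed.

Lemma HTcauchyD f g t : integr f -> integr g ->
  HTcauchy f t -> HTcauchy g t -> HTcauchy (fun x => f x + g x) t.
Proof.
move=> If Ig ft gt r r0; have r20 : 0 < r / 2 by rewrite divr_gt0.
have [e1 e10 H1] := ft _ r20; have [e2 e20 H2] := gt _ r20.
exists (Num.min e1 e2); first by rewrite lt_min e10.
move=> e e' p1; rewrite !lt_min => /andP[p2 p3] p4 /andP[p5 p6].
rewrite !HTD// opprD addrACA (le_trans (ler_normD _ _))// [leRHS]splitr.
by rewrite lerD ?H1 ?H2.
Qed.

Lemma ae_convZ f k : ae_conv f -> ae_conv (fun x => k * f x).
Proof.
move=> [If nf]; split; first exact: integrZ.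
by apply: negligibleS nf => t [tI tf]; split => // ft; apply: tf; exact: HTcauchyZ.
Qed.

Lemma ae_convD f g : ae_conv f -> ae_conv g -> ae_conv (fun x => f x + g x).
Proof.
move=> [If nf] [Ig ng]; split; first exact: integrD.
apply: negligibleS (negligibleU nf ng) => t [tI tfg].
have [ft|ft] := pselect (HTcauchy f t); last by left.
by right; split => // gt; apply: tfg; exact: HTcauchyD.
Qed.

Lemma ae_convB f g : ae_conv f -> ae_conv g -> ae_conv (fun x => f x - g x).
Proof.
move=> cf cg; under eq_fun do rewrite -mulN1r.
by apply: ae_convD => //; exact: ae_convZ.
Qed.

Lemma ae_conv0 : ae_conv (fun=> 0).
Proof.
split; first exact: integrable0.
apply: negligibleS (negligible_set0 _) => t [_]; apply.
apply: (@HTcauchy_eventually_const _ _ 1 0) => // e e0 _.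
by rewrite /HT; under eq_Rintegral do rewrite mul0r; rewrite /Rintegral integral0.
Qed.

Lemma ae_conv_sum (J : Type) (s : seq J) (F : J -> R -> R) :
  (forall j, ae_conv (F j)) -> ae_conv (fun x => \sum_(j <- s) F j x).
Proof.
move=> cF; elim: s => [|j s IH].
  by under eq_fun do rewrite big_nil; exact: ae_conv0.
by under eq_fun do rewrite big_cons; exact: ae_convD.
Qed.

(** With [r = 1/(k+1)] the sets [B k] have measure tending to 0, so the intersection of any tail is
    null. Off these intersections [t] avoids [B k] for arbitrarily large [k], which suffices for a
    three-term estimate; summability of the measures plays no part. *)
Lemma ae_conv_approx f : integr f ->
  (forall r : R, 0 < r -> exists2 g, ae_conv g & exists B : set (measurableTypeR R),
    [/\ measurable B, (mu B <= r%:E)%E & forall t, I11 t -> ~ B t ->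
      forall e, 0 < e -> `|HT e (fun x => f x - g x) t| <= r]) ->
  ae_conv f.
Proof.
move=> If H; split => //.
have rk k : 0 < (k.+1%:R : R)^-1 by rewrite invr_gt0.
pose g k := sval (cid2 (H _ (rk k))).
have cg k : ae_conv (g k) by rewrite /g; case: cid2.
have HB k : exists B : set (measurableTypeR R),
    [/\ measurable B, (mu B <= (k.+1%:R^-1)%:E)%E & forall t, I11 t -> ~ B t ->
      forall e, 0 < e -> `|HT e (fun x => f x - g k x) t| <= k.+1%:R^-1].
  by rewrite /g; case: cid2.
pose B k := sval (cid (HB k)).
have mB k : measurable (B k) by rewrite /B; case: cid => ? [].
have muB k : (mu (B k) <= (k.+1%:R^-1)%:E)%E by rewrite /B; case: cid => ? [].
have BP k t : I11 t -> ~ B k t ->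
      forall e, 0 < e -> `|HT e (fun x => f x - g k x) t| <= k.+1%:R^-1.
  by rewrite /B; case: cid => ? [? ? +] /=; apply.
pose D m := \bigcap_(k in [set k | (m <= k)%N]) B k.
have mD m : measurable (D m) by apply: bigcap_measurable => //; exists m => /=.
have D0 m : mu.-negligible (D m).
  apply/negligibleP => //; apply/eqP; rewrite eq_le measure_ge0 andbT.
  apply/lee_addgt0Pr => e e0; rewrite add0e.
  have [n hn] : exists n : nat, n.+1%:R^-1 < e.
    exists (Num.trunc e^-1); rewrite invf_plt ?posrE//; exact: truncnS_gt.
  apply: (@le_trans _ _ (mu (B (m + n)%N))).
    by rewrite le_measure ?inE// => x; apply => /=; exact: leq_addr.
  rewrite (le_trans (muB _))// lee_fin (le_trans _ (ltW hn))//.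
  by rewrite lef_pV2 ?posrE// ler_nat ltnS leq_addl.
have NG : mu.-negligible (\bigcup_k [set t | I11 t /\ ~ HTcauchy (g k) t] `|` \bigcup_m D m).
  apply: negligibleU; apply: negligible_bigcup => k; last exact: D0.
  exact: (cg k).2.
apply: negligibleS NG => t [tI tf].
apply: contrapT => /not_orP[tG tD]; apply: tf => r r0.
have r30 : 0 < r / 3 by rewrite divr_gt0.
have [n hn] : exists n : nat, n.+1%:R^-1 < r / 3.
  exists (Num.trunc (r / 3)^-1); rewrite invf_plt ?posrE//; exact: truncnS_gt.
have [k [nk kB]] : exists k, (n <= k)%N /\ ~ B k t.
  apply: contra_notP tD => /forallNP Hk; exists n => // k /= nk.
  by apply: contrapT => Bk; apply: (Hk k).
have hk : k.+1%:R^-1 <= r / 3.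
  by rewrite (le_trans _ (ltW hn))// lef_pV2 ?posrE// ler_nat ltnS.
have gt : HTcauchy (g k) t.
  by apply: contrapT => gt; apply: tG; exists k.
have [e1 e10 He] := gt _ r30; exists e1 => // e e' p1 p2 p3 p4.
have Igk : integr (g k) by case: (cg k).
have h1 := BP k t tI kB e p1; have h2 := BP k t tI kB e' p3.
rewrite HTB// in h1; rewrite HTB// in h2.
have h3 := He _ _ p1 p2 p3 p4.
rewrite (_ : HT e f t - HT e' f t = (HT e f t - HT e (g k) t) +
  (HT e (g k) t - HT e' (g k) t) - (HT e' f t - HT e' (g k) t)); last by ring.
rewrite (le_trans (ler_normB _ _))// (le_trans (lerD (ler_normD _ _) (lexx _)))//.
rewrite (le_trans (lerD (lerD (le_trans h1 hk) h3) (le_trans h2 hk)))//.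
by rewrite le_eqVlt; apply/orP; left; apply/eqP; field.
Qed.

Lemma ae_conv_modular f : integr f -> (forall x, ~ I11 x -> f x = 0) ->
  (forall l : R, 0 < l -> exists g, [/\ ae_conv g, forall x, ~ I11 x -> g x = 0 &
     (\int[mu]_(x in I11) (phi (`|f x - g x| / l))%:E <= 1%:E)%E]) ->
  ae_conv f.
Proof.
move=> If f0 H; apply: ae_conv_approx => // r r0.
have d0 := @delta_gt0 R.
(* Solves [384 N / r = r] for [N = l / delta * (1 + 64)]. *)
pose l := r * r * delta / (384 * 65).
have l0 : 0 < l.
  by apply: divr_gt0; [apply: mulr_gt0 => //; exact: mulr_gt0|lra].
have [g [cg g0 fg]] := H l l0; exists g => //.
have Ig : integr g by case: cg.
have [|B [mB muB HB]] := @HT_maximal _ (fun x => f x - g x) l 1 (integrB If Ig) l0 _ fg r r0.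
  by move=> x xI; rewrite f0// g0// subrr.
exists B; split => //.
rewrite (le_trans muB)// lee_fin le_eqVlt; apply/orP; left; apply/eqP.
by rewrite /l; field; rewrite !gt_eqF.
Qed.
End convergence.

(** * Convergence for indicators of rays *)

Section intervals.
Context {R : realType}.
Local Notation mu := (@lebesgue_measure R).
Local Notation integr f := (mu.-integrable [set: measurableTypeR R] (EFin \o f)).
Implicit Types (e u t : R) (f g : R -> R).
Let I11 : set (measurableTypeR R) := `]-1, 1[%classic.

(** The sign [s] lets one logarithmic primitive serve on both sides of the pole. *)
Lemma integral_inv_itv (s a b t : R) : s = 1 \/ s = -1 -> a < b ->
  (forall u, a <= u -> u <= b -> 0 < s * (u - t)) ->
  mu.-integrable `[a, b] (EFin \o (fun u => (u - t)^-1)) /\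
  \int[mu]_(u in `[a, b]) (u - t)^-1 = ln (s * (b - t)) - ln (s * (a - t)).
Proof.
move=> s1 ab H.
have ut u : a <= u -> u <= b -> u - t != 0.
  by move=> au ub; have := H u au ub; apply: contraTneq => ->; rewrite mulr0 ltxx.
have C : {within `[a, b], continuous (fun u => (u - t)^-1)}.
  apply: continuous_in_subspaceT => u; rewrite inE/= in_itv/= => /andP[au ub].
  apply: cvgV; first exact: ut.
  by apply: cvgB; [exact: cvg_id|exact: cvg_cst].
split; first by apply: continuous_compact_integrable => //; exact: segment_compact.
have D u : a <= u -> u <= b -> is_derive u 1 (fun u : R => ln (s * (u - t))) ((u - t)^-1).
  move=> au ub; have h := H u au ub.
  have H1 : is_derive u 1 (fun u : R => s * (u - t)) s.
    by apply: is_derive_eq; rewrite /GRing.scale/=; ring.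
  have H2 := @is_derive1_comp R (@ln R) (fun u : R => s * (u - t)) u _ _ (is_derive1_ln h) H1.
  eapply is_derive_eq; first exact: H2.
  have s0 : s != 0 by case: s1 => ->; rewrite ?oppr_eq0 oner_eq0.
  by field; rewrite s0 ut.
have E : (\int[mu]_(u in `[a, b]) ((u - t)^-1)%:E = (ln (s * (b - t)))%:E - (ln (s * (a - t)))%:E)%E.
  apply: (@continuous_FTC2 _ _ (fun u => ln (s * (u - t)))) => //.
    have cD u : a <= u -> u <= b -> {for u, continuous (fun u : R => ln (s * (u - t)))}.
      move=> au ub; apply: differentiable_continuous.
      by apply/derivable1_diffP; have [] := D u au ub.
    split.
    - by move=> u; rewrite in_itv/= => /andP[au ub]; have [] := D u (ltW au) (ltW ub).
    - by apply: cvg_at_right_filter; apply: cD => //; exact: ltW.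
    - by apply: cvg_at_left_filter; apply: cD => //; exact: ltW.
  move=> u; rewrite in_itv/= => /andP[au ub]; rewrite derive1E.
  by have [] := D u (ltW au) (ltW ub).
by rewrite /Rintegral E.
Qed.

(** Principal value cancellation: between the two radii the left side contributes [ln e - ln e'] and
    the right side [ln e' - ln e]. *)
Lemma HT_window_const f t e e' : integr f -> 0 < e -> e < e' ->
  (forall u, `|u - t| <= e' -> f u = 1) -> HT e f t = HT e' f t.
Proof.
move=> If e0 ee' f1; have e'0 : 0 < e' := lt_trans e0 ee'.
apply/eqP; rewrite -subr_eq0; apply/eqP.
rewrite /HT -RintB; [|exact: integr_fhk|exact: integr_fhk].
have [IL EL] := @integral_inv_itv (-1) (t - e') (t - e) t (or_intror erefl) ltac:(lra)
  ltac:(by move=> u *; lra).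
have [IR ER] := @integral_inv_itv 1 (t + e) (t + e') t (or_introl erefl) ltac:(lra)
  ltac:(by move=> u *; lra).
have IL' : mu.-integrable `[t - e', t - e[ (EFin \o (fun u => (u - t)^-1)).
  by apply: integrableS IL => //; apply: subset_itvl; rewrite bnd_simp.
have IR' : mu.-integrable `]t + e, t + e'] (EFin \o (fun u => (u - t)^-1)).
  by apply: integrableS IR => //; apply: subset_itvr; rewrite bnd_simp.
have -> : (fun u => f u * hk e u t - f u * hk e' u t) =
  (fun u => ((fun u => (u - t)^-1) \_ `[t - e', t - e[) u + ((fun u => (u - t)^-1) \_ `]t + e, t + e']) u).
  apply/funext => u; rewrite !patchE /hk.
  have memL : (u \in (`[t - e', t - e[%classic : set R)) = (t - e' <= u < t - e).
    by apply/idP/idP; rewrite inE/= in_itv.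
  have memR : (u \in (`]t + e, t + e']%classic : set R)) = (t + e < u <= t + e').
    by apply/idP/idP; rewrite inE/= in_itv.
  rewrite memL memR; have [ue|eu] := leP `|u - t| e.
    move: (ue); rewrite ler_norml => /andP[? ?].
    rewrite (ifF _ _ (_ : (e' < _) = false)); last first.
      by apply/negbTE; rewrite -leNgt (le_trans ue) ?(ltW ee').
    by rewrite !ifF ?mulr0 ?subrr ?addr0//; apply/negbTE/negP => /andP[? ?]; lra.
  have [ue'|eu'] := leP `|u - t| e'.
    rewrite f1// mul1r mulr0 subr0.
    move: ue'; rewrite ler_norml => /andP[? ?].
    have [ut|tu] := leP 0 (u - t).
      rewrite ger0_norm// in eu.
      by rewrite ifF ?ifT ?add0r//; [apply/andP; split; lra|apply/negbTE/negP => /andP[? ?]; lra].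
    rewrite ltr0_norm// in eu.
    by rewrite ifT ?ifF ?addr0//; [apply/negbTE/negP => /andP[? ?]; lra|apply/andP; split; lra].
  rewrite subrr; move: eu'; rewrite ltr_normr => /orP[?|?].
    by rewrite !ifF ?addr0//; apply/negbTE/negP => /andP[? ?]; lra.
  by rewrite !ifF ?addr0//; apply/negbTE/negP => /andP[? ?]; lra.
rewrite RintD; last 2 first.
- by rewrite -restrict_EFin; apply/(integrable_restrict _ _ _ _).1 => //; rewrite setTI.
- by rewrite -restrict_EFin; apply/(integrable_restrict _ _ _ _).1 => //; rewrite setTI.
rewrite -!Rintegral_mkcond Rintegral_itv_bndo_bndc// Rintegral_itv_obnd_cbnd//.
rewrite EL ER (_ : -1 * (t - e - t) = e); last by ring.
rewrite (_ : -1 * (t - e' - t) = e'); last by ring.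
rewrite (_ : 1 * (t + e' - t) = e'); last by ring.
rewrite (_ : 1 * (t + e - t) = e); last by ring.
by ring.
Qed.

(** Only [t = x] can fail. For [t < x] the truncation is inactive once [e < x - t]; for [t > x] in
    [I11] the indicator is 1 near [t] and [HT_window_const] applies. *)
Lemma ae_conv_ray (x : R) : ae_conv (\1_(I11 `&` `]x, +oo[)).
Proof.
have mI : measurable I11 by exact: measurable_itv.
have Ih : integr (\1_(I11 `&` `]x, +oo[)).
  apply: (@le_integrable_real _ _ (\1_I11)).
  - by apply: measurable_indic; apply: measurableI => //; exact: measurable_itv.
  - exact: (integrable_indic_itv (-1) 1 false true).
  - move=> u; rewrite !indicE in_setI ger0_norm//.
    by case: (u \in I11); rewrite //= lern1 leq_b1.
split => //; apply: negligibleS (_ : mu.-negligible [set x]); last first.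
  by apply/negligibleP => //; exact: lebesgue_measure_set1.
move=> t [tI]; apply: contra_notP => /eqP; rewrite neq_lt => /orP[tx|xt].
  apply: (@HTcauchy_eventually_const _ _ _ (x - t)
    (\int[mu]_u (\1_(I11 `&` `]x, +oo[) u * (u - t)^-1))).
    by rewrite subr_gt0.
  move=> e e0 ex; apply: eq_Rintegral => u _; rewrite indicE.
  case: (boolP (_ \in _)) => [|_]; last by rewrite !mul0r.
  rewrite inE/= in_itv/= andbT => -[_ xu]; congr (_ * _).
  rewrite /hk ifT// ltr_normr; apply/orP; left; lra.
move: tI; rewrite /I11/= in_itv/= => /andP[t1 t2].
pose e1 := Num.min (t - x) (Num.min (1 - t) (t + 1)).
have e10 : 0 < e1 by rewrite !lt_min !subr_gt0 xt t2 -(opprK 1) subr_gt0 t1.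
have W e e' : 0 < e -> e < e' -> e' < e1 ->
    HT e (\1_(I11 `&` `]x, +oo[)) t = HT e' (\1_(I11 `&` `]x, +oo[)) t.
  move=> e0 ee'; rewrite !lt_min => /and3P[a b c].
  apply: HT_window_const => // u; rewrite ler_norml => /andP[u1 u2].
  by rewrite indicE mem_set//; split; rewrite /I11 /= in_itv/= ?andbT; lra.
apply: (@HTcauchy_eventually_const _ _ _ (e1 / 2) (HT (e1 / 2) (\1_(I11 `&` `]x, +oo[)) t)).
  by rewrite divr_gt0.
move=> e e0 ee1; apply: W => //.
by rewrite ltr_pdivrMr// mulr_natr mulr2n ltrDl.
Qed.
End intervals.

(** * Convergence for indicators of Borel sets *)

Section borel_sets.
Context {R : realType}.
Local Notation mu := (@lebesgue_measure R).
Local Notation integr f := (mu.-integrable [set: measurableTypeR R] (EFin \o f)).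
Let I11 : set (measurableTypeR R) := `]-1, 1[%classic.

Let mI : measurable I11. Proof. exact: measurable_itv. Qed.

Lemma integr_indic_I11 (A : set (measurableTypeR R)) : measurable A ->
  integr (\1_(I11 `&` A)).
Proof.
move=> mA; apply: (@le_integrable_real _ _ (\1_I11)).
- by apply: measurable_indic; exact: measurableI.
- exact: (integrable_indic_itv (-1) 1 false true).
- move=> u; rewrite !indicE in_setI ger0_norm//.
  by case: (u \in I11); rewrite //= lern1 leq_b1.
Qed.

(** The partial unions approximate in modular: their error is the indicator of the tail [T n], with
    modular [phi (1 / l)] times the measure of [T n], which tends to 0. *)
Lemma ae_conv_bigcup (F : (set (measurableTypeR R))^nat) :
  (forall n, measurable (F n)) -> trivIset setT F ->
  (forall n, ae_conv (\1_(I11 `&` F n))) -> ae_conv (\1_(I11 `&` \bigcup_k F k)).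
Proof.
move=> mF tF cF; have mU : measurable (\bigcup_k F k) by exact: bigcupT_measurable.
pose G n := \big[setU/set0]_(k < n) F k.
have mG n : measurable (G n) by exact: bigsetU_measurable.
pose T n := I11 `&` (\bigcup_k F k `\` G n).
have mT n : measurable (T n) by apply: measurableI => //; exact: measurableD.
have GF n : G n `<=` \bigcup_k F k by move=> x; rewrite /G -bigcup_mkord => -[k _ Fk]; exists k.
apply: ae_conv_modular; first exact: integr_indic_I11.
  by move=> x xI; rewrite indicE memNset// => -[].
move=> l l0.
have T0 : mu (T n) @[n --> \oo] --> 0%E.
  have -> : 0%E = mu (\bigcap_n T n).
    rewrite (_ : \bigcap_n T n = set0) ?measure0//.
    apply/seteqP; split=> // x Tx; have [_ [[k _ Fkx] _]] := Tx 0%N I.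
    have [_ [_]] := Tx k.+1 I; apply; rewrite /G -bigcup_mkord; exists k => //=.
  apply: nonincreasing_cvg_mu => //.
  - rewrite (le_lt_trans (_ : _ <= mu I11)%E)//; first by rewrite le_measure ?inE// => x [].
    by rewrite lebesgue_measure_itv/=; case: ifPn => // _; rewrite -EFinD ltry.
  - exact: bigcapT_measurable.
  - move=> m n mn; apply/subsetPset => x [xI [xU xG]]; split => //; split => // xm.
    apply: xG; move: xm; rewrite /G -!bigcup_mkord => -[k /= km Fk]; exists k => //=.
    exact: leq_trans mn.
have p0 : 0 <= phi (1 / l) by rewrite phi_ge0// divr_ge0// ltW.
have [n hn] : exists n, (mu (T n) <= ((phi (1 / l) + 1)^-1)%:E)%E.
  have e0 : 0 < (phi (1 / l) + 1)^-1 by rewrite invr_gt0 ltr_wpDl.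
  have /fine_cvgP[[M _ finM] cvT] := T0.
  have [K _ HK] := cvgr_lt 0 cvT _ e0.
  exists (maxn M K); have := HK _ (leq_maxr M K) => /ltW /=; rewrite -lee_fin fineK//.
  exact: finM (leq_maxl M K).
exists (\1_(I11 `&` G n)); split.
- rewrite (_ : \1_(I11 `&` G n) = fun x => \sum_(k < n) \1_(I11 `&` F k) x); last first.
    apply/funext => x; elim: (n) => [|m IH].
      by rewrite /G !big_ord0 setI0 indic0.
    rewrite big_ord_recr/= -IH /G big_ord_recr/= -/(G m) !indicE !in_setI in_setU.
    case: (x \in I11); rewrite ?addr0//=.
    have [xG|xG] := boolP (x \in G m); rewrite ?add0r//=.
    rewrite memNset ?addr0// => xF; move: xG; rewrite inE /G -bigcup_mkord => -[k /= km Fk].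
    have : (F k `&` F m) x by split.
    by move/trivIsetP : tF => /(_ k m I I) ->//; rewrite neq_ltn km.
  exact: ae_conv_sum.
- by move=> x xI; rewrite indicE memNset// => -[].
- have E x : (phi (`|\1_(I11 `&` \bigcup_k F k) x - \1_(I11 `&` G n) x| / l))%:E =
      ((phi (1 / l))%:E * (\1_(T n) x)%:E)%E.
    rewrite -EFinM; congr EFin; rewrite !indicE /T in_setI in_setI in_setI in_setD.
    case: (x \in I11) => /=; last by rewrite subrr normr0 mul0r /phi mul0r mulr0.
    have [xG|xG] := boolP (x \in G n).
      have xU : x \in \bigcup_k F k by rewrite inE; apply: (GF n); exact: set_mem xG.
      by rewrite xU /= subrr normr0 mul0r /phi mul0r mulr0.
    case: (x \in _) => /=; first by rewrite subr0 normr1 mulr1.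
    by rewrite subrr normr0 mul0r /phi mul0r mulr0.
  under eq_integral do rewrite E.
  rewrite ge0_integralZl//; last first.
    by apply: measurable_funTS; apply/measurable_EFinP; exact: measurable_indic.
  rewrite integral_indic// (_ : T n `&` I11 = T n); last by apply/seteqP; split=> [x []|x [? ?]].
  apply: (@le_trans _ _ ((phi (1 / l))%:E * ((phi (1 / l) + 1)^-1)%:E)%E).
    by rewrite lee_wpmul2l ?lee_fin.
  by rewrite -EFinM lee_fin ler_pdivrMr ?ltr_wpDl// [leRHS]mul1r lerDl.
Qed.

(** Almost everywhere convergence passes to complements and disjoint unions but not visibly to
    intersections. Hence Dynkin's theorem, applied to the rays, which are stable under
    intersection. *)
Lemma ae_conv_indic (A : set (measurableTypeR R)) : measurable A ->
  ae_conv (\1_(I11 `&` A)).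
Proof.
suff H : forall S, <<s @RGenOInfty.G R>> S -> ae_conv (\1_(I11 `&` S)).
  move=> mA; apply: H; have := RGenOInfty.measurableE R.
  by rewrite /measurable/= => <-.
apply: (@dynkin_induction _ (measurableTypeR R) (@RGenOInfty.G R) (fun A => ae_conv (\1_(I11 `&` A)))).
- exact: RGenOInfty.measurableE.
- move=> _ _ [x ->] [y ->]; exists (Num.max x y).
  by apply/seteqP; split=> z /=; rewrite !in_itv/= !andbT gt_max => /andP.
- rewrite (_ : I11 `&` setT = I11 `&` `](-1), +oo[); first exact: ae_conv_ray.
  rewrite setIT; apply/seteqP; split=> x; last by case.
  by move=> xI; split => //; move: xI; rewrite /I11/= !in_itv/= => /andP[->].
- by move=> _ [x ->]; exact: ae_conv_ray.
- move=> S mS cS; rewrite (_ : \1_(I11 `&` ~` S) = fun x => \1_(I11 `&` setT) x - \1_(I11 `&` S) x).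
    apply: ae_convB => //; rewrite setIT (_ : I11 = I11 `&` `](-1), +oo[); first exact: ae_conv_ray.
    apply/seteqP; split=> x; last by case.
    by move=> xI; split => //; move: xI; rewrite /I11/= !in_itv/= => /andP[->].
  apply/funext => x; rewrite !indicE !in_setI in_setT in_setC andbT.
  by case: (x \in I11); case: (x \in S); rewrite /= ?subr0 ?subrr.
- exact: ae_conv_bigcup.
Qed.
End borel_sets.

(** * Convergence for functions of finite modular *)

Section modular_convergence.
Context {R : realType}.
Local Notation mu := (@lebesgue_measure R).
Local Notation integr f := (mu.-integrable [set: measurableTypeR R] (EFin \o f)).
Implicit Types (f g : R -> R) (s l : R).
Let I11 : set (measurableTypeR R) := `]-1, 1[%classic.
Let mI : measurable I11. Proof. exact: measurable_itv. Qed.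

Lemma phi_le s s' : 0 <= s -> s <= s' -> phi s <= phi s'.
Proof.
move=> s0 ss'; rewrite /phi ler_pM// ?ln_ge0 ?lerDl//.
by rewrite ler_ln ?posrE ?lerD2l// ltr_wpDr// (le_trans s0).
Qed.

Lemma phi_le_sqr s : 0 <= s -> phi s <= s * s.
Proof. by move=> s0; rewrite ler_wpM2l// le_ln1Dx// (lt_le_trans _ s0)// ltrN10. Qed.

Lemma phiM_le (k s : R) : 0 <= k -> 0 <= s -> phi (k * s) <= k * ln (1 + k) * s + k * phi s.
Proof.
move=> k0 s0; rewrite /phi.
have h : ln (1 + k * s) <= ln (1 + k) + ln (1 + s).
  rewrite -lnM ?posrE ?ltr_wpDr// ler_ln ?posrE.
  - nra.
  - by rewrite ltr_wpDr// mulr_ge0.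
  - by rewrite mulr_gt0 ?ltr_wpDr.
have := ler_wpM2l (mulr_ge0 k0 s0) h; lra.
Qed.

Lemma measurable_phi f : measurable_fun setT f ->
  measurable_fun setT (fun x : measurableTypeR R => phi (f x)).
Proof.
move=> mf; apply: measurable_funM => //; apply: measurableT_comp => //.
exact: measurable_funD.
Qed.

Lemma ae_conv_simple (h : {nnsfun measurableTypeR R >-> R}) :
  (forall x, ~ I11 x -> h x = 0) -> ae_conv h.
Proof.
move=> h0.
have -> : (h : R -> R) = fun x => \sum_(y <- finmap.enum_fset (fset_set (range h))) (y * \1_(I11 `&` (h @^-1` [set y])) x).
  apply/funext => x; have [xI|xI] := pselect (I11 x).
    rewrite [LHS]fimfunE fsbig_finite//; apply: eq_bigr => y _; congr (_ * _).
    by rewrite !indicE in_setI (mem_set xI).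
  by rewrite h0// big1// => y _; rewrite indicE memNset ?mulr0// => -[].
apply: ae_conv_sum => y; apply: ae_convZ; apply: ae_conv_indic.
exact: measurable_funPTI.
Qed.

(** Simple functions increasing to [f] approximate it in modular by dominated convergence with
    majorant [phi (f x / l)]; this is where finiteness is wanted at every scale. *)
Lemma ae_conv_nonneg f : integr f -> (forall x, 0 <= f x) -> (forall x, ~ I11 x -> f x = 0) ->
  (forall l, (0 < l)%R -> \int[mu]_(x in I11) (phi (f x / l))%:E < +oo)%E ->
  ae_conv f.
Proof.
move=> If f0 fI fl; apply: ae_conv_modular => // l l0.
have mf := integr_measurable If.
have mfE : measurable_fun [set: measurableTypeR R] (EFin \o f) by exact/measurable_EFinP.
pose g : nat -> {nnsfun measurableTypeR R >-> R} :=
  @nnsfun_approx _ (measurableTypeR R) R setT measurableT _ mfE.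
have g_le n x : g n x <= f x.
  rewrite -lee_fin /g nnsfun_approxE; apply: le_approx => // y _.
  by rewrite lee_fin.
have gz n x : ~ I11 x -> g n x = 0.
  by move=> xI; apply/eqP; rewrite eq_le -{1}(fI x xI) g_le fun_ge0.
have cg x : g n x @[n --> \oo] --> f x.
  have f0E y : setT y -> (0 <= (EFin \o f) y)%E by rewrite lee_fin.
  by have /fine_cvg := cvg_nnsfun_approx measurableT mfE f0E (I : setT x).
have mF n : measurable_fun I11 (fun x => (phi (`|f x - g n x| / l))%:E).
  apply/measurable_funTS/measurable_EFinP; apply: measurable_phi.
  apply: measurable_funM => //; apply: measurableT_comp => //.
  exact: (measurable_funB mf (measurable_funPT (g n))).
have abs_le n x : 0 <= `|f x - g n x| / l <= f x / l.
  rewrite divr_ge0 ?(ltW l0)//= ler_pM2r ?invr_gt0// ger0_norm ?subr_ge0//.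
  by rewrite gerBl fun_ge0.
have [] := @dominated_convergence _ _ _ mu I11 mI (fun n x => (phi (`|f x - g n x| / l))%:E)
  (cst 0%E) (fun x => (phi (f x / l))%:E) mF (measurable_cst _).
- apply: aeW => x _; apply: cvg_EFin; first exact: nearW.
  have c1 : `|f x - g n x| / l @[n --> \oo] --> 0.
    rewrite -[X in _ --> X](mul0r l^-1); apply: cvgMl.
    rewrite -(normr0 R) -(subrr (f x)); apply: cvg_norm; apply: cvgB => //; exact: cvg_cst.
  apply: (@squeeze_cvgr _ _ _ _ (cst 0) (fun n => (`|f x - g n x| / l) * (`|f x - g n x| / l))).
  - apply: nearW => n /=; have /andP[h0 _] := abs_le n x.
    by rewrite phi_ge0// phi_le_sqr.
  - exact: cvg_cst.
  - by rewrite -[X in _ --> X](mul0r (0 : R)); exact: cvgM.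
- apply/integrableP; split.
    apply/measurable_funTS/measurable_EFinP; apply: measurable_phi.
    exact: measurable_funM.
  under eq_integral => x _ do rewrite /= ger0_norm ?phi_ge0 ?divr_ge0 ?(ltW l0)//.
  exact: fl.
- apply: aeW => x n _ /=; have /andP[h0 h1] := abs_le n x.
  by rewrite lee_fin ger0_norm ?phi_ge0// phi_le.
move=> _ _; rewrite integral0 => /fine_cvgP[[M _ finM] cvT].
have [K _ HK] := cvgr_lt 0 cvT 1 ltr01.
exists (g (maxn M K)); split.
- apply: (@ae_conv_simple (g (maxn M K))) => x; exact: gz.
- exact: gz.
- have /= := HK _ (leq_maxr M K); rewrite -lte_fin fineK; first exact: ltW.
  exact: finM (leq_maxl M K).
Qed.

(** [ln (1 + k s) <= ln (1 + k) + ln (1 + s)], so a change of scale costs only a multiple of the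
    [L^1] norm. *)
Lemma modular_lty f l l' : integr f -> 0 < l -> 0 < l' ->
  (\int[mu]_(x in I11) (phi (`|f x| / l))%:E < +oo)%E ->
  (\int[mu]_(x in I11) (phi (`|f x| / l'))%:E < +oo)%E.
Proof.
move=> If l0 l'0 fl; have mf := integr_measurable If.
pose k := l / l'; have k0 : 0 <= k by rewrite divr_ge0 ?ltW.
pose c := k * ln (1 + k) / l.
have c0 : 0 <= c by rewrite !mulr_ge0 ?invr_ge0 ?ln_ge0 ?lerDl// ltW.
have mp a : measurable_fun I11 (fun x => (phi (`|f x| / a))%:E).
  apply/measurable_funTS/measurable_EFinP; apply: measurable_phi.
  by apply: measurable_funM => //; exact: measurableT_comp.
have p0 a x : 0 < a -> 0 <= phi (`|f x| / a) by move=> a0; rewrite phi_ge0// divr_ge0// ltW.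
have mn : measurable_fun I11 (fun x => `|f x|%:E).
  by apply/measurable_funTS/measurable_EFinP; exact: measurableT_comp.
apply: (@le_lt_trans _ _ (\int[mu]_(x in I11) (c%:E * `|f x|%:E + k%:E * (phi (`|f x| / l))%:E))%E).
  apply: ge0_le_integral => //.
  - by move=> x _; rewrite lee_fin p0.
  - by apply: emeasurable_funD; apply: emeasurable_funM.
  - move=> x _; rewrite -!EFinM -EFinD lee_fin.
    rewrite (_ : `|f x| / l' = k * (`|f x| / l)); last by rewrite /k; field; rewrite !gt_eqF.
    rewrite (le_trans (phiM_le k0 _)) ?divr_ge0 ?(ltW l0)//.
    by rewrite lerD2r /c -!mulrA [l^-1 * _]mulrC.
rewrite ge0_integralD//; last 4 first.
- by move=> x _; rewrite mule_ge0// lee_fin.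
- exact: emeasurable_funM.
- by move=> x _; rewrite mule_ge0// lee_fin// p0.
- exact: emeasurable_funM.
rewrite !ge0_integralZl//; last first.
- by move=> x _; rewrite lee_fin p0.
rewrite lte_add_pinfty// lte_mul_pinfty//.
have := integrableS measurableT mI (@subsetT _ _) If => /integrableP[_].
by under eq_integral do rewrite /=.
Qed.

Lemma ae_conv_LlogL f l : integr f -> (forall x, ~ I11 x -> f x = 0) -> 0 < l ->
  (\int[mu]_(x in I11) (phi (`|f x| / l))%:E < +oo)%E ->
  ae_conv f.
Proof.
move=> If fI l0 fl; have mf := integr_measurable If.
have H g : measurable_fun setT g -> (forall x, 0 <= g x <= `|f x|) -> ae_conv g.
  move=> mg gf.
  have Ig : integr g.
    apply: (le_integrable_real mg (integr_norm If)) => x.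
    by have /andP[g0 ?] := gf x; rewrite ger0_norm.
  apply: ae_conv_nonneg => //.
  - by move=> x; have /andP[] := gf x.
  - move=> x /fI fx; have := gf x; rewrite fx normr0 => h.
    by apply/eqP; rewrite eq_le andbC.
  - move=> l' l'0; apply: le_lt_trans (modular_lty If l0 l'0 fl).
    apply: ge0_le_integral => //.
    + move=> x _; have /andP[g0 _] := gf x.
      by rewrite lee_fin phi_ge0// divr_ge0// ltW.
    + apply/measurable_funTS/measurable_EFinP; apply: measurable_phi.
      exact: measurable_funM.
    + apply/measurable_funTS/measurable_EFinP; apply: measurable_phi.
      by apply: measurable_funM => //; exact: measurableT_comp.
    + move=> x _; have /andP[g0 gx] := gf x.
      by rewrite lee_fin phi_le ?divr_ge0 ?(ltW l'0)// ler_pM2r ?invr_gt0.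
have -> : f = fun x => Num.max (f x) 0 - Num.max (- f x) 0.
  apply/funext => x; rewrite /Num.max; case: ltP => fx; case: ltP => fx'; lra.
apply: ae_convB; apply: H.
- exact: measurable_maxr.
- move=> x; rewrite le_max lexx orbT/= ge_max ler_norm/=; exact: normr_ge0.
- by apply: measurable_maxr => //; exact: measurableT_comp.
- by move=> x; rewrite le_max lexx orbT/= ge_max normr_ge0 andbT -normrN ler_norm.
Qed.
End modular_convergence.

(** * The limit and its L^1 norm *)

Section limit.
Context {R : realType}.
Local Notation mu := (@lebesgue_measure R).
Local Notation integr f := (mu.-integrable [set: measurableTypeR R] (EFin \o f)).
Implicit Types (e u t : R) (f g : R -> R).
Let I11 : set (measurableTypeR R) := `]-1, 1[%classic.

Lemma HTcauchy_cvg f t : HTcauchy f t -> cvg (HT e f t @[e --> 0^'+]).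
Proof.
move=> ft; apply/cauchy_cvgP; apply: cauchy_exP => r r0.
have [e1 e10 H] := ft (r / 2) (divr_gt0 r0 (ltr0Sn _ 1)).
exists (HT (e1 / 2) f t); rewrite /fmap /=.
near=> e; rewrite /ball/=; apply: (@le_lt_trans _ _ (r / 2)); last by lra.
apply: H; [lra|lra|near: e; exact: nbhs_right_gt|near: e; exact: nbhs_right_lt].
Unshelve. all: by end_near.
Qed.

Lemma limn_einf_le (u : (\bar R)^nat) (K : \bar R) :
  (forall n, (u n <= K)%E) -> (limn_einf u <= K)%E.
Proof.
move=> uK; rewrite limn_einf_lim; apply: lime_le; first exact: is_cvg_einfs.
apply: nearW => n; apply: le_trans (uK n); apply: ereal_inf_lbound.
by exists n => //=.
Qed.

(** Tonelli takes the place of [Fubini_kernel]: with [f] of arbitrary support there is no integrable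
    majorant of [pk e u] uniform in [u]. *)
Lemma integral_pk_conv f e : 0 < e -> integr f ->
  (\int[mu]_t (PT e (fun u => `|f u|) t)%:E = (pi * \int[mu]_u `|f u|)%:E)%E.
Proof.
move=> e0 If; have mf := integr_measurable If.
transitivity (\int[mu]_t \int[mu]_u (`|f u| * pk e u t)%:E)%E.
  apply: eq_integral => t _; rewrite /PT /Rintegral fineK//.
  by apply: integrable_fin_num => //; exact/(integr_fpk _ e0)/integr_norm.
rewrite (fubini_tonelli (fun z : measurableTypeR R * measurableTypeR R =>
  (`|f z.2| * pk e z.2 z.1)%:E)); last 2 first.
- apply/measurable_EFinP; apply: measurable_funM.
    by apply: measurableT_comp => //; exact: measurableT_comp.
  by under eq_fun do rewrite pkC; exact: measurable_pk.
- by move=> z; rewrite lee_fin mulr_ge0// pk_ge0.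
transitivity (\int[mu]_u ((pi)%:E * (`|f u|)%:E))%E; last first.
  rewrite ge0_integralZl//; last 2 first.
  - by apply/measurable_EFinP; exact: measurableT_comp.
  - by rewrite lee_fin pi_ge0.
  rewrite EFinM /Rintegral fineK//.
  by apply: integrable_fin_num => //; exact: integr_norm.
apply: eq_integral => u _ /=; rewrite -EFinM mulrC -(integral_pk u e0).
rewrite -RintZ; last exact: integrable_pk.
rewrite /Rintegral fineK//.
by apply: integrable_fin_num => //; apply: integrZ; exact: integrable_pk.
Qed.

Section bound.
Context (f : R -> R) (l A : R).
Hypothesis If : integr f.
Hypothesis l0 : 0 < l.
Hypothesis f0 : forall x, ~ I11 x -> f x = 0.
Hypothesis fA : (\int[mu]_(x in I11) (phi (`|f x| / l))%:E <= A%:E)%E.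
Let N := l / delta * (A + 64).
Let mI : measurable I11. Proof. exact: measurable_itv. Qed.

Lemma HT_L1_le e : 0 < e -> (\int[mu]_(t in I11) `|HT e f t|%:E <= ((1 + pi) * N)%:E)%E.
Proof.
move=> e0; have N0 : 0 <= N.
  by rewrite (le_trans _ (modular_L1_le If l0 f0 fA))//; exact: Rintegral_ge0.
have mP := measurable_PT e0 (integr_norm If).
have P0 t : 0 <= PT e (fun u => `|f u|) t.
  by apply: Rintegral_ge0 => u _; rewrite mulr_ge0// pk_ge0.
have mQ := measurable_QT e0 If; have mH := measurable_HT e0 If.
apply: (@le_trans _ _ (\int[mu]_(t in I11) (`|QT e f t|%:E + (PT e (fun u => `|f u|) t)%:E))%E).
  apply: ge0_le_integral => //.
  - by apply/measurable_funTS/measurable_EFinP; exact: measurableT_comp.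
  - apply/measurable_funTS/measurable_EFinP; apply: measurable_funD => //.
    exact: measurableT_comp.
  - move=> t _; rewrite -EFinD lee_fin -lerBlDl.
    apply: le_trans (HT_QT_le t e0 If).
    exact: lerB_dist.
rewrite ge0_integralD//; last 3 first.
- by apply/measurable_funTS/measurable_EFinP; exact: measurableT_comp.
- by move=> t _; rewrite lee_fin.
- exact/measurable_funTS/measurable_EFinP.
rewrite mulrDl mul1r EFinD leeD//.
  apply: le_trans (QT_L1_le If e0 l0 f0 fA).
  apply: ge0_subset_integral => //.
    apply: measurable_funTS; apply/measurable_EFinP.
    by apply: measurableT_comp => //; exact: measurable_QT.
  by move=> t; rewrite /I11/= !in_itv/= => /andP[*]; lra.
apply: (@le_trans _ _ (\int[mu]_t (PT e (fun u => `|f u|) t)%:E)%E).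
  apply: ge0_subset_integral => //; first exact/measurable_EFinP.
  by move=> t _; rewrite lee_fin.
by rewrite integral_pk_conv// lee_fin ler_wpM2l ?pi_ge0// modular_L1_le.
Qed.

Lemma HT_limit : exists H : R -> R, [/\ measurable_fun [set: measurableTypeR R] H,
  (\int[mu]_(t in I11) `|H t|%:E <= ((1 + pi) * N)%:E)%E &
  mu.-negligible [set t | I11 t /\ ~ (HT e f t @[e --> 0^'+] --> H t)]].
Proof.
have [_ [B [mB B0 HB]]] : ae_conv f.
  by apply: (ae_conv_LlogL If f0 l0); rewrite (le_lt_trans fA)// ltry.
pose S := I11 `\` B; have mS : measurable S by exact: measurableD.
(* Cutting off to [S] makes [v n] converge to [H] at every point, hence [H] is Borel measurable.
   Fatou's lemma is used along [e = 1/(n+1)]. *)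
pose H : R -> R := (fun t => lim (HT e f t @[e --> 0^'+])) \_ S.
pose v n : R -> R := (fun t => HT n.+1%:R^-1 f t) \_ S.
have d0 k : 0 < (k.+1%:R : R)^-1 by rewrite invr_gt0.
have SH t : S t -> HT e f t @[e --> 0^'+] --> H t.
  move=> St; rewrite /H patchE mem_set//; apply: HTcauchy_cvg.
  by case: St => It Bt; apply: contra_notP Bt => nt; apply: HB.
have vH t : v n t @[n --> \oo] --> H t.
  have [St|St] := pselect (S t); last first.
    rewrite (_ : v ^~ t = fun=> 0); first by rewrite /H patchE memNset//; exact: cvg_cst.
    by apply/funext => n; rewrite /v patchE memNset.
  rewrite (_ : v ^~ t = fun n => HT n.+1%:R^-1 f t); last first.
    by apply/funext => n; rewrite /v patchE mem_set.
  have /cvg_at_rightP := SH t St.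
  by apply; split => [k|]; [rewrite invr_gt0|exact: cvg_harmonic].
have mv n : measurable_fun setT (v n).
  apply/(measurable_restrictT _ _).1 => //; apply: measurable_funTS.
  exact: measurable_HT.
exists H; split.
- by apply: (@measurable_fun_cvg _ _ _ _ v) => [|t _]; [exact: mv|exact: vH].
- rewrite (_ : (\int[mu]_(t in I11) `|H t|%:E)%E =
      (\int[mu]_(t in I11) limn_einf (fun n => `|v n t|%:E))%E); last first.
    apply: eq_integral => t _; have vt : (`|v n t|%:E @[n --> \oo] --> `|H t|%:E)%E.
      by apply: cvg_EFin; [exact: nearW|apply: cvg_norm; exact: vH].
    by rewrite is_cvg_limn_einfE; [apply/esym/cvg_lim|apply/cvg_ex; eexists; exact: vt].
  apply: le_trans (fatou _ mI _ _) _ => //.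
  - move=> n; apply/measurable_funTS/measurable_EFinP; apply: measurableT_comp => //; exact: mv.
  apply: limn_einf_le => n; apply: le_trans (HT_L1_le (d0 n)).
  apply: ge0_le_integral => //.
  - by apply/measurable_funTS/measurable_EFinP; apply: measurableT_comp => //; exact: mv.
  - apply/measurable_funTS/measurable_EFinP; apply: measurableT_comp => //.
    exact: measurable_HT.
  - by move=> t _; rewrite lee_fin /v patchE; case: ifPn => //; rewrite normr0.
exists B; split => // t [It nH]; apply: contrapT => Bt; apply: nH; exact: SH.
Qed.

End bound.
End limit.

Section integral_mono.
Context d (T : measurableType d) (R : realType) (m : {measure set T -> \bar R}).

(* No measurability is needed: both sides are suprema over simple functions. *)
Lemma ge0_le_integral_nomeas (D : set T) (f g : T -> \bar R) :
  (forall x, D x -> (0 <= f x)%E) -> (forall x, D x -> (f x <= g x)%E) ->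
  (\int[m]_(x in D) f x <= \int[m]_(x in D) g x)%E.
Proof.
move=> f0 fg; rewrite [leLHS]integral_mkcond [leRHS]integral_mkcond.
have f0' x : (0 <= (f \_ D) x)%E.
  by rewrite patchE; case: ifPn => //; rewrite inE; exact: f0.
have fg' x : ((f \_ D) x <= (g \_ D) x)%E.
  by rewrite !patchE; case: ifPn => //; rewrite inE; exact: fg.
rewrite !ge0_integralTE//; last by move=> x; exact: le_trans (fg' x).
apply: le_ereal_sup => _ [h hf <-]; exists h => // x.
exact: le_trans (fg' x).
Qed.

End integral_mono.

(** * Decreasing rearrangement and modular *)

Section phi_increments.
Context {R : realType}.

Lemma phi_succB_ge0 k : 0 <= phi k.+2%:R - phi k.+1%:R :> R.
Proof. by rewrite subr_ge0 phi_le// ler_nat. Qed.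

(** The right side is twice the weight [ln (2 e / t)] of the norm at [t = 1/(k+1)]. With [x = k + 1]
    it follows from [x (ln (2 + x) - ln (1 + x)) <= 1] and [ln (2 + x) <= 2 ln (2 x)]. *)
Lemma phi_succB_le k :
  phi k.+2%:R - phi k.+1%:R <= 2 * ln (2 * expR 1 * k.+1%:R) :> R.
Proof.
rewrite /phi; set x : R := k.+1%:R; have x1 : 1 <= x by rewrite ler1n.
have x0 : 0 < x by lra.
have -> : k.+2%:R = x + 1 :> R by rewrite -natr1.
have e0 := expR_gt0 (1 : R).
have -> : ln (2 * expR 1 * x) = ln 2 + 1 + ln x.
  by rewrite lnM ?posrE// ?mulr_gt0// lnM ?posrE// expRK.
have h1 : ln (1 + (x + 1)) - ln (1 + x) <= (1 + x)^-1.
  rewrite -ln_div; [|rewrite posrE; lra|rewrite posrE; lra].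
  have -> : (1 + (x + 1)) / (1 + x) = 1 + (1 + x)^-1 by field; lra.
  by apply: le_ln1Dx; rewrite (lt_le_trans _ (_ : 0 <= _))// invr_ge0; lra.
have h2 : ln (1 + (x + 1)) <= 2 * ln 2 + 2 * ln x.
  have -> : 2 * ln 2 + 2 * ln x = ln ((2 * x) * (2 * x)).
    by rewrite lnM ?posrE ?mulr_gt0// lnM ?posrE//; lra.
  rewrite ler_ln ?posrE ?mulr_gt0//; try lra.
  by nra.
have : x * (ln (1 + (x + 1)) - ln (1 + x)) <= 1.
  rewrite (le_trans (ler_wpM2l (ltW x0) h1))//.
  by rewrite ler_pdivrMr; lra.
by lra.
Qed.

End phi_increments.

Section rearrangement_modular.
Context {R : realType}.
Local Notation I11 := (@I11 R).
Local Notation leb := (@leb R).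

Lemma lebE A : leb A = @lebesgue_measure R A. Proof. by []. Qed.

Lemma measurable_leb (A : set R) :
  measurable (A : set (measurableTypeR R)) -> measurable (A : set (LebesgueR R)).
Proof. exact: sub_caratheodory. Qed.

Lemma measurable_I11 : measurable I11.
Proof. apply: measurable_leb; exact: measurable_itv. Qed.

Lemma leb_I11 : leb I11 = 2%:E.
Proof.
rewrite lebE /I11 lebesgue_measure_itv/= lte_fin ifT; last lra.
by congr EFin; lra.
Qed.

Context (f : LebesgueR R -> R[i]) (lam : R).
Hypothesis mf : measurable_fun I11 (fun x => normc (f x)).
Hypothesis lam0 : 0 < lam.
Let D k := [set x | I11 x /\ k.+1%:R * lam < normc (f x)].
Let m k := fine (leb (D k)).

Let mD k : measurable (D k).
Proof.
have := mf measurable_I11 (measurable_itv `]k.+1%:R * lam, +oo[).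
congr measurable; apply/seteqP; split => x /=; rewrite in_itv/= andbT; first by [].
by [].
Qed.

Let lebD k : leb (D k) = (m k)%:E.
Proof.
rewrite /m fineK// ge0_fin_numE// (@le_lt_trans _ _ (leb I11))// ?leb_I11 ?ltry//.
by rewrite -leb_I11 le_measure ?inE//; [exact: measurable_I11|move=> x []].
Qed.

Let m_ge0 k : 0 <= m k. Proof. exact: fine_ge0. Qed.

Let m_le2 k : m k <= 2.
Proof.
rewrite -lee_fin -lebD -leb_I11 le_measure ?inE//; first exact: measurable_I11.
by move=> x [].
Qed.

Let m_mono i j : (i <= j)%N -> m j <= m i.
Proof.
move=> ij; rewrite -lee_fin -!lebD le_measure ?inE// => x [Ix h]; split => //.
by rewrite (le_lt_trans _ h)// ler_wpM2r ?(ltW lam0)// ler_nat.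
Qed.

Let cnt N t : R := \sum_(k < N) (t < m k)%R%:R.

(** An admissible [l] is at least [(k + 1) lam] whenever [t < m k]; the largest such [k] below [N]
    bounds the count. *)
Let cnt_le N t l : 0 <= l ->
  (leb [set x | I11 x /\ (l < normc (f x))%R] <= t%:E)%E -> lam * cnt N t <= l.
Proof.
move=> l0 lt; elim: N => [|N IH]; first by rewrite /cnt big_ord0 mulr0.
rewrite /cnt big_ord_recr/=; case: (ltP t (m N)) => tm; last by rewrite addr0.
suff h : N.+1%:R * lam <= l.
  rewrite (le_trans _ h)// mulrC ler_wpM2r ?(ltW lam0)// -natr1 lerD2r.
  rewrite -[leRHS]mul1r mulr_natr -[in leRHS](card_ord N) -sumr_const.
  by apply: ler_sum => i _; case: (_ < _).
rewrite leNgt; apply/negP => lN.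
suff : m N <= t by rewrite leNgt tm.
rewrite -lee_fin -lebD (le_trans _ lt)//; apply: le_outer_measure => x [Ix h].
by split => //; exact: lt_trans h.
Qed.

(** The logarithmic weight at the right end of []0, m k[], a lower bound for it on this interval. *)
Let c k : R := ln (2 * expR 1 / m k).

Let m_c_ge0 k : 0 < m k -> 1 <= c k.
Proof.
move=> m0; rewrite /c -[leLHS]expRK ler_ln ?posrE ?expR_gt0 ?divr_gt0 ?mulr_gt0 ?expR_gt0//.
by rewrite ler_pdivlMr// mulrC ler_wpM2r ?expR_ge0.
Qed.

Hypothesis flam : (LlogLnorm f <= lam%:E)%E.

(* By [cnt_le] the rearrangement dominates a step function with jumps at the [m k],
   which is integrated against the logarithmic weight. *)
Let sum_mc_le N : \sum_(k < N) m k * c k <= 1.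
Proof.
rewrite -(ler_pM2l lam0) mulr1 -lee_fin (le_trans _ flam)// /LlogLnorm.
pose E k : set (LebesgueR R) := `]0, m k[%classic.
have mE k : measurable (E k) by apply: measurable_leb; exact: measurable_itv.
have lE k : leb (E k) = (m k)%:E.
  rewrite lebE /E lebesgue_measure_itv/= lte_fin.
  have [m0|] := ltP 0 (m k); first by rewrite sube0.
  by move=> h; congr EFin; apply/eqP; rewrite eq_le h m_ge0.
pose J : set (LebesgueR R) := `]0, 2[%classic.
have mJ : measurable J by apply: measurable_leb; exact: measurable_itv.
have mc0 k t : E k t -> 0 <= c k.
  rewrite /E/= in_itv/= => /andP[t0 tm]; rewrite (le_trans _ (m_c_ge0 _))//.
  exact: lt_trans tm.
have K0 k : 0 <= c k * m k.
  have := m_ge0 k; rewrite le_eqVlt => /orP[/eqP <-|mk]; first by rewrite mulr0.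
  by rewrite mulr_ge0// (le_trans _ (m_c_ge0 mk)).
have -> : (lam * \sum_(k < N) m k * c k)%:E =
    (\int[leb]_(t in J) \sum_(k <- index_enum 'I_N) ((lam * c k) * \1_(E k) t)%:E)%E.
  have mt (k : 'I_N) : measurable_fun J (fun t => ((lam * c k) * \1_(E k) t)%:E).
    by apply/measurable_EFinP; apply: measurable_funM => //; exact: measurable_indic.
  have t_ge0 (k : 'I_N) t : J t -> (0 <= ((lam * c k) * \1_(E k) t)%:E)%E.
    move=> _; rewrite lee_fin indicE; have [tE|] := boolP (t \in E k).
      by rewrite mulr1 mulr_ge0// ?(ltW lam0)// (mc0 _ t)// -inE.
    by rewrite mulr0.
  rewrite (ge0_integral_sum leb mJ mt t_ge0).
  rewrite mulr_sumr -sumEFin; apply: eq_bigr => k _.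
  (* Here [c k] is a default value of a division by zero; both sides vanish because [E k] is
     empty. *)
  have [m0|m0] := eqVneq (m k) 0.
    rewrite m0 mul0r mulr0 (eq_integral (fun=> 0%E)) ?integral0// => t _.
    by rewrite indicE memNset ?mulr0// /E m0/= in_itv/=; apply/negP; lra.
  have ck : 0 <= lam * c k.
    rewrite mulr_ge0 ?(ltW lam0)// (le_trans _ (m_c_ge0 _))// lt_neqAle eq_sym m0.
    exact: m_ge0.
  under eq_integral do rewrite EFinM.
  have m1 : measurable_fun J (fun x => (\1_(E k) x : R)%:E).
    by apply/measurable_EFinP; exact: measurable_indic.
  have i0 (x : LebesgueR R) : J x -> (0 <= (\1_(E k) x : R)%:E)%E by rewrite lee_fin.
  have p0 : (0 <= (lam * c k)%:E)%E by rewrite lee_fin.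
  rewrite (ge0_integralZl leb mJ m1 i0 p0).
  rewrite (integral_indic leb mJ (mE k)) setIidl ?lE; first by rewrite -EFinM; congr EFin; ring.
  move=> t; rewrite /E /J/= !in_itv/= => /andP[-> /lt_le_trans]; apply.
  exact: m_le2.
apply: ge0_le_integral_nomeas => t.
  move=> _; rewrite sumEFin lee_fin sumr_ge0// => k _; rewrite indicE.
  have [tE|] := boolP (t \in E k); last by rewrite mulr0.
  by rewrite mulr1 mulr_ge0// ?(ltW lam0)// (mc0 _ t)// -inE.
rewrite /J/= in_itv/= => /andP[t0 t2].
have w0 : 0 <= ln (2 * expR 1 / t).
  apply: ln_ge0; rewrite ler_pdivlMr// mul1r.
  have := @expR_ge1Dx R 1; lra.
apply: (@le_trans _ _ ((lam * cnt N t)%:E * (ln (2 * expR 1 / t))%:E)%E); last first.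
  apply: lee_wpmul2r; first by rewrite lee_fin.
  apply: le_ereal_inf_tmp => _ [l [l0 lt] <-]; rewrite lee_fin; exact: cnt_le.
rewrite sumEFin -EFinM lee_fin /cnt mulr_sumr mulr_suml; apply: ler_sum => k _.
rewrite -[leLHS]mulrA -[leRHS]mulrA ler_wpM2l ?(ltW lam0)//.
rewrite indicE; have [tE|] := boolP (t \in E k); last first.
  by rewrite mulr0 => _; rewrite mulr_ge0.
move: tE; rewrite inE /E/= in_itv/= => /andP[_ tm]; rewrite tm mulr1 mul1r.
have mk : 0 < m k by exact: lt_trans tm.
have e0 : 0 < 2 * expR (1 : R) by rewrite mulr_gt0 ?expR_gt0.
rewrite /c ler_ln ?posrE ?divr_gt0// ler_pM2l// lef_pV2 ?posrE//.
exact: ltW.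
Qed.

(** A Chebyshev argument: [m] decreases and [c] is at least 1 where [m] is positive, so the left
    side is at most a partial sum of [m i * c i]. It turns the weight [c k] into the explicit
    [ln (2 e (k + 1))]. *)
Let m_le k : k.+1%:R * m k <= 1.
Proof.
apply: le_trans (sum_mc_le k.+1).
rewrite mulr_natl -[in leLHS](card_ord k.+1) -sumr_const; apply: ler_sum => i _.
have := m_ge0 k; rewrite le_eqVlt => /orP[/eqP <-|mk].
  have := m_ge0 i; rewrite le_eqVlt => /orP[/eqP <-|mi]; first by rewrite mul0r.
  by rewrite mulr_ge0// (le_trans _ (m_c_ge0 mi)).
have mki : m k <= m i by apply: m_mono; rewrite -ltnS.
have mi : 0 < m i by exact: lt_le_trans mki.
by rewrite -[leLHS]mulr1 ler_pM// m_c_ge0.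
Qed.

Let sum_ln_le N : \sum_(k < N) ln (2 * expR 1 * k.+1%:R) * m k <= 1.
Proof.
apply: le_trans (sum_mc_le N); apply: ler_sum => k _; rewrite mulrC.
have := m_ge0 k; rewrite le_eqVlt => /orP[/eqP <-|mk]; first by rewrite !mul0r.
have e0 : 0 < 2 * expR (1 : R) by rewrite mulr_gt0 ?expR_gt0.
rewrite ler_pM2l// /c ler_ln ?posrE ?divr_gt0 ?mulr_gt0 ?expR_gt0// ler_pM2l//.
by rewrite -[leRHS]mul1r ler_pdivlMr.
Qed.

(** [phi] increases, so [s] is rounded up to the least positive integer above or equal to it and the
    increments telescope from 1. *)
Let phi_le_series (s : R) : 0 <= s ->
  ((phi s)%:E <= (phi 1)%:E + \sum_(0 <= k <oo)
     ((phi k.+2%:R - phi k.+1%:R) * (k.+1%:R < s)%R%:R)%:E)%E.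
Proof.
move=> s0; have [K0 [hK hmin]] : exists K : nat, s <= K.+1%:R /\ forall j : nat, (j < K)%N -> j.+1%:R < s.
  have ex : exists K : nat, s <= K.+1%:R.
    by exists (Num.trunc s); apply: ltW; exact: truncnS_gt.
  exists (ex_minn ex); case: ex_minnP => K sK Kmin; split => // j jK.
  by rewrite ltNge; apply/negP => /Kmin; rewrite leqNgt jK.
apply: (@le_trans _ _ ((phi 1)%:E + \sum_(0 <= k < K0)
     ((phi k.+2%:R - phi k.+1%:R) * (k.+1%:R < s)%R%:R)%:E)%E); last first.
  rewrite leeD2l//; apply: nneseries_lim_ge => k _ _.
  by rewrite lee_fin mulr_ge0// phi_succB_ge0.
rewrite sumEFin -EFinD lee_fin.
rewrite (@eq_big_nat _ _ _ _ _ _ (fun k => phi k.+2%:R - phi k.+1%:R)); last first.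
  by move=> k /andP[_ kK]; rewrite hmin// mulr1.
rewrite (telescope_sumr (fun k => phi (k.+1%:R : R)))// addrC subrK.
exact: phi_le.
Qed.

Lemma modular_le_LlogL : (\int[leb]_(x in I11) (phi (normc (f x) / lam))%:E <= 4%:E)%E.
Proof.
have mI := measurable_I11.
have ind k x : I11 x -> (k.+1%:R < normc (f x) / lam)%R%:R = \1_(D k) x :> R.
  move=> Ix; rewrite indicE ltr_pdivlMr//; congr (nat_of_bool _)%:R.
  by apply/idP/idP; [move=> ?; rewrite inE; split|rewrite inE => -[]].
have n0 x : 0 <= normc (f x) by case: (f x) => *; exact: sqrtr_ge0.
apply: (@le_trans _ _ (\int[leb]_(x in I11) ((phi 1)%:E + \sum_(0 <= k <oo)
     ((phi k.+2%:R - phi k.+1%:R) * \1_(D k) x)%:E))%E).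
  apply: ge0_le_integral_nomeas => x Ix.
    by rewrite lee_fin phi_ge0// divr_ge0// ltW.
  have := phi_le_series (divr_ge0 (n0 x) (ltW lam0)); rewrite (eq_eseriesr (g := fun k =>
     ((phi k.+2%:R - phi k.+1%:R) * \1_(D k) x)%:E))// => k _; by rewrite ind.
have mterm k : measurable_fun I11 (fun x => ((@phi R k.+2%:R - phi k.+1%:R) * \1_(D k) x)%:E).
  apply/measurable_EFinP; apply: measurable_funM => //; exact: measurable_indic.
have term0 k x : (0 <= ((@phi R k.+2%:R - phi k.+1%:R) * \1_(D k) x)%:E)%E.
  by rewrite lee_fin mulr_ge0// phi_succB_ge0.
have phi1_ge0 (x : LebesgueR R) : I11 x -> (0 <= (@phi R 1)%:E)%E.
  by move=> _; rewrite lee_fin phi_ge0.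
have sum_ge0 x : I11 x ->
    (0 <= \sum_(0 <= k <oo) ((@phi R k.+2%:R - phi k.+1%:R) * \1_(D k) x)%:E)%E.
  by move=> _; exact: nneseries_ge0.
have msum : measurable_fun I11 (fun x =>
    \sum_(0 <= k <oo) ((@phi R k.+2%:R - phi k.+1%:R) * \1_(D k) x)%:E)%E.
  exact: (@ge0_emeasurable_sum _ _ _ I11 (fun k x =>
    ((@phi R k.+2%:R - phi k.+1%:R) * \1_(D k) x)%:E) xpredT
    (fun k x _ _ => term0 k x) (fun k _ => mterm k)).
rewrite (ge0_integralD leb mI phi1_ge0 (measurable_cst _) sum_ge0 msum).
(* One 2 is the length of [I11] times [phi 1 <= 1]; the other is the factor in [phi_succB_le] times
   [sum_ln_le]. *)
have -> : 4%:E = (2%:E + 2%:E)%E :> \bar R by rewrite -EFinD; congr EFin; lra.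
apply: leeD.
  rewrite integral_cst// leb_I11 -EFinM lee_fin /phi mul1r.
  have := @le_ln1Dx R 1 ltac:(lra); lra.
rewrite integral_nneseries//.
apply: lime_le; first by apply: is_cvg_nneseries => k _ _; exact: integral_ge0.
apply: nearW => N; rewrite big_mkord.
apply: (@le_trans _ _ (\sum_(k < N) ((2 * ln (2 * expR 1 * k.+1%:R)) * m k)%:E)%E).
  apply: lee_sum => k _; under eq_integral do rewrite EFinM.
  have m1 : measurable_fun I11 (fun x => (\1_(D k) x : R)%:E).
    by apply/measurable_EFinP; exact: measurable_indic.
  have i0 (x : LebesgueR R) : I11 x -> (0 <= (\1_(D k) x : R)%:E)%E by rewrite lee_fin.
  have p0 : (0 <= (@phi R k.+2%:R - phi k.+1%:R)%:E)%E by rewrite lee_fin phi_succB_ge0.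
  rewrite (ge0_integralZl leb mI m1 i0 p0).
  rewrite (integral_indic leb mI (mD k)) setIidl ?lebD; last by move=> x [].
  by rewrite -EFinM lee_fin ler_wpM2r// phi_succB_le.
rewrite sumEFin lee_fin; under eq_bigr do rewrite -mulrA.
by rewrite -mulr_sumr -[leRHS]mulr1 ler_wpM2l.
Qed.

End rearrangement_modular.

(** * Lebesgue and Borel measurable functions *)

Section transfer.
Context {R : realType}.
Local Notation I11 := (@I11 R).
Local Notation leb := (@leb R).
Local Notation mu := (@lebesgue_measure R).
Local Notation integr f := (mu.-integrable [set: measurableTypeR R] (EFin \o f)).

Lemma cara_Borel (A : set (LebesgueR R)) : measurable A ->
  exists X N : set (measurableTypeR R), [/\ measurable X, mu.-negligible N & X `|` N = A].
Proof.
move=> mA; have : (completed_algebra_gen mu).-sigma.-measurable A.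
  by rewrite completed_caratheodory_measurable.
by rewrite g_sigma_completed_algebra_genE => -[X mX [N N0 XN]]; exists X, N.
Qed.

Lemma negligible_leb N : mu.-negligible N -> leb.-negligible N.
Proof.
by move=> [B [mB B0 NB]]; exists B; split => //; exact: measurable_leb.
Qed.

Lemma leb_negligible N : leb.-negligible N -> mu.-negligible N.
Proof.
move=> [B [mB B0 NB]]; apply: (@negligibleS _ _ _ mu B N NB).
have [X [N' [mX N'0 XN]]] := cara_Borel mB; rewrite -XN; apply: negligibleU => //.
exists X; split => //; apply/eqP; rewrite eq_le measure_ge0 andbT -[leRHS]B0.
by apply: le_outer_measure; rewrite -XN; left.
Qed.

Lemma measurable_leb_id : measurable_fun setT (idfun : LebesgueR R -> measurableTypeR R).
Proof. by move=> _ Y mY; rewrite setTI; exact: measurable_leb. Qed.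

Lemma measurable_fun_leb d' (T : sigmaRingType d') (D : set R) (h : R -> T) :
  measurable (D : set (measurableTypeR R)) ->
  measurable_fun (D : set (measurableTypeR R)) h ->
  measurable_fun (D : set (LebesgueR R)) h.
Proof. by move=> mD mh _ Y mY; apply: measurable_leb; exact: mh. Qed.

(** The identity from Lebesgue to Borel measurable sets pushes [leb] forward to [mu]. *)
Lemma ge0_integral_leb (D : set R) (h : R -> \bar R) :
  measurable (D : set (measurableTypeR R)) ->
  measurable_fun (D : set (measurableTypeR R)) h -> (forall x, D x -> (0 <= h x)%E) ->
  (\int[leb]_(x in D) h x = \int[mu]_(x in D) h x)%E.
Proof.
move=> mD mh h0.
have := @ge0_integral_pushforward _ _ _ _ R _ measurable_leb_id leb D h mD mh.
by move=> <-// x /[!inE]; exact: h0.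
Qed.

Lemma integral_leb (D : set R) (h : R -> \bar R) :
  measurable (D : set (measurableTypeR R)) ->
  measurable_fun (D : set (measurableTypeR R)) h ->
  (\int[leb]_(x in D) h x = \int[mu]_(x in D) h x)%E.
Proof.
move=> mD mh; rewrite integralE [RHS]integralE.
rewrite !ge0_integral_leb//; first exact: measurable_funeneg.
exact: measurable_funepos.
Qed.

Definition Borel_rep (g : LebesgueR R -> R) (G : R -> R) :=
  [/\ measurable_fun [set: measurableTypeR R] G, (forall x, ~ I11 x -> G x = 0) &
      mu.-negligible [set x | I11 x /\ g x <> G x]].

(** Each superlevel set at a rational is Borel up to a null set. Countably many such null sets lie
    in one Borel null set [M], and off [M] the superlevel sets at real [r] are unions over
    rationals. *)
Lemma Borel_rep_exists (g : LebesgueR R -> R) :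
  measurable_fun I11 g -> exists G, Borel_rep g G.
Proof.
move=> mg; pose S (q : rat) := [set x | I11 x /\ ratr q < g x].
have mS q : measurable (S q).
  have := mg measurable_I11 `]ratr q, +oo[%classic (measurable_itv _).
  by congr measurable; apply/seteqP; split => x /=; rewrite in_itv/= andbT.
have /choice[X /choice[N HN]] : forall q, exists X N : set (measurableTypeR R),
    [/\ measurable X, mu.-negligible N & X `|` N = S q].
  by move=> q; exact: cara_Borel.
have [M [mM M0 NM]] : mu.-negligible (\bigcup_n (oapp N set0 (unpickle n))).
  apply: negligible_bigcup => n; case: unpickle => [q|]/=; last exact: negligible_set0.
  by have [] := HN q.
have NMq q x : N q x -> M x.
  by move=> Nx; apply: NM; exists (pickle q); [exact: I|rewrite pickleK].
pose K : set (measurableTypeR R) := I11 `\` M.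
have mK : measurable K by apply: measurableD => //; exact: measurable_itv.
exists ((g : R -> R) \_ K); split.
- apply: (measurability _ (RGenOInfty.measurableE R)) => _ [_ [r ->] <-].
  (* The value off [K] is 0, so the complement of [K] belongs to the preimage exactly when
     [r < 0]. *)
  rewrite setTI (_ : _ @^-1` _ = (\bigcup_q (if r < ratr q then X q `\` M else set0)) `|`
      (if r < 0 then ~` K else set0)); last first.
    apply/seteqP; split => [x|x].
    - rewrite /= in_itv/= andbT patchE; case: ifPn => [|xK rx].
        rewrite inE => -[Ix Mx] rx; left.
        have [q] := rat_in_itvoo rx; rewrite in_itv/= => /andP[rq qx].
        exists q => //; rewrite rq; split => //.
        have [_ _ XN] := HN q; have : S q x by [].
        by rewrite -XN => -[//|/NMq].
      by right; rewrite rx; rewrite notin_setE in xK.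
    - rewrite /= in_itv/= andbT patchE => -[[q _]|].
        case: ifPn => // rq [Xq Mx]; have [_ _ XN] := HN q.
        have [Ix qx] : S q x by rewrite -XN; left.
        by rewrite mem_set; [exact: lt_trans qx|split].
      by case: ifPn => // r0 Kx; rewrite memNset.
  apply: measurableU.
    apply: bigcupT_measurable_rat => q; case: ifP => // _.
    by apply: measurableD => //; have [] := HN q.
  by case: ifP => // _; exact: measurableC.
- by move=> x Ix; rewrite patchE memNset// => -[].
exists M; split => // x [Ix]; rewrite patchE; apply: contra_notP => Mx.
by rewrite mem_set.
Qed.

(** On the two open intervals the kernel is [hk e]; on the rest of [I11] one has [|u - t| <= e] and
    [hk e] is 0, while off [I11] the representative vanishes. *)
Lemma HT_leb (g : LebesgueR R -> R) G t e : measurable_fun I11 g -> Borel_rep g G ->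
  integr G -> I11 t -> 0 < e ->
  \int[leb]_(x in `]-1, t - e[%classic) (g x * (x - t)^-1) +
  \int[leb]_(x in `]t + e, 1[%classic) (g x * (x - t)^-1) = HT e G t.
Proof.
move=> mg [mG G0 gG] IG It e0.
pose L : set (measurableTypeR R) := `]-1, t - e[%classic.
pose U : set (measurableTypeR R) := `]t + e, 1[%classic.
have mL : measurable L by exact: measurable_itv.
have mU : measurable U by exact: measurable_itv.
move: (It); rewrite /I11/= in_itv/= => /andP[t1 t2].
have LI : L `<=` I11 by move=> x; rewrite /L/I11/= !in_itv/= => /andP[-> ?]/=; lra.
have UI : U `<=` I11 by move=> x; rewrite /U/I11/= !in_itv/= => /andP[? ->]; rewrite andbT; lra.
have Lt u : L u -> e < `|u - t|.
  by rewrite /L/= in_itv/= => /andP[? ?]; rewrite ltr0_norm; lra.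
have Ut u : U u -> e < `|u - t|.
  by rewrite /U/= in_itv/= => /andP[? ?]; rewrite gtr0_norm; lra.
have mhk : measurable_fun [set: measurableTypeR R] (fun x : R => hk e x t).
  exact: (measurable_kernel2 t (measurable_hk e0)).
have mGh : measurable_fun [set: measurableTypeR R] (fun x : R => G x * hk e x t).
  exact: measurable_funM.
have key (D : set R) : measurable (D : set (measurableTypeR R)) -> D `<=` I11 ->
    (forall u, D u -> e < `|u - t|) ->
    \int[leb]_(x in D) (g x * (x - t)^-1) = \int[mu]_u ((fun u => G u * hk e u t) \_ D) u.
  move=> mD DI De; rewrite -Rintegral_mkcond /Rintegral.
  have mD' : measurable (D : set (LebesgueR R)) by exact: measurable_leb.
  have mGi : measurable_fun (D : set (measurableTypeR R)) (fun x => (G x * hk e x t)%:E).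
    exact/measurable_EFinP/measurable_funTS.
  rewrite -(integral_leb mD mGi); congr fine.
  transitivity (\int[leb]_(x in D) (g x * hk e x t)%:E)%E.
    by apply: eq_integral => u /[!inE] Du; rewrite /hk De.
  apply: ae_eq_integral; first exact: mD'.
  - apply/measurable_EFinP; apply: measurable_funM.
      exact: measurable_funS measurable_I11 DI mg.
    by apply: measurable_fun_leb => //; exact: measurable_funTS.
  - exact: measurable_fun_leb.
  - apply: negligibleS (negligible_leb gG) => x /= /not_implyP[Dx neq]; split.
      exact: DI.
    by apply: contra_not neq => ->.
have IL (D : set (measurableTypeR R)) : measurable D ->
    integr ((fun u => G u * hk e u t) \_ D).
  move=> mD; apply: (@le_integrable_real _ _ (fun u => `|G u * hk e u t|)).
  - by apply/(measurable_restrictT _ _).1 => //; exact: measurable_funTS.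
  - exact/integr_norm/integr_fhk.
  - by move=> u; rewrite patchE; case: ifPn => // _; rewrite normr0.
rewrite !key// -RintD; [|exact: IL|exact: IL].
rewrite /HT; apply: eq_Rintegral => u _; rewrite !patchE.
have [uI|uI] := pselect (I11 u); last first.
  by rewrite G0// mul0r !if_same addr0.
have [uL|uL] := pselect (L u).
  rewrite mem_set// memNset ?addr0//; move: uL.
  by rewrite /U/L/= !in_itv/= => /andP[_ ?] /andP[? _]; lra.
rewrite memNset// add0r; have [uU|uU] := pselect (U u); first by rewrite mem_set.
rewrite memNset// /hk ifF ?mulr0//; apply/negP => eu.
move: uI uL uU; rewrite /I11 /L /U/= !in_itv/= => /andP[-> ->]/=; rewrite andbT.
move=> /negP; rewrite -leNgt => h1 /negP; rewrite -leNgt => h2.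
by move: eu; rewrite ltNge ler_norml; move/negP; case; apply/andP; lra.
Qed.

End transfer.

(** * The complex finite Hilbert transform *)

Section complex_limit.
Context {R : realType}.

Lemma divc_real (z : R[i]) (r : R) : z / r%:C = (Re z * r^-1) +i* (Im z * r^-1).
Proof. by rewrite -fmorphV; case: z => a b /=; simpc. Qed.

Lemma cvg_complex (T : Type) (F : set_system T) {FF : Filter F} (u v : T -> R) (a b : R) :
  u e @[e --> F] --> a -> v e @[e --> F] --> b ->
  (u e +i* v e : R[i]^o) @[e --> F] --> (a +i* b : R[i]^o).
Proof.
move=> ua vb; apply/cvgrPdist_lt => -[r s]; rewrite ltcE/= => /andP[/eqP -> r0].
have r20 : 0 < r / 2 by rewrite divr_gt0.
move/cvgrPdist_lt : ua => /(_ _ r20) ua; move/cvgrPdist_lt : vb => /(_ _ r20) vb.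
near=> e; have ue : `|a - u e| < r / 2 by near: e.
have ve : `|b - v e| < r / 2 by near: e.
change ((normc ((a +i* b) - (u e +i* v e)))%:C < r%:C); rewrite ltcR.
by rewrite (le_lt_trans (normc_le _))//=; lra.
Unshelve. all: by end_near. Qed.

End complex_limit.

Section representation.
Context {R : realType}.
Local Notation I11 := (@I11 R).
Local Notation leb := (@leb R).
Local Notation mu := (@lebesgue_measure R).
Local Notation integr f := (mu.-integrable [set: measurableTypeR R] (EFin \o f)).
Implicit Types (f g : LebesgueR R -> R[i]) (F G : R -> R).

Definition crep f F G :=
  Borel_rep (fun x => Re (f x)) F /\ Borel_rep (fun x => Im (f x)) G.

Lemma truncated_rep f F G t e : cmeasurable I11 f -> crep f F G ->
  integr F -> integr G -> I11 t -> 0 < e ->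
  truncated_fht f t e = (pi^-1 * HT e F t) +i* (pi^-1 * HT e G t).
Proof.
move=> [mr mi] [rF rG] IF IG It e0.
rewrite -(HT_leb mr rF IF It e0) -(HT_leb mi rG IG It e0) /truncated_fht /cintegral.
have reE D : \int[leb]_(x in D) Re (f x / ((x : R) - t)%:C) =
    \int[leb]_(x in D) (Re (f x) * ((x : R) - t)^-1).
  by apply: eq_Rintegral => x _; rewrite divc_real.
have imE D : \int[leb]_(x in D) Im (f x / ((x : R) - t)%:C) =
    \int[leb]_(x in D) (Im (f x) * ((x : R) - t)^-1).
  by apply: eq_Rintegral => x _; rewrite divc_real.
by rewrite !reE !imE; simpc.
Qed.

Lemma fht_cvg f F G t a b : cmeasurable I11 f -> crep f F G ->
  integr F -> integr G -> I11 t ->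
  HT e F t @[e --> 0^'+] --> a -> HT e G t @[e --> 0^'+] --> b ->
  truncated_fht f t e @[e --> 0^'+] --> ((pi^-1 * a) +i* (pi^-1 * b) : R[i]^o).
Proof.
move=> mf rf IF IG It Fa Gb.
have h : ((pi^-1 * HT e F t) +i* (pi^-1 * HT e G t) : R[i]^o) @[e --> 0^'+] -->
    ((pi^-1 * a) +i* (pi^-1 * b) : R[i]^o).
  by apply: cvg_complex; apply: cvgMl_tmp.
apply: cvg_trans h; apply: near_eq_cvg; near=> e.
by rewrite (truncated_rep mf rf)//; near: e; exact: nbhs_right_gt.
Unshelve. all: by end_near. Qed.

Lemma fht_lim f t (z : R[i]) :
  truncated_fht f t e @[e --> 0^'+] --> (z : R[i]^o) -> fht f t = z.
Proof. by move=> h; apply: cvg_lim h; exact: norm_hausdorff. Qed.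

End representation.

(** * Representatives, limits and constants for complex functions *)

Section fht_limits.
Context {R : realType}.
Local Notation I11 := (@I11 R).
Local Notation leb := (@leb R).
Local Notation mu := (@lebesgue_measure R).
Local Notation integr f := (mu.-integrable [set: measurableTypeR R] (EFin \o f)).
Implicit Types (f g : LebesgueR R -> R[i]) (F G : R -> R).
Let J : set (measurableTypeR R) := `]-1, 1[%classic.

Lemma Borel_repZ (u : LebesgueR R -> R) U c : Borel_rep u U ->
  Borel_rep (fun x => c * u x) (fun x => c * U x).
Proof.
move=> [mU U0 nU]; split; first exact: measurable_funM.
  by move=> x /U0 ->; rewrite mulr0.
by apply: negligibleS nU => x /= [Ix n]; split => // h; apply: n; rewrite h.
Qed.

Lemma Borel_repD (u v : LebesgueR R -> R) U V : Borel_rep u U -> Borel_rep v V ->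
  Borel_rep (fun x => u x + v x) (fun x => U x + V x).
Proof.
move=> [mU U0 nU] [mV V0 nV]; split; first exact: measurable_funD.
  by move=> x Ix; rewrite U0// V0// addr0.
apply: negligibleS (negligibleU nU nV) => x /= [Ix n].
apply: contrapT => /not_orP[/not_andP[//|/contrapT h1] /not_andP[//|/contrapT h2]].
by apply: n; rewrite h1 h2.
Qed.

Lemma crep_lin (a b : R[i]) f g F G F' G' : crep f F G -> crep g F' G' ->
  crep (fun x => a * f x + b * g x)
    (fun x => (Re a * F x + - Im a * G x) + (Re b * F' x + - Im b * G' x))
    (fun x => (Im a * F x + Re a * G x) + (Im b * F' x + Re b * G' x)).
Proof.
move=> [fF fG] [gF gG]; split.
  rewrite (_ : (fun x => Re _) = fun x => (Re a * Re (f x) + - Im a * Im (f x)) +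
      (Re b * Re (g x) + - Im b * Im (g x))); last first.
    apply/funext => x; rewrite !mulNr -!ReM.
    by case: (a * f x) => ? ?; case: (b * g x).
  by apply: Borel_repD; apply: Borel_repD; exact: Borel_repZ.
rewrite (_ : (fun x => Im _) = fun x => (Im a * Re (f x) + Re a * Im (f x)) +
    (Im b * Re (g x) + Re b * Im (g x))); last first.
  apply/funext => x; rewrite ![Im _ * _ + _]addrC -!ImM.
  by case: (a * f x) => ? ?; case: (b * g x).
by apply: Borel_repD; apply: Borel_repD; exact: Borel_repZ.
Qed.

Lemma cmeasurable_lin (D : set (LebesgueR R)) (a b : R[i]) f g :
  cmeasurable D f -> cmeasurable D g -> cmeasurable D (fun x => a * f x + b * g x).
Proof.
move=> [mf mf'] [mg mg']; split.
  rewrite (_ : (fun x => Re _) = fun x => (Re a * Re (f x) + - Im a * Im (f x)) +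
      (Re b * Re (g x) + - Im b * Im (g x))); last first.
    apply/funext => x; rewrite !mulNr -!ReM.
    by case: (a * f x) => ? ?; case: (b * g x).
  by apply: measurable_funD; apply: measurable_funD; exact: measurable_funM.
rewrite (_ : (fun x => Im _) = fun x => (Im a * Re (f x) + Re a * Im (f x)) +
    (Im b * Re (g x) + Re b * Im (g x))); last first.
  apply/funext => x; rewrite ![Im _ * _ + _]addrC -!ImM.
  by case: (a * f x) => ? ?; case: (b * g x).
by apply: measurable_funD; apply: measurable_funD; exact: measurable_funM.
Qed.

Lemma measurable_normc (D : set (LebesgueR R)) f : cmeasurable D f ->
  measurable_fun D (fun x => normc (f x)).
Proof.
move=> [mr mi]; rewrite (_ : (fun x => _) = fun x =>
  Num.sqrt (Re (f x) ^+ 2 + Im (f x) ^+ 2)); last by apply/funext => x; case: (f x).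
apply: (measurableT_comp (f := @Num.sqrt R)).
  by apply: continuous_measurable_fun; exact: sqrt_continuous.
by apply: measurable_funD; exact: measurable_funX.
Qed.

Lemma Borel_rep_modular (h : LebesgueR R -> R) f F (lam : R) : 0 < lam ->
  measurable_fun I11 h -> (forall x, `|h x| <= normc (f x)) -> Borel_rep h F ->
  (\int[leb]_(x in I11) (phi (normc (f x) / lam))%:E <= 4%:E)%E ->
  (\int[mu]_(x in J) (phi (`|F x| / lam))%:E <= 4%:E)%E.
Proof.
move=> lam0 mh hf [mF F0 hF]; apply: le_trans.
have mJ : measurable J by exact: measurable_itv.
have p0 (x : R) : 0 <= x -> 0 <= phi (x / lam) by move=> x0; rewrite phi_ge0// divr_ge0// ltW.
have mphi : measurable_fun [set: measurableTypeR R] (fun x : R => phi (`|x| / lam)).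
  by apply: measurable_phi; apply: measurable_funM => //; exact: measurableT_comp.
have mphiF : measurable_fun J
    (fun x => (phi (`|F x| / lam))%:E).
  by apply/measurable_EFinP/measurable_funTS; exact: (measurableT_comp mphi mF).
rewrite -ge0_integral_leb//; last by move=> x _; rewrite lee_fin p0.
apply: (@le_trans _ _ (\int[leb]_(x in I11) (phi (`|h x| / lam))%:E)%E).
  rewrite le_eqVlt; apply/orP; left; apply/eqP; apply: ae_eq_integral.
  - exact: measurable_I11.
  - by apply: measurable_fun_leb => //; exact: measurable_itv.
  - by apply/measurable_EFinP; exact: (measurableT_comp mphi mh).
  - apply: negligibleS (negligible_leb hF) => x /= /not_implyP[Ix neq]; split => //.
    by apply: contra_not neq => ->.
apply: ge0_le_integral_nomeas => x _; first by rewrite lee_fin p0.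
rewrite lee_fin phi_le ?divr_ge0 ?(ltW lam0)//.
by rewrite ler_wpM2r ?hf// invr_ge0 ltW.
Qed.

(** Young's inequality at [r = 1] dominates [|F|] by its modular density plus a constant on a
    bounded interval. *)
Lemma Borel_rep_integr (h : LebesgueR R -> R) F (lam : R) : (0 < lam)%R -> Borel_rep h F ->
  (\int[mu]_(x in J) (phi (`|F x| / lam))%:E <= 4%:E)%E -> integr F.
Proof.
move=> lam0 [mF F0 _] H.
have mI : measurable J by exact: measurable_itv.
have mphi : measurable_fun [set: measurableTypeR R] (fun x : R => phi (`|F x| / lam)).
  by apply: measurable_phi; apply: measurable_funM => //; exact: measurableT_comp.
have p0 x : 0 <= phi (`|F x| / lam) by rewrite phi_ge0// divr_ge0// ltW.
apply: (@le_integrable_real _ _ (fun x =>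
    lam * ((fun x => phi (`|F x| / lam)) \_ J x + expR 1 * \1_J x))) => //.
- apply/integrZ/integrD; last exact/integrZ/(integrable_indic_itv (-1) 1 false true).
  apply/integrableP; split.
    by apply/measurable_EFinP/(measurable_restrictT _ _).1 => //; exact: measurable_funTS.
  apply: (le_lt_trans _ (ltry 4)); apply: le_trans H; rewrite [leRHS]integral_mkcond.
  apply: ge0_le_integral_nomeas => x _; first exact: abse_ge0.
  by rewrite /= !patchE; case: ifPn => //= _; rewrite ?normr0// ger0_norm.
- move=> x; rewrite patchE indicE.
  have [xI|] := boolP (x \in J); last first.
    by rewrite notin_setE => /F0 ->; rewrite normr0 mulr0 addr0 mulr0.
  have := young_phi 1 (divr_ge0 (normr_ge0 (F x)) (ltW lam0)).
  move/(ler_wpM2l (ltW lam0)); rewrite mulr1.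
  rewrite (mulrC lam (`|F x| / lam)) -mulrA mulVf ?gt_eqF// !mulr1.
  by [].
Qed.

Lemma LlogLnorm_ge0 f : (0 <= LlogLnorm f)%E.
Proof.
apply: integral_ge0 => t; rewrite /= in_itv/= => /andP[t0 t2]; apply: mule_ge0.
  by apply: le_ereal_inf_tmp => _ [l [l0 _] <-]; rewrite lee_fin.
rewrite lee_fin ln_ge0// ler_pdivlMr// mul1r.
have := @expR_ge1Dx R 1; lra.
Qed.

(** 2 for real and imaginary part, [1 + pi] from [HT_L1_le], and [68 = 4 + 64] with modular bound
    4. *)
Definition fht_const : R := 2 * ((1 + pi) * (delta^-1 * 68)).

(** Real and imaginary parts have separate representatives and a common exceptional set. [HF] and
    [HG] are limits without the factor [pi^-1]. *)
Record fht_limit f F G (HF HG : R -> R) (N : set R) : Prop := FhtLimit {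
  fl_rep : crep f F G;
  fl_intF : integr F; fl_intG : integr G;
  fl_mF : measurable_fun [set: measurableTypeR R] HF;
  fl_mG : measurable_fun [set: measurableTypeR R] HG;
  fl_negl : mu.-negligible N;
  fl_cvgF : forall t, I11 t -> ~ N t -> HT e F t @[e --> 0^'+] --> HF t;
  fl_cvgG : forall t, I11 t -> ~ N t -> HT e G t @[e --> 0^'+] --> HG t }.

Lemma fht_limit_exists f (lam : R) : cmeasurable I11 f -> 0 < lam ->
  (LlogLnorm f <= lam%:E)%E -> exists F G HF HG N, fht_limit f F G HF HG N /\
  (\int[mu]_(t in J) (`|HF t| + `|HG t|)%:E <= (fht_const * lam)%:E)%E.
Proof.
move=> mf lam0 flam; have [mr mi] := mf.
have mJ : measurable J by exact: measurable_itv.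
have M := modular_le_LlogL (measurable_normc mf) lam0 flam.
have [F rF] := Borel_rep_exists mr; have [G rG] := Borel_rep_exists mi.
have MF := Borel_rep_modular lam0 mr (fun x => Re_le_normc (f x)) rF M.
have MG := Borel_rep_modular lam0 mi (fun x => Im_le_normc (f x)) rG M.
have IF := Borel_rep_integr lam0 rF MF; have IG := Borel_rep_integr lam0 rG MG.
have [_ F0 _] := rF; have [_ G0 _] := rG.
have [HF [mHF LF NF]] := HT_limit IF lam0 F0 MF.
have [HG [mHG LG NG]] := HT_limit IG lam0 G0 MG.
exists F, G, HF, HG, ([set t | I11 t /\ ~ (HT e F t @[e --> 0^'+] --> HF t)] `|`
  [set t | I11 t /\ ~ (HT e G t @[e --> 0^'+] --> HG t)]); split.
  split => //; first exact: negligibleU.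
  - by move=> t It /not_orP[+ _]; apply: contra_notP => n.
  - by move=> t It /not_orP[_]; apply: contra_notP => n.
under eq_integral do rewrite EFinD.
rewrite ge0_integralD//; last 2 first.
- by apply/measurable_funTS/measurable_EFinP; exact: measurableT_comp.
- by apply/measurable_funTS/measurable_EFinP; exact: measurableT_comp.
rewrite (le_trans (leeD LF LG))// -EFinD lee_fin /fht_const.
by rewrite le_eqVlt; apply/orP; left; apply/eqP; ring.
Qed.

Lemma fht_limitE f F G HF HG N t : cmeasurable I11 f -> fht_limit f F G HF HG N ->
  I11 t -> ~ N t ->
  truncated_fht f t e @[e --> 0^'+] --> ((pi^-1 * HF t) +i* (pi^-1 * HG t) : R[i]^o).
Proof.
move=> mf [r iF iG _ _ _ cF cG] It Nt.
exact: (fht_cvg mf r iF iG It (cF _ It Nt) (cG _ It Nt)).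
Qed.

End fht_limits.

(** * Measurability, boundedness and linearity *)

Section fht.
Context {R : realType}.
Local Notation I11 := (@I11 R).
Local Notation leb := (@leb R).
Local Notation mu := (@lebesgue_measure R).
Local Notation integr f := (mu.-integrable [set: measurableTypeR R] (EFin \o f)).
Implicit Types (f g : LebesgueR R -> R[i]) (F G : R -> R).
Let J : set (measurableTypeR R) := `]-1, 1[%classic.

Lemma LlogL_scale f (r : R) : in_LlogL f -> 0 < r ->
  (LlogLnorm f <= (fine (LlogLnorm f) + r)%:E)%E /\ 0 < fine (LlogLnorm f) + r.
Proof.
move=> [_ foo] r0; have f0 := LlogLnorm_ge0 f.
split; last by rewrite ltr_wpDl// fine_ge0.
by rewrite EFinD fineK ?ge0_fin_numE// leeDl// lee_fin ltW.
Qed.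

Lemma LlogL_fht_limit f : in_LlogL f -> exists F G HF HG N, fht_limit f F G HF HG N.
Proof.
move=> Lf; have [h r0] := LlogL_scale Lf ltr01.
have [F [G [HF [HG [N [L _]]]]]] := fht_limit_exists Lf.1 r0 h.
by exists F, G, HF, HG, N.
Qed.

(** [fht f] is known only off a null set, where it agrees with Borel functions; completeness of
    [leb] then gives measurability. *)
Lemma cmeasurable_fht f F G HF HG N : cmeasurable I11 f -> fht_limit f F G HF HG N ->
  cmeasurable I11 (fht f).
Proof.
move=> mf L; have mI := @measurable_I11 R.
have cmpl := @completed_lebesgue_measure_is_complete R.
have aeE (p : R[i] -> R) (H : R -> R) : measurable_fun [set: measurableTypeR R] H ->
    (forall t, I11 t -> ~ N t -> p (fht f t) = pi^-1 * H t) ->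
    measurable_fun I11 (fun t => p (fht f t)).
  move=> mH pH; apply/measurable_EFinP.
  apply: (ae_measurable_fun cmpl (f := fun t : LebesgueR R => (pi^-1 * H t)%:E)).
    apply: negligibleS (negligible_leb (fl_negl L)) => t /= /not_implyP[It neq].
    by apply: contrapT => Nt; apply: neq; rewrite /= pH.
  apply: measurable_fun_leb; first exact: measurable_itv.
  by apply/measurable_EFinP/measurable_funTS; exact: measurable_funM.
split; [apply: aeE (fl_mF L) _|apply: aeE (fl_mG L) _] => t It Nt;
  by rewrite (fht_lim (fht_limitE mf L It Nt)).
Qed.

Lemma L1norm_fht_le f (lam : R) : cmeasurable I11 f -> (0 < lam)%R ->
  (LlogLnorm f <= lam%:E)%E -> (L1norm (fht f) <= (fht_const * lam)%:E)%E.
Proof.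
move=> mf lam0 flam.
have [F [G [HF [HG [N [L LL]]]]]] := fht_limit_exists mf lam0 flam.
have mJ : measurable J by exact: measurable_itv.
have mH : measurable_fun J (fun t => (`|HF t| + `|HG t|)%:E).
  apply/measurable_EFinP/measurable_funTS; apply: measurable_funD.
    by apply: measurableT_comp => //; exact: fl_mF L.
  by apply: measurableT_comp => //; exact: fl_mG L.
have h0 t : J t -> (0 <= (`|HF t| + `|HG t|)%:E)%E by rewrite lee_fin addr_ge0.
apply: le_trans LL; rewrite -(ge0_integral_leb mJ mH h0).
apply: ae_ge0_le_integral.
- exact: measurable_I11.
- by move=> t _; rewrite lee_fin normc_ge0.
- by apply/measurable_EFinP/measurable_normc; exact: cmeasurable_fht L.
- by move=> t _; rewrite lee_fin addr_ge0.
- exact: measurable_fun_leb.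
apply: negligibleS (negligible_leb (fl_negl L)) => t /= /not_implyP[It neq].
apply: contrapT => Nt; apply: neq; rewrite lee_fin (fht_lim (fht_limitE mf L It Nt)).
rewrite (le_trans (normc_le _))//= !normrM.
have p1 : `|pi^-1| <= 1 :> R.
  by rewrite ger0_norm ?invr_ge0 ?pi_ge0// invf_le1 ?pi_gt0// (le_trans _ (pi_ge2 R))//; lra.
by rewrite lerD// ler_piMl.
Qed.

Lemma fht_const_ge0 : 0 <= @fht_const R.
Proof.
have d0 : 0 <= (@delta R)^-1 * 68.
  by apply: mulr_ge0 => //; rewrite invr_ge0 (ltW delta_gt0).
have p1 : 0 <= 1 + pi :> R by have := pi_ge0 R; lra.
by rewrite /fht_const; apply: mulr_ge0 => //; exact: mulr_ge0.
Qed.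

(** The scale [lam] must be positive although the norm may vanish, so the bound is used at norm plus
    [r], and [r] tends to 0. *)
Lemma L1norm_fht_bound f : in_LlogL f ->
  (L1norm (fht f) <= (@fht_const R)%:E * LlogLnorm f)%E.
Proof.
move=> Lf; have f0 := LlogLnorm_ge0 f; have c0 := fht_const_ge0.
rewrite -[X in (_ * X)%E]fineK ?ge0_fin_numE//; last by case: Lf.
set n := fine _; apply/lee_addgt0Pr => e e0.
have r0 : 0 < e / (@fht_const R + 1) by rewrite divr_gt0// ltr_wpDl.
have [h l0] := LlogL_scale Lf r0.
apply: le_trans (L1norm_fht_le Lf.1 l0 h) _; rewrite -EFinM -EFinD lee_fin.
rewrite -/n mulrDr lerD2l mulrA ler_pdivrMr ?ltr_wpDl// mulrC ler_wpM2l ?(ltW e0)//.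
by rewrite lerDl.
Qed.

Lemma HT_lin2 F G F' G' (c1 c2 c3 c4 : R) t (a b a' b' : R) :
  integr F -> integr G -> integr F' -> integr G' ->
  HT e F t @[e --> 0^'+] --> a -> HT e G t @[e --> 0^'+] --> b ->
  HT e F' t @[e --> 0^'+] --> a' -> HT e G' t @[e --> 0^'+] --> b' ->
  HT e (fun x => (c1 * F x + c2 * G x) + (c3 * F' x + c4 * G' x)) t @[e --> 0^'+] -->
    (c1 * a + c2 * b) + (c3 * a' + c4 * b').
Proof.
move=> iF iG iF' iG' Fa Gb Fa' Gb'.
have h : (c1 * HT e F t + c2 * HT e G t) + (c3 * HT e F' t + c4 * HT e G' t) @[e --> 0^'+]
    --> (c1 * a + c2 * b) + (c3 * a' + c4 * b').
  by apply: cvgD; apply: cvgD; apply: cvgMl_tmp.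
apply: cvg_trans h; apply: near_eq_cvg; near=> e.
have e0 : 0 < e by near: e; exact: nbhs_right_gt.
rewrite (HTD t e0); [|by apply: integrD; exact: integrZ|by apply: integrD; exact: integrZ].
rewrite (HTD t e0); [|exact: integrZ|exact: integrZ].
rewrite (HTD t e0); [|exact: integrZ|exact: integrZ].
by rewrite !HTZ.
Unshelve. all: by end_near. Qed.

(** The combination of the Borel representatives represents the combination of [f] and [g], and its
    limits follow from linearity of [HT]; no triangle inequality for [LlogLnorm] enters. *)
Lemma fht_linear (a b : R[i]) f g : in_LlogL f -> in_LlogL g ->
  fht (fun x => a * f x + b * g x) =
    (fun t => a * fht f t + b * fht g t) %[ae leb in I11].
Proof.
move=> Lf Lg; have [F [G [HF [HG [N Lf']]]]] := LlogL_fht_limit Lf.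
have [F' [G' [HF' [HG' [N' Lg']]]]] := LlogL_fht_limit Lg.
apply: negligibleS (negligible_leb (negligibleU (fl_negl Lf') (fl_negl Lg'))) => t /=.
move=> /not_implyP[It neq]; apply: contrapT => /not_orP[Nt N't]; apply: neq.
rewrite (fht_lim (fht_limitE Lf.1 Lf' It Nt)) (fht_lim (fht_limitE Lg.1 Lg' It N't)).
have [r1 iF iG _ _ _ cF cG] := Lf'; have [r2 iF' iG' _ _ _ cF' cG'] := Lg'.
have c1 := cF t It Nt; have c2 := cG t It Nt; have c3 := cF' t It N't.
have c4 := cG' t It N't.
have ilin (k1 k2 k3 k4 : R) :
    integr (fun x => (k1 * F x + k2 * G x) + (k3 * F' x + k4 * G' x)).
  by apply: integrD; apply: integrD; exact: integrZ.
have := fht_cvg (cmeasurable_lin a b Lf.1 Lg.1) (crep_lin a b r1 r2) (ilin _ _ _ _)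
  (ilin _ _ _ _) It (HT_lin2 iF iG iF' iG' c1 c2 c3 c4)
  (HT_lin2 iF iG iF' iG' c1 c2 c3 c4).
move/fht_lim => ->; case: a b => [a1 a2] [b1 b2] /=; simpc.
by congr (_ +i* _); ring.
Qed.

(** The Borel representatives of [f] also represent [g], so both transforms are the same limits. *)
Lemma fht_ae_eq f g : in_LlogL f -> in_LlogL g -> f = g %[ae leb in I11] ->
  fht f = fht g %[ae leb in I11].
Proof.
move=> Lf Lg fg; have [F [G [HF [HG [N L]]]]] := LlogL_fht_limit Lf.
have [[[mF F0 nF] [mG G0 nG]] iF iG _ _ _ cF cG] := L.
have fg' := leb_negligible fg.
have rg : crep g F G.
  split; split => //.
    apply: negligibleS (negligibleU fg' nF) => x /= [Ix n].
    by apply: contrapT => /not_orP[/contrapT h1 /not_andP[//|/contrapT h2]]; apply: n;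
      rewrite -h1.
  apply: negligibleS (negligibleU fg' nG) => x /= [Ix n].
  by apply: contrapT => /not_orP[/contrapT h1 /not_andP[//|/contrapT h2]]; apply: n;
    rewrite -h1.
apply: negligibleS (negligible_leb (fl_negl L)) => t /= /not_implyP[It neq].
apply: contrapT => Nt; apply: neq.
rewrite (fht_lim (fht_limitE Lf.1 L It Nt)); apply/esym/fht_lim.
exact: (fht_cvg Lg.1 rg iF iG It (cF t It Nt) (cG t It Nt)).
Qed.

End fht.

Theorem theorem2p1 (R : realType) :
  [/\ (* T is defined on L log L and takes values in L^1 *)
      forall f : LebesgueR R -> R[i], in_LlogL f ->
        (\forall t \ae @leb R, I11 t -> fht_exists f t) /\ in_L1 (fht f),
      (* T is well defined on classes of a.e. equal functions *)
      forall f g : LebesgueR R -> R[i], in_LlogL f -> in_LlogL g ->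
        f = g %[ae @leb R in @I11 R] ->
        fht f = fht g %[ae @leb R in @I11 R],
      (* T is linear *)
      forall (a b : R[i]) (f g : LebesgueR R -> R[i]),
        in_LlogL f -> in_LlogL g ->
        fht (fun x => a * f x + b * g x) =
          (fun t => a * fht f t + b * fht g t) %[ae @leb R in @I11 R]
    & (* T is bounded *)
      exists C : R, forall f : LebesgueR R -> R[i], in_LlogL f ->
        (L1norm (fht f) <= C%:E * LlogLnorm f)%E].
Proof.
split.
- move=> f Lf; have [F [G [HF [HG [N L]]]]] := LlogL_fht_limit Lf; split.
    apply: negligibleS (negligible_leb (fl_negl L)) => t /= /not_implyP[It nex].
    apply: contrapT => Nt; apply: nex; apply/cvg_ex; eexists.
    exact: fht_limitE Lf.1 L It Nt.
  split; first exact: cmeasurable_fht Lf.1 L.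
  rewrite (le_lt_trans (L1norm_fht_bound Lf))//.
  rewrite -[X in (_ * X)%E]fineK ?ge0_fin_numE ?LlogLnorm_ge0//; last by case: Lf.
  by rewrite -EFinM ltry.
- exact: fht_ae_eq.
- exact: fht_linear.
- by exists fht_const => f; exact: L1norm_fht_bound.
Qed.
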